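(* Let $\mathfrak{g}$ be a finite-dimensional Lie algebra with trivial center over a field $\mathbb{K}$ of characteristic $0$, let $\Gamma$ be an m.c.r. Lie subalgebra of $e(\mathrm{ad}\,\mathfrak{g})$, and let $\mathfrak{g}=\mathfrak{s}\oplus\mathfrak{k}\oplus\mathfrak{m}$ be the associated $\Gamma$-decomposition. Let $\mu:\mathfrak{k}\to\mathfrak{gl}(\mathfrak{m})$, $\mu(x)=\mathrm{ad}\,x|_{\mathfrak{m}}$, and let $\mathfrak{B}=(\mathrm{Der}\,\hat{\mathfrak{n}})^{\Gamma}|_{\mathfrak{m}}$, where $\hat{\mathfrak{n}}$ is the Lie subalgebra of $\mathfrak{g}$ generated by $\mathfrak{m}$. The sequence of normalizers $$\mu(\mathfrak{k})\lhd \mathrm{N}^1_{\mathfrak{B}}(\mu(\mathfrak{k}))\lhd\cdots\lhd \mathrm{N}^n_{\mathfrak{B}}(\mu(\mathfrak{k}))\lhd\cdots\lhd\widehat{\mathrm{N}_{\mathfrak{B}}}(\mu(\mathfrak{k}))$$ contained in $\mathfrak{B}$ terminates at $\widehat{\mathrm{N}_{\mathfrak{B}}}(\mu(\mathfrak{k}))=\mathrm{N}^q_{\mathfrak{B}}(\mu(\mathfrak{k}))$ for some integer $q$ such that $\mathrm{N}^{q+1}_{\mathfrak{B}}(\mu(\mathfrak{k}))=\mathrm{N}^q_{\mathfrak{B}}(\mu(\mathfrak{k}))$. The derivation tower $(\mathfrak{g}_n)$ of $\mathfrak{g}$ (with each $\mathfrak{g}_n$ identified with the ideal $\mathrm{ad}\,\mathfrak{g}_n$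 of $\mathfrak{g}_{n+1}$) is given by the Lie subalgebras $$\mathfrak{g}_n=\mathfrak{s}\oplus\mathrm{N}^n_{\mathfrak{B}}(\mu(\mathfrak{k}))\oplus\mathfrak{m}$$ of the Lie algebra $\mathfrak{s}\oplus\mathfrak{B}\oplus\mathfrak{m}$, and it terminates at $\widehat{\mathfrak{g}}:=\mathfrak{s}\oplus\widehat{\mathrm{N}_{\mathfrak{B}}}(\mu(\mathfrak{k}))\oplus\mathfrak{m}$; thus $\widehat{\mathfrak{g}}$ is complete.
   Context: A Lie algebra is complete if its center is trivial and all its derivations are inner. The derivation tower of $\mathfrak{g}$ is $\mathfrak{g}_0=\mathfrak{g}$, $\mathfrak{g}_{n+1}=\mathrm{Der}(\mathfrak{g}_n)$; if $Z(\mathfrak{g})=0$ then all $Z(\mathfrak{g}_n)=0$, and $\mathfrak{g}_n\cong\mathrm{ad}\,\mathfrak{g}_n$ is regarded as an ideal of $\mathfrak{g}_{n+1}$. $e(\mathrm{ad}\,\mathfrak{g})$ is the smallest algebraic Lie subalgebra of $\mathfrak{gl}(\mathfrak{g})$ containing $\mathrm{ad}\,\mathfrak{g}$. A Lie subalgebra of $\mathfrak{gl}(\mathfrak{g})$ is completely reducible (c.r.) if its natural action on $\mathfrak{g}$ is semisimple; an m.c.r. subalgebra of $e(\mathrm{ad}\,\mathfrak{g})$ is one maximal among the c.r. subalgebras contained in $e(\mathrm{ad}\,\mathfrak{g})$. The $\Gamma$-decomposition $\mathfrak{g}=\mathfrak{s}\oplus\mathfrak{k}\oplus\mathfrak{m}$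 associated with $\Gamma$ is the one for which $\mathfrak{s}$ is a Levi subalgebra; $\mathfrak{k}$ is a nilpotent Lie subalgebra with $[\mathfrak{s},\mathfrak{k}]=0$; $\mathfrak{m}$ is a subspace of the radical $\mathfrak{r}$ with $\mathfrak{r}=\mathfrak{m}\oplus\mathfrak{k}$ and $[\mathfrak{s}\oplus\mathfrak{k},\mathfrak{m}]=\mathfrak{m}$; and $\Gamma=\mathrm{ad}\,\mathfrak{s}\oplus(\mathrm{ad}\,\mathfrak{k})|_{\mathrm S}$, where $(\mathrm{ad}\,\mathfrak{k})|_{\mathrm S}$ is the set of semisimple Jordan components of elements of $\mathrm{ad}\,\mathfrak{k}$. $\hat{\mathfrak{n}}$ is a $\Gamma$-stable nilpotent ideal of $\mathfrak{g}$; $(\mathrm{Der}\,\hat{\mathfrak{n}})^{\Gamma}$ is the set of derivations of $\hat{\mathfrak{n}}$ commuting with the restriction of $\Gamma$ to $\hat{\mathfrak{n}}$; these stabilize $\mathfrak{m}$, and $\mathfrak{B}$ is the Lie algebra of their restrictions to $\mathfrak{m}$. Since $Z(\mathfrak{g})=0$, $\mu$ is injective. The Lie algebra $\mathfrak{s}\oplus\mathfrak{B}\oplus\mathfrak{m}$ has the bilinear skew-symmetric law $\Phi$ given, for $x_i\in\mathfrak{s}$, $y_i\in\mathfrak{B}$, $z_i\in\mathfrak{m}$, by $\Phi(x_1,x_2+y_2+z_2)=[x_1,x_2]+[x_1,z_2]$, $\Phi(y_1,y_2+z_2)=y_1y_2-y_2y_1+y_1\cdot z_2$, $\Phi(z_1,z_2)=\mu(k)+m$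 with $k,m$ the projections of $[z_1,z_2]$ to $\mathfrak{k}$ and $\mathfrak{m}$; $\mathfrak{g}$ is identified with its subalgebra $\mathfrak{s}\oplus\mu(\mathfrak{k})\oplus\mathfrak{m}$ via $s+k+m\mapsto s+\mu(k)+m$. For a Lie subalgebra $\mathcal{A}\subset\mathfrak{B}$: $\mathrm{N}^0_{\mathfrak{B}}(\mathcal{A})=\mathcal{A}$ and $\mathrm{N}^{p+1}_{\mathfrak{B}}(\mathcal{A})$ is the normalizer of $\mathrm{N}^p_{\mathfrak{B}}(\mathcal{A})$ in $\mathfrak{B}$; $\widehat{\mathrm{N}_{\mathfrak{B}}}(\mathcal{A})$ is the stationary value of this sequence. *)

(* Defs.v *)
From HB Require Import structures.
From mathcomp Require Import all_boot ssralg vector.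
From mathcomp Require Import mpoly.

Set Implicit Arguments.
Unset Strict Implicit.
Unset Printing Implicit Defensive.

Import GRing.Theory.
Local Open Scope ring_scope.

Section LinearAlgebra.
Variable K : fieldType.

Section Hom.
Variables V W : vectType K.

Definition ev_fun (x : V) (f : 'Hom(V, W)) : W := f x.

Lemma ev_is_linear x : linear (ev_fun x).
Proof. by move=> a f g; rewrite /ev_fun add_lfunE scale_lfunE. Qed.
HB.instance Definition _ x := GRing.isLinear.Build K _ _ _ _ (ev_is_linear x).

Definition evl (x : V) : 'Hom('Hom(V, W), W) := linfun (ev_fun x).

Lemma evlE x f : evl x f = f x. Proof. by rewrite lfunE. Qed.

Lemma evl_is_linear : linear evl.
Proof. by move=> a x y; apply/lfunP=> f; rewrite add_lfunE scale_lfunE !evlE linearP. Qed.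

End Hom.
Arguments evl {V W} x.
Arguments evlE {V W}.

(** The subspace { w | F x w \in T for all x \in U }; it is computed on a basis
    of U, which is adequate when F is linear (lemma [mem_transp]). *)
Section Transporter.
Variables V A B : vectType K.

Definition transp (U : {vspace V}) (T : {vspace B}) (F : V -> 'Hom(A, B)) :
    {vspace A} :=
  (\bigcap_(i < \dim U) (F (vbasis U)`_i @^-1: T))%VS.

Lemma mem_transp U T F w : linear F ->
  w \in transp U T F <-> (forall x, x \in U -> F x w \in T).
Proof.
move=> linF; rewrite memvE; split=> [/subv_bigcapP h x xU|h]; last first.
  apply/subv_bigcapP=> i _; rewrite -memvE -memv_preim.
  by apply: h; apply: vbasis_mem; rewrite mem_nth ?size_tuple.
pose F' : {linear V -> 'Hom(A, B)} :=
  HB.pack F (GRing.isLinear.Build K V 'Hom(A, B) *:%R F linF).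
rewrite -[F]/(F' : V -> _) (coord_vbasis xU) linear_sum sum_lfunE memv_suml // => i _.
rewrite linearZ scale_lfunE memvZ //= memv_preim memvE; exact: h.
Qed.

End Transporter.

Section Transporter2.
Variables V1 V2 A B : vectType K.

Definition transp2 (U1 : {vspace V1}) (U2 : {vspace V2}) (T : {vspace B})
    (F : V1 -> V2 -> 'Hom(A, B)) : {vspace A} :=
  (\bigcap_(i < \dim U1) transp U2 T (F (vbasis U1)`_i))%VS.

Lemma mem_transp2 U1 U2 T F w :
    (forall y, linear (F^~ y)) -> (forall x, linear (F x)) ->
  w \in transp2 U1 U2 T F <->
  (forall x y, x \in U1 -> y \in U2 -> F x y w \in T).
Proof.
move=> linl linr; rewrite memvE; split=> [/subv_bigcapP h x y xU yU|h]; last first.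
  apply/subv_bigcapP=> i _; rewrite -memvE; apply/mem_transp=> // y yU.
  by apply: h => //; apply: vbasis_mem; rewrite mem_nth ?size_tuple.
have: w \in transp U1 T (F^~ y).
  rewrite memvE; apply/subv_bigcapP=> i _; rewrite -memvE -memv_preim.
  by move: (h i isT); rewrite -memvE mem_transp //; apply.
by rewrite mem_transp //; apply.
Qed.

End Transporter2.

Section Endomorphisms.
Variable V : vectType K.
Implicit Types (f g : 'End(V)) (A U W : {vspace V}).

Definition stable (A : {vspace 'End(V)}) U :=
  forall f, f \in A -> (f @: U <= U)%VS.

Definition completely_reducible (A : {vspace 'End(V)}) :=
  forall U, stable A U ->
    exists W, [/\ stable A W, (U + W)%VS = fullv & (U :&: W)%VS = 0%VS].

Definition semisimple_end f := completely_reducible <[f]>%VS.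

Definition nilpotent_end f :=
  exists n, iter n (fun g => (f \o g)%VF) \1%VF = 0.

Definition semisimple_part f (S : 'End(V)) :=
  exists N : 'End(V), [/\ semisimple_end S, nilpotent_end N,
                          (S \o N)%VF = (N \o S)%VF & f = S + N].

Definition gl_bracket f g : 'End(V) := ((f \o g) - (g \o f))%VF.

End Endomorphisms.

(** Restriction of an endomorphism of V to the subspace U: z |-> f z.  When f
    does not stabilise U, f z is replaced by its image under [vsproj U]. *)
Section Restriction.
Variables (V : vectType K) (U : {vspace V}).

Definition restr_fun (f : 'End(V)) : 'End(subvs_of U) :=
  (linfun (vsproj U) \o f \o linfun vsval)%VF.

Lemma restr_is_linear : linear restr_fun.
Proof.
move=> a f g; apply/lfunP=> x.
by rewrite add_lfunE scale_lfunE !comp_lfunE add_lfunE scale_lfunE !linearP.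
Qed.
HB.instance Definition _ := GRing.isLinear.Build K _ _ _ _ restr_is_linear.

Definition restr : 'Hom('End(V), 'End(subvs_of U)) := linfun restr_fun.

Lemma restrE f (z : subvs_of U) : restr f z = vsproj U (f (vsval z)).
Proof. by rewrite lfunE /= !comp_lfunE !lfunE. Qed.

End Restriction.

(** Polynomial functions on a vector space are written in the coordinates of a
    fixed basis.  An algebraic group is a Zariski closed subgroup G of GL(V)
    (a group of K-points), and its Lie algebra is the tangent space at the
    identity cut out by the differentials of all polynomials vanishing on G.
    In characteristic 0 the K-points of a connected linear algebraic K-group are
    Zariski dense, so that the resulting class of algebraic Lie algebras is the
    same as the one obtained from algebraic K-groups. *)

Section Algebraic.

Definition peval (V : vectType K) (p : {mpoly K[\dim {:V}]}) (v : V) : K :=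
  p.@[fun i => coord (vbasis {:V}) i v].

Definition pdiff (V : vectType K) (p : {mpoly K[\dim {:V}]}) (v w : V) : K :=
  \sum_(i < \dim {:V}) peval (mderiv i p) v * coord (vbasis {:V}) i w.

Variable V : vectType K.

Definition algebraic_group (G : 'End(V) -> Prop) :=
  [/\ G \1%VF,
      forall f g, G f -> G g -> G (f \o g)%VF,
      forall f, G f -> G (f^-1)%VF
    & exists P : {mpoly K[\dim {:'End(V)}]} -> Prop,
        forall f, G f <-> lker f = 0%VS /\ (forall p, P p -> peval p f = 0)].

Definition group_lie_algebra (G : 'End(V) -> Prop) (X : 'End(V)) :=
  forall p, (forall f, G f -> peval p f = 0) -> pdiff p \1%VF X = 0.

Definition algebraic (E : {vspace 'End(V)}) :=
  exists2 G, algebraic_group G & forall X, X \in E <-> group_lie_algebra G X.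

Definition algebraic_hull (A E : {vspace 'End(V)}) :=
  [/\ algebraic E, (A <= E)%VS
    & forall E', algebraic E' -> (A <= E')%VS -> (E <= E')%VS].

End Algebraic.
End LinearAlgebra.
Arguments evl {K V W} x.

Definition lie_law (K : fieldType) (L : vectType K) (br : L -> L -> L) : Prop :=
  [/\ forall y, linear (br^~ y),
      forall x, linear (br x),
      forall x, br x x = 0
    & forall x y z, br x (br y z) + br y (br z x) + br z (br x y) = 0].

HB.mixin Record Vector_isLie (K : fieldType) L of Vector K L := {
  lie : L -> L -> L;
  lieP : lie_law lie
}.

#[short(type="lieAlgType")]
HB.structure Definition LieAlgebra (K : fieldType) :=
  {L of Vector_isLie K L & Vector K L}.

Definition lie_of_law (K : fieldType) (V : vectType K) (br : V -> V -> V)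
    (brP : lie_law br) : lieAlgType K :=
  HB.pack (Vector.sort V) (Vector_isLie.Build K V brP).

Lemma lie_of_lawE (K : fieldType) (V : vectType K) (br : V -> V -> V)
    (brP : lie_law br) (x y : lie_of_law brP) : lie x y = br x y.
Proof. by []. Qed.

Lemma gl_lie_law (K : fieldType) (V : vectType K) : lie_law (@gl_bracket K V).
Proof.
rewrite /gl_bracket; split.
- move=> g a f h; rewrite comp_lfunDl -comp_lfunZl comp_lfunDr -comp_lfunZr.
  by rewrite scalerBr opprD addrACA.
- move=> g a f h; rewrite comp_lfunDl -comp_lfunZl comp_lfunDr -comp_lfunZr.
  by rewrite scalerBr opprD addrACA.
- by move=> f; rewrite subrr.
move=> f g h.
apply/lfunP=> x; rewrite !(add_lfunE, opp_lfunE, comp_lfunE, zero_lfunE, linearB) /=.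
rewrite !opprK !addrA [LHS](ACl ((1*11)*(2*8)*(3*5)*(4*10)*(6*12)*(7*9))) /=.
by rewrite !subrr !addNr !addr0.
Qed.
HB.instance Definition _ (K : fieldType) (V : vectType K) :=
  Vector_isLie.Build K 'End(V) (gl_lie_law V).

Section LieTheory.
Variables (K : fieldType) (L : lieAlgType K).
Implicit Types (x y z : L) (U V I : {vspace L}) (D : 'End(L)).

Lemma lie_is_linear x : linear (lie x).
Proof. by case: (@lieP K L) => _ + _ _; apply. Qed.
HB.instance Definition _ x := GRing.isLinear.Build K _ _ _ _ (lie_is_linear x).

Lemma liexx x : lie x x = 0.
Proof. by case: (@lieP K L). Qed.

Lemma lieDZl y : linear (lie^~ y).
Proof. by case: (@lieP K L) => + _ _ _; apply. Qed.

Lemma lieC x y : lie x y = - lie y x.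
Proof.
have lD (u v w : L) : lie (u + v) w = lie u w + lie v w.
  by have := lieDZl w 1 u v; rewrite !scale1r.
apply/eqP; rewrite -addr_eq0; apply/eqP.
by have := liexx (x + y); rewrite lD !raddfD /= !liexx add0r addr0.
Qed.

Lemma lieBl x y z : lie (x - y) z = lie x z - lie y z.
Proof. by rewrite !(lieC _ z) linearB opprB opprK addrC. Qed.

Lemma jacobi x y z : lie x (lie y z) + lie y (lie z x) + lie z (lie x y) = 0.
Proof. by case: (@lieP K L). Qed.

Definition adx x : 'End(L) := linfun (lie x).

Lemma adx_is_linear : linear adx.
Proof.
by move=> a x y; apply/lfunP=> z; rewrite add_lfunE scale_lfunE !lfunE /= lieDZl.
Qed.
HB.instance Definition _ := GRing.isLinear.Build K _ _ _ _ adx_is_linear.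

Definition ad : 'Hom(L, 'End(L)) := linfun adx.

Lemma adE x y : ad x y = lie x y.
Proof. by rewrite lfunE /= lfunE. Qed.

Definition lie_vs U V : {vspace L} :=
  <<[seq lie x y | x <- vbasis U, y <- vbasis V]>>%VS.

Definition lie_subalg U := forall x y, x \in U -> y \in U -> lie x y \in U.

Definition lie_ideal I U :=
  (I <= U)%VS /\ forall x y, x \in U -> y \in I -> lie x y \in I.

Definition lie_generated V U :=
  [/\ lie_subalg U, (V <= U)%VS
    & forall U', lie_subalg U' -> (V <= U')%VS -> (U <= U')%VS].

Definition lie_solvable U := exists n, iter n (fun V => lie_vs V V) U = 0%VS.
Definition lie_nilpotent U := exists n, iter n (lie_vs U) U = 0%VS.

Definition lie_radical I :=
  [/\ lie_ideal I fullv, lie_solvable I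
    & forall J, lie_ideal J fullv -> lie_solvable J -> (J <= I)%VS].

Definition levi_subalg U :=
  lie_subalg U /\
  exists2 I, lie_radical I & (U + I)%VS = fullv /\ (U :&: I)%VS = 0%VS.

Definition trivial_center U :=
  forall x, x \in U -> (forall y, y \in U -> lie x y = 0) -> x = 0.

(** A derivation of a subalgebra U is encoded by any endomorphism of the whole
    space that restricts to it. *)
Definition derivation_on U D :=
  (forall x, x \in U -> D x \in U) /\
  (forall x y, x \in U -> y \in U -> D (lie x y) = lie (D x) y + lie x (D y)).

Definition lie_complete U :=
  trivial_center U /\
  forall D, derivation_on U D ->
    exists2 x, x \in U & forall y, y \in U -> D y = lie x y.

(** D |-> D[x, y] - [D x, y] - [x, D y] *)
Definition leibniz x y : 'Hom('End(L), L) :=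
  evl (lie x y) + (ad y \o evl x)%VF - (ad x \o evl y)%VF.

Lemma leibnizE x y D :
  leibniz x y D = D (lie x y) - (lie (D x) y + lie x (D y)).
Proof.
rewrite /leibniz add_lfunE opp_lfunE add_lfunE !comp_lfunE !adE !evlE.
by rewrite (lieC y) opprD addrA.
Qed.

Lemma leibniz_linearl y : linear (leibniz^~ y).
Proof.
move=> a x x'; apply/lfunP=> D; rewrite leibnizE [RHS]add_lfunE [in RHS]scale_lfunE !leibnizE.
by rewrite lieDZl !linearP /= !lieDZl scalerBr scalerDr !opprD !addrA;
  rewrite [LHS](ACl (1*3*5*2*4*6)).
Qed.

Lemma leibniz_linearr x : linear (leibniz x).
Proof.
move=> a y y'; apply/lfunP=> D; rewrite leibnizE [RHS]add_lfunE [in RHS]scale_lfunE !leibnizE.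
by rewrite !linearP /= scalerBr scalerDr !opprD !addrA;
  rewrite [LHS](ACl (1*3*5*2*4*6)).
Qed.

Definition der_on U : {vspace 'End(L)} :=
  (transp U U evl :&: transp2 U U 0%VS leibniz)%VS.

Lemma mem_der_on U D : D \in der_on U <-> derivation_on U D.
Proof.
rewrite memv_cap; split=> [/andP[] | [DU DL]].
  rewrite mem_transp; last exact: evl_is_linear.
  rewrite mem_transp2; [|exact: leibniz_linearl|exact: leibniz_linearr].
  move=> DU DL; split=> [x /DU|x y xU yU]; first by rewrite evlE.
  by have := DL x y xU yU; rewrite memv0 leibnizE subr_eq0 => /eqP.
apply/andP; split.
  by rewrite mem_transp => [x|]; [rewrite evlE; exact: DU|exact: evl_is_linear].
rewrite mem_transp2; [|exact: leibniz_linearl|exact: leibniz_linearr].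
by move=> x y xU yU; rewrite memv0 leibnizE DL ?subrr.
Qed.

Definition comm_fun (g : 'End(L)) x : 'Hom('End(L), L) :=
  evl (g x) - (g \o evl x)%VF.

Lemma comm_funE g x D : comm_fun g x D = D (g x) - g (D x).
Proof. by rewrite /comm_fun add_lfunE opp_lfunE comp_lfunE !evlE. Qed.

Definition commutant_on U (G : {vspace 'End(L)}) : {vspace 'End(L)} :=
  transp2 G U 0%VS comm_fun.

Lemma mem_commutant_on U G D :
  D \in commutant_on U G <->
  (forall g x, g \in G -> x \in U -> D (g x) = g (D x)).
Proof.
rewrite mem_transp2; last 2 first.
- move=> x a g g'; apply/lfunP=> f; rewrite comm_funE [RHS]add_lfunE [in RHS]scale_lfunE !comm_funE.
  rewrite !(add_lfunE, scale_lfunE) linearP /= scalerBr opprD !addrA.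
  by rewrite [LHS](ACl (1*3*2*4)).
- move=> g a x x'; apply/lfunP=> f; rewrite comm_funE [RHS]add_lfunE [in RHS]scale_lfunE !comm_funE.
  by rewrite !linearP /= scalerDr !addrA [LHS](ACl (1*3*2*4)).
split=> h g x gG xU.
  by have := h g x gG xU; rewrite memv0 comm_funE subr_eq0 => /eqP.
by rewrite memv0 comm_funE h // subrr.
Qed.

Definition normalizer (B A : {vspace L}) : {vspace L} :=
  (B :&: transp A A ad)%VS.

Lemma mem_normalizer B A x :
  x \in normalizer B A <-> (x \in B /\ forall y, y \in A -> lie x y \in A).
Proof.
rewrite memv_cap; split=> [/andP[-> h]|[-> h]]; last first.
  rewrite mem_transp => [y yA|]; last exact: linearP.
  by rewrite adE lieC memvN h.
split=> // y yA; move: h; rewrite mem_transp => [h|]; last exact: linearP.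
by rewrite lieC memvN -adE h.
Qed.

Definition iter_normalizer (B A : {vspace L}) n : {vspace L} :=
  iter n (normalizer B) A.

End LieTheory.
Arguments ad {K L}.

Lemma gl_lieE (K : fieldType) (V : vectType K) (f g : 'End(V)) x :
  lie f g x = f (g x) - g (f x).
Proof. by rewrite [LHS]add_lfunE opp_lfunE !comp_lfunE. Qed.

Section Subalgebra.
Variables (K : fieldType) (L : lieAlgType K) (U : {vspace L}).

Definition sub_lie (x y : subvs_of U) : subvs_of U :=
  vsproj U (lie (vsval x) (vsval y)).

Lemma sub_lie_law : lie_subalg U -> lie_law sub_lie.
Proof.
move=> subU; have subE x y : vsval (sub_lie x y) = lie (vsval x) (vsval y).
  by rewrite vsprojK // subU ?subvsP.
split=> [y a x x'|x a y y'|x|x y z]; apply: val_inj.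
- by rewrite /= !subE /= lieDZl.
- by rewrite /= !subE /= linearP.
- by rewrite /= subE liexx.
by rewrite /= !subE jacobi.
Qed.

End Subalgebra.

Section DerivationAlgebra.
Variables (K : fieldType) (L : lieAlgType K).

Definition Der := subvs_of (der_on {:L}).

Lemma lie_subalg_Der : lie_subalg (der_on {:L}).
Proof.
move=> f g /mem_der_on[_ fL] /mem_der_on[_ gL]; apply/mem_der_on.
split=> [x _|x y _ _]; first exact: memvf.
rewrite !gl_lieE gL ?fL ?memvf // !linearD /= !fL ?gL ?memvf //.
rewrite lieBl linearN /= !opprD !addrA.
by rewrite [LHS](ACl (1*5*4*8*(2*7)*(3*6))) /= !subrr !addr0.
Qed.

HB.instance Definition _ := Vector.on Der.
HB.instance Definition _ :=
  Vector_isLie.Build K Der (sub_lie_law lie_subalg_Der).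

Lemma ad_derivation (x : L) : ad x \in der_on {:L}.
Proof.
apply/mem_der_on; split=> [y _|y z _ _]; first exact: memvf.
rewrite !adE; have /eqP := jacobi x y z.
by rewrite (lieC z x) (lieC z (lie x y)) linearN -addrA -opprD subr_eq0 addrC => /eqP->.
Qed.

Definition ad_der (x : L) : Der := Subvs (ad_derivation x).

End DerivationAlgebra.

Fixpoint derivation_tower (K : fieldType) (L : lieAlgType K) n : lieAlgType K :=
  if n is n'.+1 then Der (derivation_tower L n') else L.

Section GammaDecomposition.
Variables (K : fieldType) (L : lieAlgType K).
Implicit Types (E Gam : {vspace 'End(L)}) (s k m nhat : {vspace L}).

Definition mcr_subalg E Gam :=
  [/\ lie_subalg Gam, completely_reducible Gam, (Gam <= E)%VS
    & forall Gam', lie_subalg Gam' -> completely_reducible Gam' ->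
        (Gam' <= E)%VS -> (Gam <= Gam')%VS -> Gam' = Gam].

Record gamma_decomposition Gam s k m : Prop := {
  gd_levi : levi_subalg s;
  gd_k_subalg : lie_subalg k;
  gd_k_nilpotent : lie_nilpotent k;
  gd_sk : lie_vs s k = 0%VS;
  gd_radical : exists2 r, lie_radical r &
    (m + k)%VS = r /\ (m :&: k)%VS = 0%VS;
  gd_m : lie_vs (s + k)%VS m = m;
  gd_Gam : exists T : {vspace 'End(L)},
    [/\ forall S, S \in T <-> (exists2 y, y \in k & semisimple_part (ad y) S),
        Gam = (ad @: s + T)%VS
      & (ad @: s :&: T)%VS = 0%VS]
}.

Definition mu m : 'Hom(L, 'End(subvs_of m)) := (restr m \o ad)%VF.

(** The restrictions to m of the derivations of nhat that commute with Gam and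
    stabilise m *)
Definition gammaB Gam m nhat : {vspace 'End(subvs_of m)} :=
  (restr m @: (der_on nhat :&: commutant_on nhat Gam :&: transp m m evl))%VS.

Lemma mem_gammaB Gam m nhat f :
  f \in gammaB Gam m nhat <->
  exists D : 'End(L),
    [/\ derivation_on nhat D,
        forall g x, g \in Gam -> x \in nhat -> D (g x) = g (D x)
      & forall z : subvs_of m, vsval (f z) = D (vsval z)].
Proof.
have linev : linear (@evl K L L) by exact: evl_is_linear.
split=> [/memv_imgP[D]|[D [derD commD Df]]].
  move=> /memv_capP[/memv_capP[derD commD] Dm] ->.
  exists D; split; [exact/mem_der_on | exact/mem_commutant_on | move=> z].
  move: Dm; rewrite mem_transp // => Dm.
  by rewrite restrE vsprojK // -evlE Dm ?subvsP.
have -> : f = restr m D.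
  by apply/lfunP=> z; apply: val_inj; rewrite /= restrE -Df vsprojK ?subvsP.
apply: memv_img; apply/memv_capP; split.
  by apply/memv_capP; split; [exact/mem_der_on | exact/mem_commutant_on].
rewrite mem_transp // => z zm.
by rewrite evlE -(vsprojK zm) -Df subvsP.
Qed.

End GammaDecomposition.

(** The vector space s (+) B (+) m, with its law Phi, for a decomposition
    L = s (+) k (+) m and a Lie subalgebra B of gl(m) that contains mu(k); the
    maps [vsproj] only change the type of elements that are already in s, B, m. *)
Section Extension.
Variables (K : fieldType) (L : lieAlgType K) (s k m : {vspace L}).
Variable B : {vspace 'End(subvs_of m)}.

Definition ext : vectType K := (subvs_of s * subvs_of B * subvs_of m)%type.

(** [daddv_pi k (s + m)] is the projection onto k along s (+) m. *)
Definition Phi (u v : ext) : ext :=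
  let: (x1, y1, z1) := u in
  let: (x2, y2, z2) := v in
  let w := lie (vsval z1) (vsval z2) in
  (sub_lie x1 x2,
   sub_lie y1 y2 + vsproj B (mu m (daddv_pi k (s + m) w)),
   vsproj m (lie (vsval x1) (vsval z2)) - vsproj m (lie (vsval x2) (vsval z1))
     + (vsval y1 z2 - vsval y2 z1)
     + vsproj m (daddv_pi m (s + k) w)).

Definition ext_B (u : ext) : 'End(subvs_of m) := vsval u.1.2.

Lemma ext_B_is_linear : linear ext_B.
Proof. by []. Qed.
HB.instance Definition _ := GRing.isLinear.Build K _ _ _ _ ext_B_is_linear.

(** The subspace s (+) A (+) m, for A contained in B *)
Definition ext_sub (A : {vspace 'End(subvs_of m)}) : {vspace ext} :=
  (linfun ext_B @^-1: A)%VS.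

Lemma mem_ext_sub A (x : subvs_of s) (y : subvs_of B) (z : subvs_of m) :
  ((x, y, z) : ext) \in ext_sub A = (vsval y \in A).
Proof. by rewrite -memv_preim lfunE. Qed.

End Extension.

Definition lie_morphism (K : fieldType) (L1 L2 : lieAlgType K) (f : 'Hom(L1, L2)) :=
  forall x y, f (lie x y) = lie (f x) (f y).

(* Main.v *)
(* Let mu(k) <= A <= B be subalgebras and let D be a derivation of
   h = s + A + m. By Whitehead's lemma for s, and by Fitting decompositions with
   respect to ad y for y in k, subtracting an inner derivation makes D vanish on
   s and commute with the semisimple parts of ad k. Then D preserves A, the
   Gamma-invariants of h, and maps m = Gamma m into s + m. The s-component of D
   on m is zero: D maps the solvable ideal generated by m onto an ideal of s
   modulo A + m, and the Leibniz formula for D^(2^i) on the i-th derived algebra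
   shows that this ideal is solvable. So D restricts on m to an element of B
   that normalizes A, and D is the restriction of an inner derivation of
   s + N_B(A) + m. Since the centralizer of g in s + B + m is zero, this
   identifies Der h with s + N_B(A) + m, and the tower follows by induction.

   The law Phi satisfies the Jacobi identity because an element of B extends to a
   derivation of nhat commuting with Gamma, which therefore preserves the
   components in k (killed by Gamma) and in m (spanned by Gamma m). *)
Require Import Defs.
From HB Require Import structures.
From Stdlib Require Import Classical_Prop.
From mathcomp Require Import all_boot ssralg vector poly polydiv separable ssrint ssrnum order matrix mxalgebra mxpoly fieldext.
From mathcomp Require Import ring.

Set Implicit Arguments.
Unset Strict Implicit.
Unset Printing Implicit Defensive.

Import Order.TTheory GRing.Theory Num.Theory.
Local Open Scope ring_scope.

(** * Jordan decomposition *)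

(** The semisimple part of [ad y], for y in k, need not be inner on s + A + m, so a derivation D is
    made to commute with it only through [ad y] itself. Fitting's lemma for [ad y], on the space of
    elements killed by s and by the semisimple parts treated so far, yields an inner correction
    after which some power of [ad y] kills D y. Then a power of ad (ad y) kills D, and D commutes
    with the semisimple part of [ad y]. Restricting to that space is what keeps the earlier
    normalizations.

    Eigenvalues are avoided: Jordan decomposition and semisimplicity are handled over K through
    separable polynomials. Only Cartan's criterion passes to a splitting field; it supplies the
    Casimir operator for Whitehead's lemma, which is proved without Weyl's theorem.

    The members of the tower are different types, so the induction is about an arbitrary Lie algebra
    H with an injective morphism j into s + B + m of image s + A + m. *)

Section SeparablePart.
Variable K : fieldType.
Hypothesis charK : [pchar K] =i pred0.
Implicit Types p q h : {poly K}.

Lemma natr_pchar0_neq0 n : (n.+1%:R : K) != 0.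
Proof. by have /pcharf0P-> := charK. Qed.

Lemma deriv_pchar0_neq0 p : (1 < size p)%N -> p^`() != 0.
Proof.
move=> p1; apply/eqP=> /polyP/(_ (size p).-2); rewrite coef_deriv coef0 => /eqP.
rewrite prednK; last by rewrite -ltnS prednK // ltnW.
rewrite -mulr_natl mulf_eq0 -lead_coefE lead_coef_eq0 -size_poly_eq0.
by case: (size p) p1 => [|[|n]] //= _; rewrite orbF (negPf (natr_pchar0_neq0 n)).
Qed.

(** In characteristic 0 a polynomial fails to be separable only through a square factor w^2. If q =
    v w^2, then v w has smaller degree and q divides (v w)^2, so the exponent doubles at each
    descent. *)
Lemma separable_radical q : q != 0 ->
  exists p n, separable_poly p /\ q %| p ^+ n.
Proof.
have [m] := ubnP (size q); elim: m q => // m IHm q ltqm q0.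
have [sq|nsq] := boolP (separable_poly q); first by exists q, 1%N; split.
have [w w1 wq] : exists2 w : {poly K}, size w != 1%N & w ^+ 2 %| q.
  apply: NNPP => nw; case/negP: nsq; apply/separable_polyP; split.
    apply/poly_square_freeP => u u1; apply/negP=> uq; apply: nw.
    by exists u.
  by move=> u _; exact: deriv_pchar0_neq0.
have [v def_q] := dvdpP _ _ wq.
move: q0; rewrite def_q expr2 !mulf_eq0 orbb negb_or => /andP[v0 w0].
have [||p [n [sp pn]]] := IHm (v * w).
- have w2 : (1 < size w)%N by rewrite ltn_neqAle eq_sym w1 size_poly_gt0.
  move: ltqm; rewrite def_q expr2 mulrA [X in (X < _)%N -> _]size_mul ?mulf_neq0 //.
  by move: w2; case: (size w) => [|[|a]] // _; rewrite !addnS /= ltnS; apply: leq_ltn_trans (leq_addr _ _).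
- by rewrite mulf_neq0.
exists p, (n + n)%N; split => //.
rewrite exprD; apply: dvdp_trans (dvdp_mul pn pn).
by rewrite mulrA dvdp_mul2l ?mulf_neq0 // dvdp_mulIr.
Qed.

Lemma comp_poly_taylor2 p h e : exists c,
  p \Po (h + e) = p \Po h + (p^`() \Po h) * e + e ^+ 2 * c.
Proof.
elim/poly_ind: p => [|p a [c IH]].
  by exists 0; rewrite deriv0 !comp_poly0 mul0r mulr0 !addr0.
exists (c * (h + e) + (p^`() \Po h)).
rewrite derivD derivC addr0 derivM derivX mulr1 !comp_polyD !comp_polyM.
rewrite !comp_polyC !comp_polyX IH; ring.
Qed.

(* Newton's iteration h := h - a(h) p(h), where a p' = 1 modulo p. *)
Lemma separable_lift p n : separable_poly p ->
  exists h, p %| h - 'X /\ p ^+ n %| p \Po h.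
Proof.
move=> sp; have /Bezout_eq1_coprimepP[[b a] /= ab]  : coprimep p p^`() by move: sp; rewrite unlock.
elim: n => [|n [h [hX hn]]].
  by exists 'X; rewrite subrr dvdp0 expr0 dvd1p.
(* A multiple of [p ^+ 0] says nothing about p dividing [p \Po h], so exponent 1 is obtained afresh
   from 'X; from then on each step squares the error. *)
case: n hn => [_|n hn].
  by exists 'X; rewrite subrr dvdp0 comp_polyXr.
exists (h - (a \Po h) * (p \Po h)).
have [c ->] := comp_poly_taylor2 p h (- ((a \Po h) * (p \Po h))).
have pph : p %| p \Po h by apply: dvdp_trans hn; rewrite dvdp_exp.
have -> : p \Po h + (p^`() \Po h) * - ((a \Po h) * (p \Po h)) +
    (- ((a \Po h) * (p \Po h))) ^+ 2 * c =
    (p \Po h) * (p \Po h) * ((b \Po h) + (a \Po h) ^+ 2 * c).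
  have E : (a \Po h) * (p^`() \Po h) = 1 - (b \Po h) * (p \Po h).
    have := congr1 (fun q => q \Po h) ab.
    by rewrite comp_polyD !comp_polyM comp_polyC addrC => /(canRL (addrK _)).
  have -> : (p^`() \Po h) * - ((a \Po h) * (p \Po h)) =
    - (((a \Po h) * (p^`() \Po h)) * (p \Po h)) by ring.
  by rewrite E; ring.
split; first by rewrite addrAC dvdp_sub // dvdp_mull.
apply: dvdp_mulr; apply: dvdp_trans (dvdp_mul hn hn).
by rewrite -exprD dvdp_exp2l // addSn ltnS addnS ltnS leq_addr.
Qed.

End SeparablePart.

Section HornerAlg.
Variables (K : fieldType) (A : algType K).
Implicit Types (a b x y : A) (p q : {poly K}).

Lemma comm_horner_alg a x p : GRing.comm x a -> GRing.comm x (horner_alg a p).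
Proof.
move=> xa; elim/poly_ind: p => [|p c IH]; first by rewrite rmorph0; exact: commr0.
rewrite rmorphD rmorphM /= horner_algX horner_algC.
apply: commrD; first exact: commrM.
by rewrite /GRing.comm -scalerAl mul1r -scalerAr mulr1.
Qed.

Lemma horner_alg_comp a p q : horner_alg (horner_alg a q) p = horner_alg a (p \Po q).
Proof.
elim/poly_ind: p => [|p c IH]; first by rewrite comp_poly0 !rmorph0.
rewrite comp_polyD comp_polyM comp_polyX comp_polyC !rmorphD !rmorphM /= -IH.
by rewrite !horner_algX !horner_algC.
Qed.

Lemma commutator_horner_alg a y w p :
  a * y - y * a = w -> GRing.comm w a ->
  horner_alg a p * y - y * horner_alg a p = horner_alg a p^`() * w.
Proof.
move=> def_w wa; elim/poly_ind: p => [|p c IH].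
  by rewrite deriv0 !rmorph0 !mul0r mulr0 subrr.
rewrite derivD derivC addr0 derivM derivX mulr1 !(rmorphD, rmorphM) /=.
rewrite horner_algX horner_algC mulrDl !mulrDr -scalerAl -scalerAr mul1r mulr1.
rewrite opprD addrACA subrr addr0 mulrDl -(mulrA _ a w) -wa mulrA -IH -def_w.
by rewrite !mulrBl !mulrBr -!mulrA [RHS]addrC addrA addrNK.
Qed.

(* [p(a) = 0] with [p] separable: [0 = p(a) y - y p(a) = p'(a) w], and [p'(a)]
   is invertible. *)
Lemma separable_ad_ker a y p :
  separable_poly p -> horner_alg a p = 0 ->
  GRing.comm (a * y - y * a) a -> a * y - y * a = 0.
Proof.
move=> sp pa wa; have := commutator_horner_alg p erefl wa.
have /Bezout_eq1_coprimepP[[u v] /= uv]  : coprimep p p^`() by move: sp; rewrite unlock.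
have := congr1 (horner_alg a) uv; rewrite rmorphD !rmorphM /= pa mulr0 add0r rmorph1.
by move=> h; rewrite mul0r mulr0 subrr => /esym/(congr1 ( *%R (horner_alg a v)));
  rewrite mulrA h mul1r mulr0.
Qed.

End HornerAlg.

Lemma nat_noninc_stable (d : nat -> nat) :
    (forall i, (d i.+1 <= d i)%N) ->
  forall m, exists2 n, (m <= n)%N & d n.+1 = d n.
Proof.
move=> dS m; have [k] := ubnP (d m); elim: k m => // k IHk m ltk.
have [eqd|ned] := eqVneq (d m.+1) (d m); first by exists m.
have [|n le_n dn] := IHk m.+1; last by exists n; rewrite // ltnW.
by rewrite -ltnS (leq_trans _ ltk) // ltnS ltn_neqAle ned dS.
Qed.

(** * Subspaces cut out by arbitrary properties, and Fitting's lemma *)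

Section Subspaces.
Variables (K : fieldType) (V : vectType K).
Implicit Types U W Z : {vspace V}.

Lemma vspace_max (P : {vspace V} -> Prop) U0 : P U0 ->
  exists U, [/\ P U, (U0 <= U)%VS
    & forall W, P W -> (U <= W)%VS -> W = U].
Proof.
have [m] := ubnP (\dim {:V} - \dim U0)%N; elim: m U0 => // m IHm U0 ltm PU0.
have [[W [PW U0W neW]]|nW] :=
  classic (exists W, [/\ P W, (U0 <= W)%VS & W <> U0]); last first.
  exists U0; split=> // W PW U0W; apply: NNPP => neW; apply: nW; by exists W.
have ltd : (\dim U0 < \dim W)%N.
  rewrite ltn_neqAle dimvS // andbT; apply/eqP=> eqd; apply: neW.
  by apply/esym/eqP; rewrite eqEdim U0W eqd leqnn.
have [|U [PU WU maxU]] := IHm W _ PW.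
  rewrite -ltnS; apply: leq_trans ltm; rewrite ltnS ltn_sub2l //.
  by apply: leq_trans ltd _; rewrite dimvS ?subvf.
by exists U; split=> //; apply: subv_trans WU.
Qed.

(** A maximal subspace contained in P is all of P, since a vector of P outside it could be adjoined.
    This allows subspaces defined by quantified conditions that no boolean test decides. *)
Lemma vspace_of_pred (P : V -> Prop) :
    P 0 -> (forall a u v, P u -> P v -> P (a *: u + v)) ->
  exists U : {vspace V}, forall x, x \in U <-> P x.
Proof.
move=> P0 PD.
have [|U [PU _ maxU]] := @vspace_max (fun U => forall x, x \in U -> P x) 0%VS.
  by move=> x; rewrite memv0 => /eqP->.
exists U => x; split=> [|Px]; first exact: PU.
rewrite -(maxU (U + <[x]>)%VS) ?addvSl //.
  by rewrite (subvP (addvSr _ _)) ?memv_line.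
move=> _ /memv_addP[u uU [_ /vlineP[a ->] ->]].
by rewrite addrC; apply: PD => //; apply: PU.
Qed.

(** The images X^i Z decrease and become stationary at some n, where X^n Z = X^(2n) Z. The lower
    bound m serves the callers, which need n positive or large. *)
Lemma fitting (X : 'End(V)) Z m :
    (forall z, z \in Z -> X z \in Z) ->
  exists2 n, (m <= n)%N & forall z, z \in Z ->
    exists a b, [/\ a \in Z, b \in Z, z = a + iter n X b & iter n X a = 0].
Proof.
move=> XZ; pose F i := iter i (lfun_img X) Z.
have FS i : (F i.+1 <= F i)%VS.
  elim: i => [|i IH]; last exact: limgS.
  by apply/subvP=> _ /memv_imgP[z zZ ->]; apply: XZ.
have memF i z : z \in F i <-> exists2 b, b \in Z & z = iter i X b.
  elim: i z => [|i IH] z; first by split=> [zZ|[b bZ ->]] //; exists z.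
  split=> [/memv_imgP[y /IH[b bZ ->] ->]|[b bZ ->]]; first by exists b.
  by apply: memv_img; apply/IH; exists b.
have [n le_mn eqn] := nat_noninc_stable (fun i => dimvS (FS i)) m.
have FE : F n.+1 = F n.
  by apply/eqP; rewrite eqEdim FS eqn leqnn.
have FnE k : F (k + n)%N = F n 
  by elim: k => // k IH; rewrite -[RHS]FE; apply: (congr1 (lfun_img X) IH).
exists n => // z zZ.
have : iter n X z \in F (n + n)%N by rewrite FnE; apply/memF; exists z.
case/memF => b bZ; rewrite iterD => def_b.
have bnZ : iter n X b \in Z by elim: (n) => //= k; apply: XZ.
exists (z - iter n X b), b; split=> //; first exact: memvB.
  by rewrite subrK.
have linX k u v : iter k X (u - v) = iter k X u - iter k X v.
  by elim: k => //= k ->; rewrite linearB.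
by rewrite linX def_b subrr.
Qed.

Lemma iter_lfunD (X : 'End(V)) n u v : iter n X (u + v) = iter n X u + iter n X v.
Proof. by elim: n => //= n ->; rewrite linearD. Qed.

Lemma iter_lfunB (X : 'End(V)) n u v : iter n X (u - v) = iter n X u - iter n X v.
Proof. by elim: n => //= n ->; rewrite linearB. Qed.

Lemma iter_lfun0 (X : 'End(V)) n : iter n X 0 = 0.
Proof. by elim: n => //= n ->; rewrite linear0. Qed.

Lemma iter_lfun_comm (X Y : 'End(V)) : (forall v, X (Y v) = Y (X v)) ->
  forall n v, iter n X (Y v) = Y (iter n X v).
Proof. by move=> XY; elim=> //= n IH v; rewrite IH XY. Qed.

Lemma iter_lfun_mem (X : 'End(V)) Z : (forall z, z \in Z -> X z \in Z) ->
  forall n z, z \in Z -> iter n X z \in Z.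
Proof. by move=> XZ; elim=> //= n IH z /IH/XZ. Qed.

Lemma nilpotent_endP (N : 'End(V)) :
  nilpotent_end N <-> exists n, forall v, iter n N v = 0.
Proof.
have itE n v : (iter n (fun g => (N \o g)%VF) \1%VF) v = iter n N v.
  by elim: n => [|n IH] /=; rewrite ?id_lfunE ?comp_lfunE ?IH.
split=> [[n n0]|[n n0]]; exists n; first by move=> v; rewrite -itE n0 zero_lfunE.
by apply/lfunP=> v; rewrite itE n0 zero_lfunE.
Qed.

(** The binomial argument for (F - G)^(m + n), run as an induction on m + n. Nilpotency is required
    at the single vector v only, which is what generalized kernels need. *)
Lemma iter_nilB (F G H : 'End(V)) : (forall v, F (G v) = G (F v)) ->
    (forall v, H v = F v - G v) ->
  forall m n v, iter m F v = 0 -> iter n G v = 0 -> iter (m + n) H v = 0.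
Proof.
move=> FG HE m n; move E: (m + n)%N => t; elim: t m n E => [|t IHt] m n E v.
  by move/eqP: E; rewrite addn_eq0 => /andP[/eqP-> _].
have GF v' : G (F v') = F (G v') by rewrite FG.
case: m E => [|m] E; first by move=> v0 _; rewrite [v]v0 iter_lfun0.
case: n E => [|n] E; first by move=> _ v0; rewrite [v]v0 iter_lfun0.
move=> Fv Gv; rewrite iterSr HE iter_lfunB.
have -> : iter t H (F v) = 0.
  apply: (IHt m n.+1); first by move: E; rewrite addSn => -[].
    by rewrite -iterSr.
  by rewrite (iter_lfun_comm GF) Gv linear0.
have -> : iter t H (G v) = 0.
  apply: (IHt m.+1 n); first by move: E; rewrite addnS => -[].
    by rewrite (iter_lfun_comm FG) Fv linear0.
  by rewrite -iterSr.
by rewrite subrr.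
Qed.

End Subspaces.

(** * Endomorphisms as an algebra, and polynomials in them *)

Section LfunAlg.
Variables (K : fieldType) (V : vectType K).
Hypothesis Vp : (0 < dim V)%N.
Local Notation A := (lfun_algType Vp).

Lemma lfun_alg_mulE (f g : A) (v : V) : ((f * g : A) : 'End(V)) v = (g : 'End(V)) ((f : 'End(V)) v).
Proof. by rewrite -comp_lfunE. Qed.

Lemma lfun_alg_expE (f : A) n (v : V) : ((f ^+ n : A) : 'End(V)) v = iter n (f : 'End(V)) v.
Proof.
elim: n v => [|n IH] v; first by rewrite expr0 /= id_lfunE.
by rewrite exprSr lfun_alg_mulE IH.
Qed.

Lemma lfun_alg_stable (f : A) (W : {vspace V}) :
    (forall w, w \in W -> (f : 'End(V)) w \in W) ->
  forall p w, w \in W -> (horner_alg f p : 'End(V)) w \in W.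
Proof.
move=> fW p w wW; elim/poly_ind: p => [|p c IH].
  by rewrite rmorph0 (@zero_lfunE K V V) mem0v.
rewrite rmorphD rmorphM /= horner_algX horner_algC (@add_lfunE K V V) lfun_alg_mulE.
by rewrite memvD ?fW // (@scale_lfunE K V V) memvZ ?id_lfunE.
Qed.

Lemma lfun_alg_annihilator (f : A) : exists2 p : {poly K}, p != 0 & horner_alg f p = 0.
Proof.
pose X : (\dim {:'End(V)}).+1.-tuple 'End(V) := [tuple (f ^+ i : A) : 'End(V) | i < _].
have nfree : ~~ free X.
  apply/negP; rewrite /free => /eqP E.
  have := dimvS (subvf <<X>>%VS); rewrite E size_tuple.
  by rewrite ltnn.
apply: NNPP => nP; case/negP: nfree; apply/freeP => k sum0 i.
pose p := \sum_(i < (\dim {:'End(V)}).+1) k i *: 'X^i : {poly K}.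
have p0 : p = 0.
  apply/eqP; apply/negP => /negP p0; apply: nP; exists p => //.
  rewrite raddf_sum /= -[RHS]sum0; apply: eq_bigr => j _.
  rewrite linearZ /= rmorphXn /= horner_algX mulr_algl.
  by rewrite (nth_map j) ?size_enum_ord // nth_ord_enum.
have := congr1 (fun q : {poly K} => q`_i) p0.
rewrite coef0 coef_sum (bigD1 i) //= big1 => [|j ji]; last first.
  by rewrite coefZ coefXn eq_sym (inj_eq val_inj) (negPf ji) mulr0.
by rewrite coefZ coefXn eqxx mulr1 addr0.
Qed.
End LfunAlg.

(** * Semisimplicity by separable polynomials; the Jordan decomposition over K *)

Section JordanDecomposition.
Variable K : fieldType.
Hypothesis charK : [pchar K] =i pred0.

Lemma ker2_iter (V : vectType K) (T : 'End(V)) :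
    (forall y, T (T y) = 0 -> T y = 0) ->
  forall n y, iter n T y = 0 -> T y = 0.
Proof.
move=> T2; elim=> [|n IH] y; first by move=> /= ->; rewrite linear0.
by case: n IH => [|n] IH //; rewrite !iterS => /T2 h; apply: IH.
Qed.

Section Alg.
Variable V : vectType K.
Hypothesis Vp : (0 < dim V)%N.
Local Notation A := (lfun_algType Vp).

(** For p the separable radical of an annihilating polynomial, P = p(S) is nilpotent. On a stable
    complement W of ker P it is both injective and nilpotent, so W = 0 and P = 0. *)
Lemma semisimple_separable (S : A) : semisimple_end (S : 'End(V)) ->
  exists2 p : {poly K}, separable_poly p & horner_alg S p = 0.
Proof.
move=> ssS; have [q q0 qS] := lfun_alg_annihilator S.
have [p [n [sp /dvdpP[r def_pn]]]] := separable_radical charK q0.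
exists p => //; pose P : 'End(V) := horner_alg S p.
have Pn0 v : iter n P v = 0.
  rewrite -[P]/((horner_alg S p : A) : 'End(V)) -lfun_alg_expE -rmorphXn /= def_pn.
  by rewrite rmorphM /= qS mulr0 (@zero_lfunE K V V).
have PS v : P ((S : 'End(V)) v) = (S : 'End(V)) (P v).
  have : GRing.comm S (horner_alg S p) by apply: comm_horner_alg.
  by move/(congr1 (fun f : A => (f : 'End(V)) v)); rewrite !lfun_alg_mulE.
have [|W [Wst UW UW0]] := ssS (lker P).
  move=> _ /vlineP[c ->]; apply/subvP=> _ /memv_imgP[v vP ->].
  by rewrite scale_lfunE memvZ // memv_ker PS (eqP (etrans (esym (memv_ker _ _)) vP)) linear0.
have WP w : w \in W -> P w \in W.
  apply: lfun_alg_stable => {}w wW.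
  by apply: (subvP (Wst _ (memv_line _))); apply: memv_img.
have Winj w : w \in W -> P w = 0 -> w = 0.
  by move=> wW Pw; apply/eqP; rewrite -memv0 -UW0 memv_cap memv_ker Pw eqxx.
have W0 w : w \in W -> w = 0.
  move=> wW; have := Pn0 w; elim: (n) w wW => // k IH w wW.
  by rewrite iterSr => /(IH _ (WP _ wW))/Winj; apply.
apply/lfunP=> v; rewrite (@zero_lfunE K V V).
have := memvf v; rewrite -UW => /memv_addP[u uP [w wW ->]].
by rewrite (W0 _ wW) addr0; apply/eqP; rewrite -memv_ker.
Qed.

Lemma separable_ad_ker2 (S : A) p (Y : 'End(V)) : separable_poly p -> horner_alg S p = 0 ->
  lie (S : 'End(V)) (lie (S : 'End(V)) Y) = 0 -> lie (S : 'End(V)) Y = 0.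
Proof.
move=> sp pS h; have E (Z : A) : lie (S : 'End(V)) (Z : 'End(V)) = (Z * S - S * Z : A) by [].
have E' : lie (S : 'End(V)) Y = - (S * (Y : A) - (Y : A) * S) by rewrite E opprB.
rewrite E' (separable_ad_ker sp pS) ?oppr0 //.
move: h; rewrite E' E mulNr mulrN opprK addrC => /eqP.
by rewrite subr_eq0 => /eqP.
Qed.

(** A projection e onto U is corrected to commute with S. The maps into U that vanish on U form an
    ad S-stable space containing [S, e]; a correction c in it makes e - c commute with S, and ker (e
    - c) is the stable complement. *)
Lemma separable_semisimple (S : A) p : separable_poly p -> horner_alg S p = 0 ->
  semisimple_end (S : 'End(V)).
Proof.
move=> sp pS U Ust.
have SU u : u \in U -> (S : 'End(V)) u \in U.
  by move=> uU; apply: (subvP (Ust _ (memv_line _))); apply: memv_img.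
pose P (f : 'End(V)) := (forall v, f v \in U) /\ (forall u, u \in U -> f u = 0).
have [||Q QP] := @vspace_of_pred _ _ P.
- by split=> v; rewrite zero_lfunE ?mem0v.
- move=> a f h [fU f0] [hU h0]; split=> v; rewrite add_lfunE scale_lfunE.
    by rewrite memvD ?memvZ.
  by move=> vU; rewrite f0 ?h0 // scaler0 addr0.
have SQ f : f \in Q -> ad (S : 'End(V)) f \in Q.
  move=> /QP[fU f0]; apply/QP; split=> [v|u uU].
    by rewrite adE gl_lieE memvB ?SU.
  by rewrite adE gl_lieE f0 // f0 ?SU // linear0 subrr.
pose e := projv U.
have eQ : ad (S : 'End(V)) e \in Q.
  apply/QP; split=> [v|u uU]; rewrite adE gl_lieE.
    by rewrite memvB ?SU ?memv_proj.
  by rewrite !projv_id ?SU // subrr.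
(* A positive exponent n + 1 lets c = (ad S)^n b absorb the second term of [S, e] = a + (ad S)^(n+1)
   b. Then [S, e - c] = a, so e - c lies in a generalized kernel of ad S, which is its kernel. *)
have [[//|n] _ fitn] := fitting 1 SQ.
have [a [b [aQ bQ def_e Sa]]] := fitn _ eQ.
pose c := iter n (ad (S : 'End(V))) b.
have cQ : c \in Q by apply: iter_lfun_mem.
have Sec : ad (S : 'End(V)) (e - c) = a.
  rewrite linearB /= def_e. exact: (addrK (ad (S : 'End(V)) c) a).
have Sec0 : ad (S : 'End(V)) (e - c) = 0.
  apply: (@ker2_iter _ _ _ n.+2); last by rewrite iterSr Sec.
  by move=> y; rewrite !adE; apply: separable_ad_ker2 pS.
case/QP: cQ => cU c0; pose e' := e - c.
have e'S v : e' ((S : 'End(V)) v) = (S : 'End(V)) (e' v).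
  by apply/eqP; rewrite eq_sym -subr_eq0 -gl_lieE -adE Sec0 zero_lfunE.
have e'U v : e' v \in U by rewrite add_lfunE opp_lfunE memvB ?memv_proj.
have e'id u : u \in U -> e' u = u.
  by move=> uU; rewrite add_lfunE opp_lfunE c0 // subr0 projv_id.
exists (lker e'); split.
- move=> _ /vlineP[k ->]; apply/subvP=> _ /memv_imgP[v vP ->].
  by rewrite scale_lfunE memvZ // memv_ker e'S (eqP (etrans (esym (memv_ker _ _)) vP)) linear0.
- apply/eqP; rewrite eqEsubv subvf; apply/subvP=> v _.
  rewrite -(subrK (e' v) v) addrC memv_add // memv_ker linearB /=.
  by rewrite (e'id (e' v)) ?subrr.
apply/eqP; rewrite -subv0; apply/subvP=> u /memv_capP[uU].
by rewrite memv_ker e'id ?memv0.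
Qed.

End Alg.

Variable V : vectType K.
Implicit Types (S X Y N : 'End(V)).

Lemma dim0_eq0 (W : vectType K) : ~~ (0 < dim W)%N -> forall v : W, v = 0.
Proof.
rewrite lt0n negbK => /eqP W0 v; apply/eqP; rewrite -memv0.
have : \dim {:W} == 0 by rewrite dimvf W0.
by rewrite dimv_eq0 => /eqP<-; exact: memvf.
Qed.

Lemma semisimple_ad_ker S Y : semisimple_end S -> lie S (lie S Y) = 0 -> lie S Y = 0.
Proof.
move=> ssS; have [Vp|/dim0_eq0 V0] := boolP (0 < dim V)%N.
  by have [p sp pS] := @semisimple_separable V Vp _ ssS; apply: separable_ad_ker2 pS.
by move=> _; apply/lfunP=> v; rewrite zero_lfunE [LHS]V0.
Qed.

Lemma semisimple_ad_iter S Y n : semisimple_end S -> iter n (ad S) Y = 0 -> lie S Y = 0.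
Proof.
move=> ssS Sn; rewrite -adE; apply: ker2_iter Sn => y.
by rewrite !adE; apply: semisimple_ad_ker.
Qed.

Lemma semisimple_ker S v : semisimple_end S -> S (S v) = 0 -> S v = 0.
Proof.
move=> ssS SSv; have [|W [Wst UW UW0]] := ssS (lker S).
  move=> _ /vlineP[c ->]; apply/subvP=> _ /memv_imgP[w wP ->].
  by rewrite scale_lfunE memvZ // memv_ker (eqP (etrans (esym (memv_ker _ _)) wP)) linear0.
have := memvf v; rewrite -UW => /memv_addP[u uP [w wW def_v]].
have Su : S u = 0 by apply/eqP; rewrite -memv_ker.
have Sv : S v = S w by rewrite def_v linearD /= Su add0r.
apply/eqP; rewrite -memv0 -UW0 memv_cap memv_ker SSv eqxx /= Sv.
by apply: (subvP (Wst _ (memv_line _))); apply: memv_img.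
Qed.

Lemma semisimple_ker_iter S v n : semisimple_end S -> iter n S v = 0 -> S v = 0.
Proof. by move=> ssS; apply: ker2_iter => y; apply: semisimple_ker. Qed.

(** Let p^n annihilate X with p separable, and let h be the Newton lift. Then S = h(X) satisfies
    p(S) = 0, and X - S is a multiple of p(X), hence nilpotent. *)
Lemma semisimple_part_exists X : exists S, semisimple_part X S.
Proof.
have [Vp|/dim0_eq0 V0] := boolP (0 < dim V)%N; last first.
  exists 0, 0; split.
  - move=> U _; exists {:V}%VS; split=> //; first by move=> f _; exact: subvf.
      by rewrite addvf.
    by rewrite capvf; apply/eqP; rewrite -subv0; apply/subvP=> v _; rewrite [v]V0 mem0v.
  - by exists 0; apply/lfunP=> v; rewrite [LHS]V0 zero_lfunE.
  - by [].
  by apply/lfunP=> v; rewrite [LHS]V0 [RHS]V0.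
have [q q0 qX] := @lfun_alg_annihilator K V Vp X.
have [p [n [sp /dvdpP[r def_pn]]]] := separable_radical charK q0.
have [h [/dvdpP[u hu] /dvdpP[w hw]]] := separable_lift n sp.
pose A := lfun_algType Vp; pose H : A := horner_alg (X : A) h.
have eN : (X : A) - H = - horner_alg (X : A) (u * p).
  by rewrite -hu rmorphB /= horner_algX opprB.
have N0 : ((X : A) - H) ^+ n = 0.
  rewrite eN -rmorphN -rmorphXn -mulNr exprMn def_pn !rmorphM /=.
  by rewrite [horner_alg _ q]qX !mulr0.
exists H, ((X : A) - H); split.
- apply: (separable_semisimple sp); rewrite horner_alg_comp hw def_pn !rmorphM /=.
  by rewrite [horner_alg _ q]qX !mulr0.
- apply/nilpotent_endP; exists n => v.
  by rewrite -lfun_alg_expE N0; exact: zero_lfunE.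
- have HX : (X : A) * H = H * X by apply: comm_horner_alg.
  by rewrite -[LHS]/(((X : A) - H) * H) -[RHS]/(H * ((X : A) - H)) mulrBl mulrBr HX.
by rewrite addrC; symmetry; exact: (subrK H X).
Qed.

End JordanDecomposition.

(** * Engel's theorem *)

Section LieBasics.
Variables (K : fieldType) (L : lieAlgType K).
Implicit Types x y z : L.

Lemma lieDl x y z : lie (x + y) z = lie x z + lie y z.
Proof. by have := lieDZl z 1 x y; rewrite !scale1r. Qed.
Lemma lieDr x y z : lie x (y + z) = lie x y + lie x z.
Proof. exact: linearD. Qed.
Lemma lieBr x y z : lie x (y - z) = lie x y - lie x z.
Proof. exact: linearB. Qed.
Lemma lie0r x : lie x 0 = 0. Proof. exact: linear0. Qed.
Lemma lie0l x : lie 0 x = 0. Proof. by rewrite lieC lie0r oppr0. Qed.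
Lemma lieNr x y : lie x (- y) = - lie x y. Proof. exact: linearN. Qed.
Lemma lieZr a x y : lie x (a *: y) = a *: lie x y. Proof. exact: linearZ. Qed.
Lemma lieZl a x y : lie (a *: x) y = a *: lie x y.
Proof. by rewrite lieC lieZr -scalerN -lieC. Qed.

Lemma lie_jacobi x y z : lie x (lie y z) = lie (lie x y) z + lie y (lie x z).
Proof.
have /eqP := jacobi x y z; rewrite (lieC z x) (lieC z (lie x y)) lieNr.
by rewrite subr_eq0 subr_eq => /eqP.
Qed.

Lemma memv_lieC (U : {vspace L}) x y : (lie x y \in U) = (lie y x \in U).
Proof. by rewrite lieC memvN. Qed.

End LieBasics.

Section Engel.
Variable K : fieldType.

(** Engel's theorem for U modulo W, stated without quotient spaces. In the induction the same form,
    for [ad] on h modulo a maximal proper subalgebra H, produces x outside H with [H, x] in H, and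
    then h = H + <x>. *)
Lemma engel_relative (L : lieAlgType K) (h : {vspace L}) :
    lie_subalg h ->
    (forall x y, x \in h -> y \in h -> exists n, iter n (ad x) y = 0) ->
  forall (V : vectType K) (rho : 'Hom(L, 'End(V))) (U W : {vspace V}),
    (forall x y v, x \in h -> y \in h ->
       rho (lie x y) v = rho x (rho y v) - rho y (rho x v)) ->
    (forall x u, x \in h -> u \in U -> rho x u \in U) ->
    (forall x w, x \in h -> w \in W -> rho x w \in W) ->
    (forall x u, x \in h -> u \in U -> exists n, iter n (rho x) u \in W) ->
    ~~ (U <= W)%VS ->
  exists u, [/\ u \in U, u \notin W & forall x, x \in h -> rho x u \in W].
Proof.
have [n] := ubnP (\dim h); elim: n h => // n IHn h ltn subh nilh.
move=> V rho U W rhoM rhoU rhoW rhonil nUW.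
have [h0|h0] := eqVneq h 0%VS.
  have /subvPn[u uU uW] := nUW; exists u; split=> // x.
  by rewrite h0 memv0 => /eqP->; rewrite linear0 zero_lfunE mem0v.
pose P (H : {vspace L}) := [/\ lie_subalg H, (H <= h)%VS & H <> h].
have [|H [[subH Hh neH] _ maxH]] := @vspace_max _ _ P 0%VS.
  split; [|exact: sub0v|by move=> E; rewrite E eqxx in h0].
  by move=> x y; rewrite !memv0 => /eqP-> _; rewrite lieC linear0 oppr0.
have ltH : (\dim H < n)%N.
  apply: (@leq_trans (\dim h)) => //; rewrite ltn_neqAle dimvS // andbT.
  by apply/eqP=> E; apply: neH; apply/eqP; rewrite eqEdim Hh E leqnn.
have hP x : x \in H -> x \in h by move/(subvP Hh).
have nilH x y : x \in H -> y \in H -> exists n, iter n (ad x) y = 0.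
  by move=> /hP xh /hP; apply: nilh.
have [|||||x [xh xH xHH]] := IHn H ltH subH nilH _ (@ad K L) h H _ _ _ _ _.
- move=> x y v _ _; rewrite !adE; by rewrite [in RHS]lie_jacobi addrK.
- by move=> x u /hP xh uh; rewrite adE subh.
- by move=> x w xH wH; rewrite adE subH.
- by move=> x u /hP xh /(nilh x u xh)[k k0]; exists k; rewrite k0 mem0v.
- by apply/negP=> hH; apply: neH; apply/eqP; rewrite eqEsubv Hh.
have defh : h = (H + <[x]>)%VS.
  apply: NNPP => neh; case/negP: xH.
  rewrite -(maxH (H + <[x]>)%VS) ?addvSl ?(subvP (addvSr _ _)) ?memv_line //.
  split; last by move=> E; apply: neh.
    move=> _ _ /memv_addP[a aH [_ /vlineP[c ->] ->]] /memv_addP[b bH [_ /vlineP[d ->] ->]].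
    apply: (subvP (addvSl _ _)).
    have aW : lie a x \in H by rewrite -adE xHH.
    have bW : lie x b \in H by rewrite memv_lieC -adE xHH.
    rewrite lieDl !lieDr !lieZl !lieZr liexx !scaler0 addr0.
    by rewrite (memvD (memvD (subH _ _ aH bH) (memvZ _ aW)) (memvZ _ bW)).
  by rewrite subv_add Hh -memvE.
have [||U' U'P] := @vspace_of_pred _ _ (fun u => u \in U /\ forall y, y \in H -> rho y u \in W).
- by split=> [|y _]; rewrite ?linear0 mem0v.
- move=> a u v [uU uH] [vU vH]; split=> [|y yH]; first by rewrite memvD ?memvZ.
  by rewrite linearP /= memvD ?memvZ ?uH ?vH.
have [|||||u [uU uW uH]] := IHn H ltH subH nilH V rho U W.
- by move=> a b v /hP ah /hP bh; apply: rhoM.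
- by move=> a u /hP; apply: rhoU.
- by move=> a u /hP; apply: rhoW.
- by move=> a u /hP; apply: rhonil.
- by [].
have U'x v : v \in U' -> rho x v \in U'.
  move=> /U'P[vU vH]; apply/U'P; split=> [|y yH]; first exact: rhoU.
  have /eqP := rhoM y x v (hP _ yH) xh; rewrite eq_sym subr_eq => /eqP->.
  by apply: memvD; [apply: vH; rewrite -adE; apply: xHH | apply: rhoW => //; apply: vH].
have uU' : u \in U' by apply/U'P.
have exn : exists k, iter k (rho x) u \in W by apply: rhonil.
(* The last iterate of [rho x] on u outside W is the vector sought; it stays in [U'], whose elements
   H sends into W. *)
case: (ex_minnP exn) => -[|k] kW kmin; first by case/negP: uW.
exists (iter k (rho x) u).
have kU' : iter k (rho x) u \in U' by apply: iter_lfun_mem.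
have /U'P[kU kH] := kU'; split=> //.
  by apply/negP=> /kmin; rewrite ltnn.
move=> z; rewrite defh => /memv_addP[a aH [_ /vlineP[c ->] ->]].
rewrite linearD linearZ /= add_lfunE scale_lfunE.
exact: memvD (kH _ aH) (memvZ c kW).
Qed.

(** A maximal proper stable subspace W has codimension one by Engel, with the extra vector sent into
    W. Hence h U lies in W, against the assumption that h U spans U. *)
Lemma engel_image (L : lieAlgType K) (h : {vspace L}) :
    lie_subalg h ->
    (forall x y, x \in h -> y \in h -> exists n, iter n (ad x) y = 0) ->
  forall (V : vectType K) (rho : 'Hom(L, 'End(V))) (U : {vspace V}),
    (forall x y v, x \in h -> y \in h ->
       rho (lie x y) v = rho x (rho y v) - rho y (rho x v)) ->
    (forall x u, x \in h -> u \in U -> rho x u \in U) ->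
    (forall x u, x \in h -> u \in U -> exists n, iter n (rho x) u = 0) ->
    (forall W, (W <= U)%VS -> (forall x u, x \in h -> u \in U -> rho x u \in W) -> W = U) ->
  U = 0%VS.
Proof.
move=> subh nilh V rho U rhoM rhoU rhonil full; apply: NNPP => U0.
pose P (W : {vspace V}) := [/\ forall x w, x \in h -> w \in W -> rho x w \in W, (W <= U)%VS & W <> U].
have [|W [[Wst WU neW] _ maxW]] := @vspace_max _ _ P 0%VS.
  split; [|exact: sub0v|by move=> E; apply: U0].
  by move=> x w _; rewrite memv0 => /eqP->; rewrite linear0 mem0v.
have [||u [uU uW uh]] := engel_relative subh nilh rhoM rhoU Wst.
- by move=> x u xh /(rhonil x u xh)[k k0]; exists k; rewrite k0 mem0v.
- by apply/negP=> UW; apply: neW; apply/eqP; rewrite eqEsubv WU.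
have defU : (W + <[u]>)%VS = U.
  apply: NNPP => neU; case/negP: uW.
  rewrite -(maxW (W + <[u]>)%VS) ?addvSl ?(subvP (addvSr _ _)) ?memv_line //.
  split=> //; last by rewrite subv_add WU -memvE.
  move=> x _ xh /memv_addP[a aW [_ /vlineP[c ->] ->]].
  apply: (subvP (addvSl _ _)); rewrite linearD linearZ.
  exact: memvD (Wst _ _ xh aW) (memvZ c (uh _ xh)).
apply: neW; apply: full => // x v xh; rewrite -defU => /memv_addP[a aW [_ /vlineP[c ->] ->]].
by rewrite linearD linearZ; apply: memvD (Wst _ _ xh aW) (memvZ c (uh _ xh)).
Qed.

End Engel.

(** * Cartan's criterion *)

Lemma irreducible_factor (K : fieldType) (p : {poly K}) : (1 < size p)%N ->
  exists2 q, irreducible_poly q & q %| p.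
Proof.
have [n] := ubnP (size p); elim: n p => // n IHn p ltn p1.
have [irr|nirr] := classic (irreducible_poly p); first by exists p.
have [q [q1 qp neq]] : exists q : {poly K}, [/\ size q != 1%N, q %| p & ~~ (q %= p)].
  apply: NNPP => nq; apply: nirr; split=> // q q1 qp; apply: NNPP => neq.
  by apply: nq; exists q; split=> //; apply/negP.
have p0 : p != 0 by rewrite -size_poly_gt0 ltnW.
have q0 : q != 0 by apply: contraNneq p0 => q0; move: qp; rewrite q0 dvd0p.
have ltq : (size q < size p)%N.
  rewrite ltn_neqAle dvdp_leq // andbT; apply: contra neq => eqs.
  by rewrite -dvdp_size_eqp.
have [||r irr rq] := IHn q; first exact: leq_trans ltq _.
  by rewrite ltn_neqAle eq_sym q1 size_poly_gt0.
by exists r => //; apply: dvdp_trans qp.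
Qed.

Lemma splitting_extension (K : fieldType) (p : {poly K}) : p != 0 ->
  exists (F : fieldType) (iota : {rmorphism K -> F}) (rs : seq F),
    map_poly iota p %= \prod_(x <- rs) ('X - x%:P).
Proof.
have [n] := ubnP (size p); elim: n K p => // n IHn K p ltn p0.
have [p1|p1] := leqP (size p) 1.
  exists K, (GRing.RMorphism.clone K K idfun _), [::].
  by rewrite big_nil map_poly_id // -size_poly_eq1 eqn_leq p1 size_poly_gt0.
have [q irr /dvdpP[u def_p]] := irreducible_factor p1.
have [L _ [z qz _]] := irredp_FAdjoin irr.
pose j : {rmorphism K -> L} := GRing.in_alg L.
have : root (map_poly j p) z by rewrite def_p rmorphM rootM qz orbT.
move/factor_theorem=> [v def_jp].
have jp0 : map_poly j p != 0 by rewrite map_poly_eq0.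
have v0 : v != 0 by apply: contraNneq jp0 => v0; rewrite def_jp v0 mul0r.
have [|//|F [i [rs irs]]] := IHn L v.
  move: ltn; rewrite -(size_map_poly j) def_jp size_Mmonic ?monicXsubC // size_XsubC.
  by rewrite addn2.
exists F, (GRing.RMorphism.clone K F (i \o j) _), (i z :: rs).
rewrite map_poly_comp def_jp rmorphM /= big_cons mulrC.
by rewrite rmorphB /= map_polyX map_polyC eqp_mull.
Qed.

(** * Additive functions on eigenvalues, and polynomial idempotents *)

Section CharZero.
Variable F : fieldType.
Hypothesis charF : [pchar F] =i pred0.

Lemma intr_pchar0_eq0 (d : int) : (d%:~R == 0 :> F) = (d == 0).
Proof.
have /pcharf0P natE := charF.
by case: d => n; rewrite ?NegzE ?rmorphN ?oppr_eq0 /= -pmulrn natE.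
Qed.

Lemma mulrz_pchar0_eq0 (x : F) (d : int) : (x *~ d == 0) = (x == 0) || (d == 0).
Proof. by rewrite -mulrzr mulf_eq0 intr_pchar0_eq0. Qed.

(* An additive function on the group generated by the elements of [s], given by
   its values on [s]. *)
Definition additive_on (s : seq F) (f : F -> int) :=
  forall q : F -> int, \sum_(x <- s) x *~ q x = 0 -> \sum_(x <- s) q x * f x = 0.

(** It stands in for a linear form over the rationals on the span of s. Elements y are added one at
    a time: if some multiple d y, d nonzero, is an integral combination of the previous elements, f
    is multiplied by d so that f y can be chosen integral; otherwise f y = 0. *)
Lemma additive_on_exists (s : seq F) (x0 : F) : uniq s -> x0 \in s -> x0 != 0 ->
  exists2 f, additive_on s f & f x0 != 0.
Proof.
move=> us x0s x0n; have ps := perm_to_rem x0s.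
suff [f fP f0] : exists2 f, additive_on (x0 :: rem x0 s) f & f x0 != 0.
  by exists f => // q; rewrite !(perm_big _ ps); apply: fP.
move: us; rewrite (perm_uniq ps); move: (rem x0 s) => {ps x0s} {}s.
have perm_add (t1 t2 : seq F) f : perm_eq t1 t2 -> additive_on t1 f -> additive_on t2 f.
  by move=> p h q; rewrite -!(perm_big _ p); apply: h.
elim: s => [|y s IHs] /= => [_|/andP[]].
  exists (fun=> 1) => // q; rewrite !big_seq1 => /eqP.
  by rewrite mulrz_pchar0_eq0 (negPf x0n) => /eqP->; rewrite mul0r.
rewrite inE negb_or => /andP[x0y x0s] /andP[ys us].
have [|f fP f0] := IHs; first by rewrite /= x0s.
have yt : y \notin x0 :: s by rewrite inE negb_or eq_sym x0y.
have perm2 : perm_eq [:: y, x0 & s] [:: x0, y & s].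
  by rewrite (perm_catCA [:: y] [:: x0] s).
have bigS (T : nmodType) (G H : F -> T) : {in x0 :: s, G =1 H} ->
    \sum_(x <- x0 :: s) G x = \sum_(x <- x0 :: s) H x.
  by move=> GH; rewrite big_seq [RHS]big_seq; apply: eq_bigr => x /GH.
have neq_y x : x \in x0 :: s -> (x == y) = false.
  by move=> xs; apply: contraNF yt => /eqP<-.
have [[d [q [d0 qy]]]|nq] := classic (exists d q, d != 0 /\
    y *~ d = \sum_(x <- x0 :: s) x *~ q x).
  pose f' x := if x == y then \sum_(x <- x0 :: s) q x * f x else d * f x.
  exists f'; last by rewrite /f' (negPf x0y) mulf_neq0.
  apply: perm_add perm2 _ => r; rewrite !(big_cons _ _ y) => rel.
  rewrite {1}/f' eqxx (bigS _ (fun x => r x * f' x) (fun x => r x * (d * f x))); last first.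
    by move=> x xs; rewrite /f' neq_y.
  have := fP (fun x => q x * r y + d * r x).
  have -> : \sum_(x <- x0 :: s) x *~ (q x * r y + d * r x) = 0.
    under eq_bigr do rewrite mulrzDr [d * _]mulrC !mulrzA.
    by rewrite big_split /= -!mulrz_suml -qy mulrzAC -mulrzDl rel mul0rz.
  move=> E; rewrite -[RHS](E erefl) mulr_sumr -big_split /=; apply: eq_bigr => x _.
  ring.
exists (fun x => if x == y then 0 else f x); last by rewrite (negPf x0y).
apply: perm_add perm2 _ => r; rewrite !(big_cons _ _ y) eqxx mulr0 add0r => rel.
rewrite (bigS _ _ (fun x => r x * f x)); last by move=> x /neq_y ->.
have ry : r y = 0.
  apply/eqP; apply: NNPP => /negP ry; apply: nq; exists (- r y), r.
  by rewrite oppr_eq0 ry mulrNz; split=> //; apply/eqP; rewrite eqr_oppLR -addr_eq0 rel.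
by apply: fP; move: rel; rewrite ry mulr0z add0r.
Qed.

(** Chinese remainders without quotient rings: the error w is a multiple of the whole product, so it
    disappears once evaluated at an operator that the product annihilates. *)
Lemma crt_idempotents (I : eqType) (s : seq I) (q : I -> {poly F}) :
    uniq s -> {in s &, forall x y, x != y -> coprimep (q x) (q y)} ->
  exists (e : I -> {poly F}) (w : {poly F}),
    [/\ 1 = \sum_(x <- s) e x + w, \prod_(x <- s) q x %| w &
      {in s, forall x, \prod_(y <- rem x s) q y %| e x}].
Proof.
elim: s => [|x s IHs] /=; first by exists (fun=> 0), 1; rewrite !big_nil add0r dvdpp.
move=> /andP[xs us] cop.
have [|e [w [sum1 Qw eq]]] := IHs us.
  by move=> y z ys zs; apply: cop; rewrite inE ?ys ?zs orbT.
have copQ : coprimep (q x) (\prod_(y <- s) q y).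
  rewrite coprimep_sym big_seq; elim/big_rec: _ => [|y p ys copp]; first exact: coprime1p.
  rewrite coprimepMl copp andbT coprimep_sym cop ?inE ?ys ?eqxx ?orbT //.
  by apply: contraNneq xs => ->.
have /Bezout_eq1_coprimepP[[u v] /= uv] := copQ.
exists (fun y => if y == x then v * \prod_(y <- s) q y else u * q x * e y), (u * q x * w).
have neq y : y \in s -> (y == x) = false by move=> ys; apply: contraNF xs => /eqP<-.
split.
- rewrite big_cons eqxx [X in _ = _ + X + _](eq_big_seq (fun y => u * q x * e y)) => [|y /neq-> //].
  by rewrite -mulr_sumr -addrA -mulrDr -sum1 mulr1 addrC.
- by rewrite big_cons -mulrA dvdp_mull // dvdp_mul.
move=> y; rewrite inE => /predU1P[->|ys]; rewrite ?eqxx ?dvdp_mull //.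
by rewrite neq // eq_sym neq // big_cons dvdp_mul ?dvdp_mull // eq.
Qed.

End CharZero.

Section Trace.
Variable K : fieldType.

Lemma exp_mulmx_swap m n (A : 'M[K]_(m, n)) (B : 'M_(n, m)) i :
  (A *m B) ^+ i *m A = A *m (B *m A) ^+ i.
Proof.
elim: i => [|i IH]; first by rewrite !expr0 mul1mx mulmx1.
by rewrite !exprSr -!mulmxE [RHS]mulmxA -IH -!mulmxA.
Qed.

(** A rank factorization M = C R gives tr M = tr (R C), with R C again nilpotent and of smaller
    size. *)
Lemma trace_nilpotent n (M : 'M[K]_n) N : M ^+ N = 0 -> \tr M = 0.
Proof.
have [k] := ubnP n; elim: k n M N => // k IHk n M N ltn M0.
have [r_lt|r_ge] := ltnP (\rank M) n; last first.
  case: n M ltn M0 r_ge => [|n] M ltn M0 r_ge; first by rewrite /mxtrace big_ord0.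
  have uM : M \in unitmx by rewrite -row_full_unit /row_full eqn_leq rank_leq_col.
  have : M ^+ N \in unitmx by elim: (N) => [|i IH]; rewrite ?unitmx1 // exprS unitmx_mul uM.
  by rewrite M0 unitmxE det0 unitr0.
rewrite -{1}(mulmx_base M) mxtrace_mulC.
apply: (IHk _ _ N.+1); first exact: leq_trans r_lt _.
by rewrite exprSr -mulmxE mulmxA exp_mulmx_swap mulmx_base M0 mulmx0 mul0mx.
Qed.

Lemma trace_idempotent n (P : 'M[K]_n) : P *m P = P -> \tr P = (\rank P)%:R.
Proof.
move=> PP; rewrite -{1}(mulmx_base P) mxtrace_mulC.
suff -> : row_base P *m col_base P = 1%:M by rewrite mxtrace1.
apply: (row_free_inj (row_base_free P)); apply: (row_full_inj (col_base_full P)).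
move: (row_base P) (col_base P) (mulmx_base P) => R C CR.
by rewrite /= mul1mx -mulmxA CR mulmxA CR PP.
Qed.

End Trace.

(** * Cartan's criterion over a field that splits the characteristic polynomial *)

Section CartanSplit.
Variables (F : fieldType) (n : nat).
Hypothesis charF : [pchar F] =i pred0.
Local Notation M := 'M[F]_n.+1.
Variables (X : M) (r : nat) (a b : 'I_r -> M).

Definition mx_commutator (Y Z : M) : M := Y * Z - Z * Y.

Lemma mx_commutator_is_linear Y : linear (mx_commutator Y).
Proof.
move=> c Z T; rewrite /mx_commutator mulrDr mulrDl -scalerAr -scalerAl scalerBr.
by rewrite opprD addrACA.
Qed.
HB.instance Definition _ Y := GRing.isLinear.Build F M M _ _ (mx_commutator_is_linear Y).

Definition mulmx_lfun (Y : M) : 'End(M) := linfun (mulmx Y).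
Definition mulmxr_lfun (Y : M) : 'End(M) := linfun (mulmxr Y).
Definition mx_ad (Y : M) : 'End(M) := linfun (mx_commutator Y).

Lemma mxM_dim_gt0 : (0 < dim M)%N. Proof. by []. Qed.
Local Notation A := (lfun_algType mxM_dim_gt0).

Lemma horner_mx_dvd_eq0 (p q : {poly F}) : p %| q -> horner_mx X p = 0 -> horner_mx X q = 0.
Proof. by move=> /dvdpP[u ->] pX; rewrite rmorphM /= pX mulr0. Qed.

Lemma horner_ad_dvd_eq0 (p q : {poly F}) (Z : M) : p %| q ->
  (horner_alg (mx_ad X : A) p : 'End(M)) Z = 0 ->
  (horner_alg (mx_ad X : A) q : 'End(M)) Z = 0.
Proof.
move=> /dvdpP[u ->] pZ; rewrite mulrC rmorphM /= lfun_alg_mulE pZ.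
exact: linear0.
Qed.

Lemma horner_ad_gen (x y : F) (N : nat) (Z : M) :
    (X - x%:M) ^+ N * Z = 0 -> Z * (X - y%:M) ^+ N = 0 ->
  (horner_alg (mx_ad X : A) (('X - (x - y)%:P) ^+ (N + N)) : 'End(M)) Z = 0.
Proof.
move=> xZ yZ; rewrite rmorphXn lfun_alg_expE /=.
have LE Y k T : iter k (mulmx_lfun Y) T = Y ^+ k * T.
  elim: k => [|k IH] /=; first by rewrite expr0 mul1r.
  by rewrite IH lfunE /= mulmxE mulrA exprS.
have RE Y k T : iter k (mulmxr_lfun Y) T = T * Y ^+ k.
  elim: k => [|k IH] /=; first by rewrite expr0 mulr1.
  by rewrite IH lfunE /= mulmxE -mulrA exprSr.
apply: (@iter_nilB _ _ (mulmx_lfun (X - x%:M)) (mulmxr_lfun (X - y%:M))).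
- by move=> T; rewrite !lfunE /= !mulmxE mulrA.
- move=> T; rewrite rmorphB /= horner_algX horner_algC.
  rewrite (@add_lfunE F M M) (@opp_lfunE F M M) (@scale_lfunE F M M) (@id_lfunE F M).
  rewrite !lfunE /= /mx_commutator mulmxBl mulmxBr -!mulmxE mul_scalar_mx mul_mx_scalar.
  by rewrite scalerBl !opprB addrACA [RHS]addrACA (addrC (- (T *m X))).
- exact: etrans (LE _ _ _) xZ.
exact: etrans (RE _ _ _) yZ.
Qed.

Hypothesis defX : X = \sum_i (a i * b i - b i * a i).
Hypothesis tr0 : forall j, \sum_i \tr (a i * iter j (mx_ad X) (b i)) = 0.

(** By linearity [tr0] holds with any polynomial in ad X applied to [b i]. When g(ad X) = ad Y,
    invariance of the trace turns the sum into - tr (X Y). *)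
Lemma cartan_trace (g : {poly F}) (Y : M) :
    (forall Z, (horner_alg (mx_ad X : A) g : 'End(M)) Z = Y * Z - Z * Y) ->
  \tr (X * Y) = 0.
Proof.
move=> gY; have : \sum_i \tr (a i * (horner_alg (mx_ad X : A) g : 'End(M)) (b i)) = 0.
  rewrite -[g]coefK poly_def.
  have E i : (horner_alg (mx_ad X : A) (\sum_(j < size g) g`_j *: 'X^j) : 'End(M)) (b i) =
      \sum_(j < size g) g`_j *: iter j (mx_ad X) (b i).
    rewrite raddf_sum /= (@sum_lfunE F M M); apply: eq_bigr => j _.
    rewrite linearZ /= rmorphXn /= horner_algX mulr_algl (@scale_lfunE F M M).
    by rewrite lfun_alg_expE.
  under eq_bigr do rewrite E mulr_sumr raddf_sum /=.
  rewrite exchange_big big1 //= => j _.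
  under eq_bigr do rewrite -scalerAr mxtraceZ.
  by rewrite -mulr_sumr tr0 mulr0.
under eq_bigr do rewrite gY mulrBr raddfB /= !mulrA (mxtrace_mulC (a _ * Y)) !mulmxE mulrA.
under eq_bigr do rewrite -raddfB /= -mulrBl -opprB mulNr raddfN /=.
by rewrite sumrN -raddf_sum /= -mulr_suml -defX => /eqP; rewrite oppr_eq0 => /eqP.
Qed.

(** If an eigenvalue x0 of X were nonzero, take an additive integral f with f x0 nonzero and let Y
    act as f x on the generalized eigenspace of x. On the block (x, y), ad X has generalized
    eigenvalue x - y and ad Y is f x - f y, so ad Y is a polynomial in ad X and tr (X Y) = 0.
    Applying f to that relation gives a vanishing sum of terms rank times (f x)^2, which forces f x0
    = 0. *)
Lemma cartan_nilpotent_split (s : seq F) :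
  char_poly X %| \prod_(x <- s) ('X - x%:P) -> exists N, X ^+ N = 0.
Proof.
move=> Xs; pose rs := undup s; pose N := size s.
pose q (N : nat) x : {poly F} := ('X - x%:P) ^+ N.
have cop k (l : seq F) : {in l &, forall x y, x != y -> coprimep (q k x) (q k y)}.
  move=> x y _ _ xy; apply: coprimep_expl; apply: coprimep_expr.
  by apply: coprimep_XsubC2; rewrite subr_eq0 eq_sym.
have CX : horner_mx X (\prod_(x <- rs) q N x) = 0.
  apply: horner_mx_dvd_eq0 (Cayley_Hamilton X); apply: dvdp_trans Xs _.
  rewrite -prodr_undup_exp_count; elim/big_ind2: _ => // [p p' u u' pp uu|x _].
    exact: dvdp_mul.
  by apply: dvdp_exp2l; apply: count_size.
have [e [w [sum1 Qw eq]]] := crt_idempotents (undup_uniq s) (cop N rs).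
pose P x := horner_mx X (e x).
have wX : horner_mx X w = 0 by apply: horner_mx_dvd_eq0 Qw CX.
have sumP : \sum_(x <- rs) P x = 1.
  have := congr1 (horner_mx X) sum1.
  by rewrite rmorphD rmorph1 /= wX addr0 raddf_sum.
have qe x : x \in rs -> \prod_(y <- rs) q N y %| q N x * e x.
  by move=> xs; rewrite (big_rem x xs) dvdp_mul // eq.
have qe' x y : x \in rs -> y \in rs -> x != y -> q N y %| e x.
  move=> xs ys xy; apply: dvdp_trans (eq x xs).
  have yr : y \in rem x rs by rewrite mem_rem_uniq ?undup_uniq // inE eq_sym xy.
  by rewrite (big_rem y yr) dvdp_mulIl.
have PE x y : x \in rs -> y \in rs -> x != y -> P x * P y = 0.
  move=> xs ys xy; rewrite /P -rmorphM /=; apply: horner_mx_dvd_eq0 CX.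
  by apply: dvdp_trans (qe y ys) _; rewrite dvdp_mul ?qe'.
have PP x : x \in rs -> P x * P x = P x.
  move=> xs; rewrite -[RHS]mulr1 -sumP mulr_sumr (big_rem x xs) /= big1_seq ?addr0 //.
  by move=> y /=; rewrite mem_rem_uniq ?undup_uniq // inE => /andP[yx ys]; rewrite PE // eq_sym.
have XqE x : (X - x%:M) ^+ N = horner_mx X (q N x).
  by rewrite rmorphXn rmorphB /= horner_mx_X horner_mx_C.
have qP x : x \in rs -> (X - x%:M) ^+ N * P x = 0.
  by move=> xs; rewrite XqE /P -rmorphM /=; apply: horner_mx_dvd_eq0 (qe x xs) CX.
have Pq x : x \in rs -> P x * (X - x%:M) ^+ N = 0.
  by move=> xs; rewrite XqE /P -rmorphM /= mulrC; apply: horner_mx_dvd_eq0 (qe x xs) CX.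
apply: NNPP => nX.
(* If [P x] were zero for every nonzero x, the only summand left in X^N would come from the block at
   0, which X^N kills. *)
have [x0 [x0s x00 Px0]] : exists x0, [/\ x0 \in rs, x0 != 0 & P x0 != 0].
  apply: NNPP => no; apply: nX; exists N; rewrite -[LHS]mulr1 -sumP mulr_sumr big1_seq // => x /= xs.
  have [x00|x00] := eqVneq x 0.
    by have := qP x xs; rewrite x00 raddf0 subr0.
  suff -> : P x = 0 by rewrite mulr0.
  by apply/eqP; apply: NNPP => /negP Px; apply: no; exists x.
have [f fadd f0] := additive_on_exists charF (undup_uniq s) x0s x00.
have sum1E (T : zmodType) (G : F -> T) u : u \in rs ->
    \sum_(z <- rs) G z *~ (z == u)%:Z = G u.
  move=> us; rewrite (big_rem u us) /= eqxx big1_seq ?addr0 // => z /=.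
  by rewrite mem_rem_uniq ?undup_uniq // inE => /andP[/negPf->].
have fsub x y x' y' : x \in rs -> y \in rs -> x' \in rs -> y' \in rs ->
    x - y = x' - y' -> f x - f y = f x' - f y'.
  move=> xs ys xs' ys' E.
  have := fadd (fun z => (z == x)%:Z - (z == y)%:Z - ((z == x')%:Z - (z == y')%:Z)).
  under eq_bigr do rewrite !mulrzBr.
  rewrite !sumrB !sum1E // E subrr => /(_ erefl).
  under eq_bigr do rewrite mulrC -mulrzz !mulrzBr.
  by rewrite !sumrB !sum1E // => /eqP; rewrite subr_eq0 => /eqP.
pose pairs := [seq (x, y) | x <- rs, y <- rs].
(* By [fsub] the value f x - f y depends only on d = x - y, so any pair representing d will do; 0 is
   a default for other d. *)
pose ft d := if [seq p <- pairs | p.1 - p.2 == d] is p :: _ then f p.1 - f p.2 else 0.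
have ftE x y : x \in rs -> y \in rs -> ft (x - y) = f x - f y.
  move=> xs ys; rewrite /ft; case E: [seq p <- _ | _] => [|[x' y'] t].
    have : (x, y) \in [seq p <- pairs | p.1 - p.2 == x - y].
      by rewrite mem_filter eqxx; apply: allpairs_f.
    by rewrite E.
  have : (x', y') \in [seq p <- pairs | p.1 - p.2 == x - y] by rewrite E inE eqxx.
  rewrite mem_filter => /andP[/eqP /= E' /allpairsP[[x1 y1] /= [x1s y1s [ex ey]]]].
  by apply: fsub; rewrite ?ex ?ey // -ex -ey.
pose D := undup [seq x - y | x <- rs, y <- rs].
(* On the block (x, y), ad X - (x - y) is a difference of two commuting maps nilpotent of order N;
   hence the exponent N + N. *)
have [e' [w' [sum1' Qw' eq']]] := crt_idempotents (undup_uniq _) (cop (N + N)%N D).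
pose H p (Z : M) : M := (horner_alg (mx_ad X : A) p : 'End(M)) Z.
have HD p p' Z : H (p + p') Z = H p Z + H p' Z.
  by rewrite /H rmorphD; exact: add_lfunE.
have HZ c p Z : H (c *: p) Z = c *: H p Z.
  by rewrite /H linearZ /= mulr_algl; exact: scale_lfunE.
have Hsum (I : Type) (l : seq I) (G : I -> {poly F}) Z : H (\sum_(i <- l) G i) Z = \sum_(i <- l) H (G i) Z.
  elim: l => [|i l IH]; last by rewrite !big_cons HD IH.
  by rewrite !big_nil /H rmorph0; exact: zero_lfunE.
have H1 Z : H 1 Z = Z by rewrite /H rmorph1; exact: id_lfunE.
have Hlin p l (G : F -> M) : H p (\sum_(i <- l) G i) = \sum_(i <- l) H p (G i).
  by rewrite /H linear_sum.
have Hdvd p p' Z : p %| p' -> H p Z = 0 -> H p' Z = 0 by exact: horner_ad_dvd_eq0.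
have Hgen x y Z : (X - x%:M) ^+ N * Z = 0 -> Z * (X - y%:M) ^+ N = 0 ->
    H (q (N + N)%N (x - y)) Z = 0 by exact: horner_ad_gen.
have Htr g Y : (forall Z, H g Z = Y * Z - Z * Y) -> \tr (X * Y) = 0 by exact: cartan_trace.
clearbody H.
pose Y := \sum_(x <- rs) P x *~ f x.
pose g := \sum_(d <- D) (ft d)%:~R *: e' d.
have gY Z : H g Z = Y * Z - Z * Y.
  have -> : Z = \sum_(x <- rs) \sum_(y <- rs) P x * Z * P y.
    under eq_bigr do rewrite -mulr_sumr sumP mulr1.
    by rewrite -mulr_suml sumP mul1r.
  rewrite mulr_sumr mulr_suml -sumrB Hlin; apply: eq_big_seq => x xs /=.
  rewrite mulr_sumr mulr_suml -sumrB Hlin; apply: eq_big_seq => y ys /=.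
  set T := P x * Z * P y.
  have Hq : H (q (N + N)%N (x - y)) T = 0.
    apply: Hgen; first by rewrite /T !mulrA qP // !mul0r.
    have -> : T * (X - y%:M) ^+ N = P x * Z * (P y * (X - y%:M) ^+ N) by rewrite [RHS]mulrA.
    by rewrite Pq ?mulr0.
  have xyD : x - y \in D by rewrite mem_undup; apply: allpairs_f.
  have He d : d \in D -> d != x - y -> H (e' d) T = 0.
    move=> dD dxy; apply: Hdvd Hq; apply: dvdp_trans (eq' d dD).
    have yr : x - y \in rem d D by rewrite mem_rem_uniq ?undup_uniq // inE eq_sym dxy.
    by rewrite (big_rem _ yr) dvdp_mulIl.
  have Hw : H w' T = 0.
    apply: Hdvd Hq; apply: dvdp_trans Qw'.
    by rewrite (big_rem _ xyD) dvdp_mulIl.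
  have HeT : H (e' (x - y)) T = T.
    rewrite -[RHS]H1 (congr1 (H^~ T) sum1') HD Hw addr0 Hsum (big_rem _ xyD) /=.
    rewrite big1_seq ?addr0 //.
    by move=> d /=; rewrite mem_rem_uniq ?undup_uniq // inE => /andP[dn dD]; rewrite He.
  have YT : Y * T = T *~ f x.
    rewrite /Y mulr_suml (big_rem x xs) /= big1_seq ?addr0.
      by rewrite mulrzAl /T !mulrA PP.
    move=> z /=; rewrite mem_rem_uniq ?undup_uniq // inE => /andP[zx zs].
    by rewrite mulrzAl /T !mulrA PE // !mul0r mul0rz.
  have TY : T * Y = T *~ f y.
    rewrite /Y mulr_sumr (big_rem y ys) /= big1_seq ?addr0.
      by rewrite mulrzAr /T -!mulrA PP.
    move=> z /=; rewrite mem_rem_uniq ?undup_uniq // inE => /andP[zy zs].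
    by rewrite mulrzAr /T -!mulrA PE 1?eq_sym // !mulr0 mul0rz.
  rewrite YT TY -mulrzBr -ftE // /g Hsum (big_rem _ xyD) /= big1_seq ?addr0.
    by rewrite HZ HeT scaler_int.
  move=> d /=; rewrite mem_rem_uniq ?undup_uniq // inE => /andP[dn dD].
  by rewrite HZ He // scaler0.
have trP x : x \in rs -> \tr (X * P x) = x *+ \rank (P x).
  move=> xs; have -> : X * P x = (X - x%:M) * P x + x *: P x.
    by rewrite mulrBl -(mul_scalar_mx x (P x)) mulmxE subrK.
  rewrite mxtraceD mxtraceZ [\tr (P x)]trace_idempotent ?mulmxE ?PP // mulr_natr.
  rewrite (@trace_nilpotent _ _ _ N.+1) ?add0r // exprMn_comm.
    by rewrite exprS exprS mulrA -(mulrA _ _ (P x)) qP // mulr0 mul0r.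
  have -> : X - x%:M = horner_mx X ('X - x%:P) by rewrite rmorphB /= horner_mx_X horner_mx_C.
  exact: comm_horner_mx2.
have := Htr _ _ gY; rewrite mulr_sumr raddf_sum /=.
rewrite (eq_big_seq (fun x => x *~ (f x * (\rank (P x))%:Z))) => [/fadd|x xs]; last first.
  by rewrite mulrzAr raddfMz /= trP // pmulrn mulrzA mulrzAC.
move/eqP; rewrite psumr_eq0 => [/allP/(_ x0 x0s)/=|x _].
  by rewrite !mulf_eq0 (negPf f0) orbF /= eqz_nat mxrank_eq0 (negPf Px0).
by rewrite mulrAC mulr_ge0 // -expr2 sqr_ge0.
Qed.

End CartanSplit.

(** The hypotheses carry over to an extension that splits the characteristic polynomial, and
    nilpotency descends from there. *)
Lemma cartan_nilpotent (K : fieldType) (charK : [pchar K] =i pred0) n (X : 'M[K]_n)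
    r (a b : 'I_r -> 'M[K]_n) :
    X = \sum_i (a i *m b i - b i *m a i) ->
    (forall j, \sum_i \tr (a i *m iter j (fun Z => X *m Z - Z *m X) (b i)) = 0) ->
  exists N, X ^+ N = 0.
Proof.
case: n X a b => [|n] X a b defX tr0; first by exists 0%N; apply/matrixP; case.
have cp0 : char_poly X != 0 by rewrite monic_neq0 ?char_poly_monic.
have [F [iota [s eqs]]] := splitting_extension cp0.
have charF : [pchar F] =i pred0 by move=> p; rewrite (fmorph_pchar iota) charK.
pose f := map_mx iota.
have itE j i : iter j (mx_ad (f n.+1 n.+1 X)) (f _ _ (b i)) =
    f _ _ (iter j (fun Z => X *m Z - Z *m X) (b i)).
  elim: j => //= j ->; rewrite lfunE /= /mx_commutator /f map_mxB !map_mxM.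
  by [].
have [|||N XN] := @cartan_nilpotent_split F n charF (f _ _ X) r (fun i => f _ _ (a i)) (fun i => f _ _ (b i)) _ _ s.
- rewrite {1}defX /f raddf_sum; apply: eq_bigr => i _.
  by rewrite raddfB /= !map_mxM.
- move=> j; rewrite -[RHS](rmorph0 iota) -(tr0 j) rmorph_sum; apply: eq_bigr => i _.
  by rewrite itE -mulmxE -map_mxM trace_map_mx.
- by rewrite -map_char_poly (eqp_dvdl _ eqs).
exists N; apply/eqP; rewrite -(map_mx_eq0 iota); apply/eqP.
by rewrite -[RHS]XN; apply: rmorphXn.
Qed.

Import VectorInternalTheory.

(** * Traces of endomorphisms, and Cartan's criterion for them *)

Section LfunTrace.
Variables (K : fieldType) (V : vectType K).
Implicit Types f g h : 'End(V).

Lemma mul_rV_f2mx f u : u *m f2mx f = v2r (f (r2v u)).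
Proof. by rewrite [in RHS]unlock /= !r2vK. Qed.

Lemma f2mx_comp f g : f2mx (f \o g)%VF = f2mx g *m f2mx f.
Proof.
apply/row_matrixP=> i; rewrite !rowE mulmxA !mul_rV_f2mx comp_lfunE.
by rewrite v2rK.
Qed.

Lemma f2mx_is_linear : linear (@f2mx K V V).
Proof.
move=> c f g; apply/row_matrixP=> i.
rewrite !rowE mulmxDr -scalemxAr !mul_rV_f2mx add_lfunE scale_lfunE.
by rewrite linearP.
Qed.
HB.instance Definition _ := GRing.isLinear.Build K _ _ _ _ f2mx_is_linear.

Definition lfun_trace f : K := \tr (f2mx f).

Lemma lfun_trace_is_linear : scalar lfun_trace.
Proof. by move=> c f g; rewrite /lfun_trace !linearP. Qed.
HB.instance Definition _ := GRing.isLinear.Build K _ _ _ lfun_trace lfun_trace_is_linear.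

Lemma lfun_traceC f g : lfun_trace (f \o g)%VF = lfun_trace (g \o f)%VF.
Proof. by rewrite /lfun_trace !f2mx_comp mxtrace_mulC. Qed.

Lemma f2mx_iter f n v : v2r (iter n f v) = v2r v *m (f2mx f) ^+ n.
Proof.
elim: n => [|n IH]; first by rewrite expr0 mulmx1.
by rewrite iterS exprSr -mulmxE mulmxA -IH mul_rV_f2mx v2rK.
Qed.

Lemma f2mx_exp_eq0 f n : (f2mx f) ^+ n = 0 <-> (forall v, iter n f v = 0).
Proof.
split=> [f0 v|f0]; first by apply: v2r_inj; rewrite f2mx_iter f0 mulmx0 linear0.
by apply/row_matrixP=> i; rewrite !rowE mulmx0 -[delta_mx _ _]r2vK -f2mx_iter f0 linear0.
Qed.

Lemma lfun_trace_nilpotent f n : (forall v, iter n f v = 0) -> lfun_trace f = 0.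
Proof. by move/f2mx_exp_eq0; apply: trace_nilpotent. Qed.

Lemma cartan_nilpotent_end (charK : [pchar K] =i pred0) (X : 'End(V)) r (a b : 'I_r -> 'End(V)) :
    X = \sum_i lie (a i) (b i) ->
    (forall j, \sum_i lfun_trace (a i \o iter j (ad X) (b i))%VF = 0) ->
  exists N, forall v, iter N X v = 0.
Proof.
move=> defX tr0.
(* Matrices act on row vectors, so [f2mx] reverses composition and each bracket changes sign. *)
have itE j i : iter j (fun Z => f2mx X *m Z - Z *m f2mx X) (f2mx (b i)) =
    (-1) ^+ j *: f2mx (iter j (ad X) (b i)).
  elim: j => [|j IH]; first by rewrite scale1r.
  rewrite !iterS IH -scalemxAr -scalemxAl -scalerBr exprSr mulrN1 scaleNr -scalerN.
  congr (_ *: _); rewrite adE [lie _ _]/(_ - _)%R linearB /= !f2mx_comp.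
  by rewrite opprB.
have [||N XN] := cartan_nilpotent charK (X := f2mx X) (a := fun i => - f2mx (a i)) (b := fun i => f2mx (b i)).
- rewrite {1}defX linear_sum; apply: eq_bigr => i _ /=.
  rewrite [lie _ _]/(_ - _)%R linearB /= !f2mx_comp.
  by rewrite mulNmx mulmxN opprK addrC.
- move=> j; under eq_bigr do rewrite itE -scalemxAr mxtraceZ mulNmx raddfN /= mxtrace_mulC -f2mx_comp -/(lfun_trace _).
  by rewrite -mulr_sumr sumrN tr0 oppr0 mulr0.
by exists N; apply/f2mx_exp_eq0.
Qed.

End LfunTrace.

(** * Spans of brackets, and Cartan's criterion for solvability *)

Section LieSpan.
Variables (K : fieldType) (L : lieAlgType K).
Implicit Types (U V W I : {vspace L}) (x y : L).

Lemma memv_lie_vs U V x y : x \in U -> y \in V -> lie x y \in lie_vs U V.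
Proof.
move=> xU yV; rewrite (coord_vbasis xU) (coord_vbasis yV) linear_sum memv_suml // => j _ /=.
rewrite lieC linear_sum -sumrN memv_suml // => i _; rewrite -lieC.
rewrite lieZl lieZr !memvZ //; apply: memv_span; apply: allpairs_f.
  by rewrite mem_nth ?size_tuple.
by rewrite mem_nth ?size_tuple.
Qed.

Lemma lie_vs_subP U V W :
  (lie_vs U V <= W)%VS <-> (forall x y, x \in U -> y \in V -> lie x y \in W).
Proof.
split=> [UVW x y xU yV|h]; first by apply: (subvP UVW); apply: memv_lie_vs.
apply/span_subvP=> _ /allpairsP[[x y] [/= xU yV ->]].
by apply: h; apply: vbasis_mem.
Qed.

Lemma lie_vsS U1 U2 V1 V2 : (U1 <= U2)%VS -> (V1 <= V2)%VS -> (lie_vs U1 V1 <= lie_vs U2 V2)%VS.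
Proof.
by move=> UU VV; apply/lie_vs_subP=> x y xU yV; apply: memv_lie_vs; [apply: (subvP UU)|apply: (subvP VV)].
Qed.

Lemma lie_vsP U V x : x \in lie_vs U V ->
  exists r (a b : 'I_r -> L), [/\ forall i, a i \in U, forall i, b i \in V & x = \sum_i lie (a i) (b i)].
Proof.
pose P x := exists s : seq (L * L), all (fun p => (p.1 \in U) && (p.2 \in V)) s /\
  x = \sum_(p <- s) lie p.1 p.2.
have [||W WP] := @vspace_of_pred _ _ P.
- by exists [::]; rewrite big_nil.
- move=> c u v [s [sP ->]] [t [tP ->]].
  exists ([seq (c *: p.1, p.2) | p <- s] ++ t); split.
    rewrite all_cat tP andbT all_map; apply: sub_all sP => p /= /andP[p1 p2].
    by rewrite memvZ.
  rewrite big_cat big_map /= scaler_sumr; congr (_ + _).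
  by apply: eq_bigr => p _; rewrite lieZl.
have sub : (lie_vs U V <= W)%VS.
  apply/lie_vs_subP=> u v uU vV; apply/WP; exists [:: (u, v)].
  by rewrite /= uU vV big_seq1.
move=> /(subvP sub)/WP[s [/allP sP ->]].
exists (size s), (fun i => (tnth (in_tuple s) i).1), (fun i => (tnth (in_tuple s) i).2).
split=> [i|i|]; try by case/andP: (sP _ (mem_tnth i (in_tuple s))).
by rewrite big_tnth.
Qed.

Lemma lie_subalg_lie_vs U : lie_subalg U <-> (lie_vs U U <= U)%VS.
Proof. by rewrite lie_vs_subP. Qed.

Lemma lie_solvable_lie_vs U : lie_solvable (lie_vs U U) -> lie_solvable U.
Proof. by case=> n n0; exists n.+1; rewrite iterSr. Qed.

End LieSpan.

(** ad f is the difference of left and right composition with f, two commuting maps that are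
    nilpotent of order n. *)
Lemma lie_nilpotent_left (K : fieldType) (V : vectType K) (f g : 'End(V)) n :
  (forall v, iter n f v = 0) -> iter (n + n) (ad f) g = 0.
Proof.
move=> f0.
have Llin : linear (fun h : 'End(V) => (f \o h)%VF).
  by move=> c h h'; rewrite comp_lfunDr comp_lfunZr.
have Rlin : linear (fun h : 'End(V) => (h \o f)%VF).
  by move=> c h h'; rewrite comp_lfunDl comp_lfunZl.
pose LF : {linear 'End(V) -> 'End(V)} := HB.pack (fun h : 'End(V) => (f \o h)%VF) (GRing.isLinear.Build K _ _ _ _ Llin).
pose RF : {linear 'End(V) -> 'End(V)} := HB.pack (fun h : 'End(V) => (h \o f)%VF) (GRing.isLinear.Build K _ _ _ _ Rlin).
apply: (@iter_nilB _ _ (linfun LF) (linfun RF)).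
- by move=> h; rewrite !lfunE /= comp_lfunA.
- by move=> h; rewrite adE !lfunE.
- have E m v : iter m (linfun LF) g v = iter m f (g v).
    by elim: m => [//|m IH]; rewrite !iterS lfunE /= comp_lfunE IH.
  by apply/lfunP=> v; rewrite E f0 zero_lfunE.
have E m v : iter m (linfun RF) g v = g (iter m f v).
  by elim: m v => [//|m IH] v; rewrite iterS lfunE /= comp_lfunE IH -iterSr.
by apply/lfunP=> v; rewrite E f0 linear0 zero_lfunE.
Qed.


(** If [I, I] is proper, induct. Otherwise every element of I is a sum of brackets, so Cartan's
    criterion makes it act nilpotently; faithfulness on I turns this into nilpotency of [ad], and by
    Engel's theorem a perfect I is then 0. *)
Lemma cartan_solvable (K : fieldType) (charK : [pchar K] =i pred0) (L : lieAlgType K)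
    (V : vectType K) (rho : 'Hom(L, 'End(V))) (I : {vspace L}) :
    (forall x y, rho (lie x y) = lie (rho x) (rho y)) ->
    lie_subalg I -> (I :&: lker rho)%VS = 0%VS ->
    (forall x y, x \in I -> y \in I -> lfun_trace (rho x \o rho y)%VF = 0) ->
  lie_solvable I.
Proof.
move=> rhoM; have [n] := ubnP (\dim I); elim: n I => // n IHn I ltn subI ker0 tr0.
have JI : (lie_vs I I <= I)%VS by apply/lie_subalg_lie_vs.
have [eqJ|neJ] := eqVneq (lie_vs I I) I; last first.
  apply: lie_solvable_lie_vs; apply: IHn.
  - apply: (@leq_trans (\dim I)) => //; rewrite ltn_neqAle dimvS // andbT.
    by apply: contra neJ => /eqP E; rewrite eqEdim JI E leqnn.
  - by apply/lie_subalg_lie_vs; apply: lie_vsS.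
  - by apply/eqP; rewrite -subv0 -ker0; apply: capvS.
  - by move=> x y /(subvP JI) xI /(subvP JI) yI; apply: tr0.
have adI j x y : x \in I -> y \in I -> iter j (ad x) y \in I.
  by move=> xI; apply: iter_lfun_mem => z zI; rewrite adE; apply: subI.
have rhoad j x y : iter j (ad (rho x)) (rho y) = rho (iter j (ad x) y).
  by elim: j => //= j ->; rewrite !adE rhoM.
have nilI x : x \in I -> exists N, forall v, iter N (rho x) v = 0.
  move=> xI; move: (xI); rewrite -{1}eqJ => /lie_vsP[r [a [b [aI bI def_x]]]].
  apply: (cartan_nilpotent_end charK (a := fun i => rho (a i)) (b := fun i => rho (b i))).
    by rewrite def_x linear_sum; apply: eq_bigr => i _; exact: rhoM.
  by move=> j; apply: big1 => i _; rewrite rhoad tr0 // adI.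
have adnil x y : x \in I -> y \in I -> exists N, iter N (ad x) y = 0.
  move=> xI yI; have [N N0] := nilI x xI; exists (N + N)%N.
  apply/eqP; rewrite -memv0 -ker0 memv_cap adI //= memv_ker -rhoad.
  by rewrite lie_nilpotent_left.
exists 0%N => /=; apply: (engel_image subI adnil (rho := ad)).
- by move=> x y v _ _; rewrite !adE [in RHS]lie_jacobi addrK.
- by move=> x u xI uI; rewrite adE subI.
- exact: adnil.
move=> W WI h; apply/eqP; rewrite eqEsubv WI /= -{1}eqJ; apply/lie_vs_subP=> x y xI yI.
by rewrite -adE h.
Qed.

(** * Whitehead's lemma *)

Lemma dimv_rV (K : fieldType) n : \dim {:'rV[K]_n} = n.
Proof. by rewrite dimvf [LHS]dim_matrix [LHS]mul1n. Qed.

Section InvariantForm.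
Variables (K : fieldType) (L : lieAlgType K) (V : vectType K).
Variable rho : 'Hom(L, 'End(V)).
Hypothesis rhoM : forall x y, rho (lie x y) = lie (rho x) (rho y).
Implicit Types (x y z : L) (I J : {vspace L}).

Definition trace_form x y : K := lfun_trace (rho x \o rho y)%VF.

Lemma trace_formC x y : trace_form x y = trace_form y x.
Proof. exact: lfun_traceC. Qed.

Lemma trace_form_is_linear x : scalar (trace_form x).
Proof.
move=> a y z; rewrite /trace_form linearP /= comp_lfunDr -comp_lfunZr.
by rewrite linearP.
Qed.
HB.instance Definition _ x := GRing.isLinear.Build K L K _ (trace_form x) (trace_form_is_linear x).

Lemma trace_form_linearl y : scalar (trace_form^~ y).
Proof. by move=> a x z; rewrite !(trace_formC _ y) linearP. Qed.

Lemma trace_formNl x y : trace_form (- x) y = - trace_form x y.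
Proof. by rewrite !(trace_formC _ y) linearN. Qed.

Lemma trace_form_inv x y z : trace_form (lie x y) z = trace_form x (lie y z).
Proof.
rewrite /trace_form !rhoM /lie /= /gl_bracket comp_lfunDl comp_lfunDr comp_lfunNl comp_lfunNr.
rewrite !linearB /= -!comp_lfunA; congr (_ - _).
by rewrite lfun_traceC -comp_lfunA [RHS]lfun_traceC -!comp_lfunA [LHS]lfun_traceC -!comp_lfunA.
Qed.

Lemma orthogonal_exists J : exists I : {vspace L},
  (forall x, x \in I <-> forall y, y \in J -> trace_form x y = 0) /\
  (\dim {:L} <= \dim I + \dim J)%N.
Proof.
pose f x : 'rV[K]_(\dim J) := \row_i trace_form x (vbasis J)`_i.
have linf : linear f.
  by move=> a x y; apply/rowP=> i; rewrite !mxE trace_form_linearl.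
pose F : {linear L -> 'rV[K]_(\dim J)} := HB.pack f (GRing.isLinear.Build K _ _ _ f linf).
exists (lker (linfun F)); split=> [x|]; last first.
  rewrite -(limg_ker_dim (linfun F) fullv) capfv leq_add2l.
  by apply: leq_trans (dimvS (subvf _)) _; rewrite dimv_rV.
rewrite memv_ker lfunE; split=> [/eqP/rowP fx y yJ|h].
  rewrite (coord_vbasis yJ) linear_sum big1 // => i _; rewrite linearZ /=.
  by have := fx i; rewrite !mxE => ->; rewrite mulr0.
by apply/eqP/rowP=> i; rewrite !mxE h // vbasis_mem // mem_nth ?size_tuple.
Qed.

End InvariantForm.

(** * Semisimple Lie algebras and the Casimir element *)

Section Semisimple.
Variable K : fieldType.
Hypothesis charK : [pchar K] =i pred0.

Definition lie_semisimple (S : lieAlgType K) :=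
  forall I : {vspace S}, lie_ideal I fullv -> lie_solvable I -> I = 0%VS.

Variable S : lieAlgType K.
Hypothesis ssS : lie_semisimple S.
Implicit Types (I J : {vspace S}) (x y z : S).

Lemma ad_morphism (L : lieAlgType K) (x y : L) : ad (lie x y) = lie (ad x) (ad y).
Proof. by apply/lfunP=> z; rewrite gl_lieE !adE lie_jacobi addrK. Qed.

Lemma lie_abelian_solvable (L : lieAlgType K) (I : {vspace L}) :
  (forall x y : L, x \in I -> y \in I -> lie x y = 0) -> lie_solvable I.
Proof.
move=> h; exists 1%N; apply/eqP; rewrite -subv0; apply/lie_vs_subP=> x y xI yI.
by rewrite h ?mem0v.
Qed.

Lemma semisimple_center x : (forall y, lie x y = 0) -> x = 0.
Proof.
move=> x0; apply/eqP; rewrite -memv0 -(@ssS (lker ad)).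
- by rewrite memv_ker; apply/eqP/lfunP=> y; rewrite adE x0 zero_lfunE.
- split=> [|y z _]; first exact: subvf.
  rewrite !memv_ker => /eqP z0; apply/eqP/lfunP=> t.
  by rewrite lieC -adE z0 zero_lfunE oppr0 linear0.
apply: lie_abelian_solvable => y z.
by rewrite memv_ker => /eqP y0 _; rewrite -adE y0 zero_lfunE.
Qed.

Lemma semisimple_faithful : lker (@ad K S) = 0%VS.
Proof.
apply/eqP; rewrite -subv0; apply/subvP=> x; rewrite memv_ker memv0 => /eqP x0.
by apply/eqP/semisimple_center => y; rewrite -adE x0 zero_lfunE.
Qed.

(** The complement is the orthogonal for the Killing form; its intersection with J is solvable by
    Cartan's criterion, hence zero. *)
Lemma semisimple_ideal_compl J : lie_ideal J fullv ->
  exists I, [/\ lie_ideal I fullv, (J :&: I)%VS = 0%VS & (J + I)%VS = fullv].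
Proof.
move=> [_ idJ]; have [I [IP dimI]] := orthogonal_exists ad J.
have idI : lie_ideal I fullv.
  split=> [|x y _ /IP yI]; first exact: subvf.
  apply/IP=> z zJ; rewrite lieC trace_formNl (trace_form_inv (@ad_morphism S)).
  by rewrite yI ?idJ ?memvf // oppr0.
have JI0 : (J :&: I)%VS = 0%VS.
  apply: ssS.
    split=> [|x y _ /memv_capP[yJ yI]]; first exact: subvf.
    by rewrite memv_cap idJ ?memvf //= (proj2 idI) ?memvf.
  apply: (cartan_solvable charK (@ad_morphism S)).
  - move=> x y /memv_capP[xJ xI] /memv_capP[yJ yI].
    by rewrite memv_cap idJ ?memvf //= (proj2 idI) ?memvf.
  - by rewrite semisimple_faithful capv0.
  by move=> x y /memv_capP[_ /IP xI] /memv_capP[yJ _]; apply: xI.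
exists I; split=> //; apply/eqP; rewrite eqEdim subvf /=.
by rewrite dimv_disjoint_sum // addnC.
Qed.

(** An ideal complementary to [S, S] is abelian, hence zero. *)
Lemma semisimple_perfect : lie_vs {:S} {:S} = {:S}%VS.
Proof.
pose J := lie_vs {:S} {:S}.
have [|I [[_ idI] JI0 JI]] := @semisimple_ideal_compl J.
  by split=> [|x y _ _]; [exact: subvf | exact: memv_lie_vs (memvf _) (memvf _)].
have I0 : I = 0%VS.
  apply: ssS; first by split=> //; exact: subvf.
  apply: lie_abelian_solvable => x y xI yI; apply/eqP; rewrite -memv0 -JI0 memv_cap.
  by rewrite memv_lie_vs ?memvf ?idI ?memvf.
by rewrite -[RHS]JI I0 addv0.
Qed.

Section Casimir.
Variables (V : vectType K) (rho : 'Hom(S, 'End(V))).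
Hypothesis rhoM : forall x y, rho (lie x y) = lie (rho x) (rho y).
Local Notation beta := (trace_form rho).

(** Dual bases, for the trace form, of an ideal I complementary to ker rho. Invariance of the
    Casimir tensor is stated against every bilinear Psi; this avoids tensor products and serves both
    for the Casimir operator and for its analogue on cocycles. *)
Lemma casimir_basis : exists (d : nat) (e e' : 'I_d -> S),
  [/\ forall i j, beta (e i) (e' j) = (i == j)%:R,
      d = 0%N -> rho = 0 &
      forall (W : vectType K) (Psi : S -> S -> W) (x : S),
        (forall y, linear (Psi^~ y)) -> (forall y, linear (Psi y)) ->
        \sum_i (Psi (lie x (e i)) (e' i) + Psi (e i) (lie x (e' i))) = 0].
Proof.
have [|I [[_ idI] JI0 JI]] := @semisimple_ideal_compl (lker rho).
  split=> [|x y _]; first exact: subvf.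
  rewrite !memv_ker rhoM => /eqP->; apply/eqP/lfunP=> v.
  by rewrite gl_lieE !zero_lfunE linear0 subr0.
(* I meets its own orthogonal in a solvable ideal, so the trace form is nondegenerate on I. *)
have [R [RP _]] := orthogonal_exists rho I.
have idR x y : y \in (I :&: R)%VS -> lie x y \in (I :&: R)%VS.
  move=> /memv_capP[yI /RP yR]; rewrite memv_cap idI ?memvf //=; apply/RP=> z zI.
  rewrite lieC trace_formNl (trace_form_inv rhoM).
  by rewrite yR ?idI ?memvf // oppr0.
have nondeg x : x \in I -> (forall y, y \in I -> beta x y = 0) -> x = 0.
  move=> xI /RP xR; apply/eqP; rewrite -memv0 -(_ : I :&: R = 0)%VS ?memv_cap ?xI //.
  apply: ssS; first by split=> [|t y _ yR]; [exact: subvf | exact: idR].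
  apply: (cartan_solvable charK rhoM).
  - by move=> t y _; apply: idR.
  - by apply/eqP; rewrite -subv0 -JI0 capvC capvS // capvSl.
  by move=> t y /memv_capP[_ /RP tR] /memv_capP[yI _]; apply: tR.
pose d := \dim I; pose e (i : 'I_d) := (vbasis I)`_i.
have eI i : e i \in I by rewrite vbasis_mem // mem_nth ?size_tuple.
pose f y : 'rV[K]_d := \row_i beta (e i) y.
have linf : linear f by move=> a y z; apply/rowP=> i; rewrite !mxE linearP.
pose F : {linear S -> 'rV[K]_d} := HB.pack f (GRing.isLinear.Build K _ _ _ f linf).
have Finj x : x \in I -> f x = 0 -> x = 0.
  move=> xI /rowP fx; apply: nondeg => // y yI.
  rewrite trace_formC -[beta y x]/((beta^~ x) y) (coord_vbasis yI).
  rewrite trace_formC linear_sum big1 // => i _; rewrite linearZ /= trace_formC.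
  by have := fx i; rewrite !mxE => ->; rewrite mulr0.
have Fimg : (linfun F @: I)%VS = fullv.
  apply/eqP; rewrite eqEdim subvf /= limg_dim_eq.
    by rewrite dimv_rV.
  apply/eqP; rewrite -subv0; apply/subvP=> x /memv_capP[xI].
  by rewrite memv_ker memv0 => /eqP Fx; rewrite (Finj x xI) //; exact: etrans (esym (lfunE F x)) Fx.
have ex_e' (j : 'I_d) : exists y, y \in I /\ f y = delta_mx ord0 j.
  have : delta_mx ord0 j \in (linfun F @: I)%VS by rewrite Fimg memvf.
  by move=> /memv_imgP[y yI ->]; exists y; split=> //; exact: esym (lfunE F y).
have [e' e'P] : exists e' : 'I_d -> S, forall j, e' j \in I /\ f (e' j) = delta_mx ord0 j.
  by have [e' e'P] := fin_all_exists ex_e'; exists e'.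
have dual i j : beta (e i) (e' j) = (i == j)%:R.
  by have [_ /rowP/(_ i)] := e'P j; rewrite !mxE.
have expand x : x \in I -> x = \sum_i beta x (e' i) *: e i.
  move=> xI; rewrite [LHS](coord_vbasis xI); apply: eq_bigr => i _; congr (_ *: _).
  rewrite [in RHS](coord_vbasis xI) trace_formC linear_sum (bigD1 i) //= linearZ /=.
  rewrite trace_formC dual eqxx mulr1 big1 ?addr0 // => j ji.
  by rewrite linearZ /= trace_formC dual (negPf ji) mulr0.
have expand' x : x \in I -> x = \sum_i beta (e i) x *: e' i.
  move=> xI; apply/eqP; rewrite -subr_eq0; apply/eqP; apply: Finj.
    by rewrite memvB // memv_suml // => i _; rewrite memvZ //; case: (e'P i).
  apply/rowP=> j; rewrite !mxE linearB linear_sum /= (bigD1 j) //= linearZ /= dual eqxx mulr1.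
  rewrite big1 ?addr0 ?subrr // => i ij.
  by rewrite linearZ /= dual eq_sym (negPf ij) mulr0.
exists d, e, e'; split=> //.
  move=> d0; have I0 : I = 0%VS by apply/eqP; rewrite -dimv_eq0 -/d d0.
  apply/lfunP=> x; rewrite zero_lfunE; apply/eqP; rewrite -memv_ker.
  by rewrite -[lker _]addv0 -I0 JI memvf.
move=> W Psi x linl linr.
pose Pl y : {linear S -> W} := HB.pack (Psi^~ y) (GRing.isLinear.Build K _ _ _ _ (linl y)).
pose Pr y : {linear S -> W} := HB.pack (Psi y) (GRing.isLinear.Build K _ _ _ _ (linr y)).
rewrite big_split /=.
have -> : \sum_i Psi (lie x (e i)) (e' i) =
    \sum_i \sum_j beta (lie x (e i)) (e' j) *: Psi (e j) (e' i).
  apply: eq_bigr => i _; rewrite -[LHS]/(Pl (e' i) _) {1}(expand (lie x (e i))) ?idI ?memvf //.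
  by rewrite linear_sum; apply: eq_bigr => j _; rewrite linearZ.
have -> : \sum_i Psi (e i) (lie x (e' i)) =
    - \sum_i \sum_j beta (lie x (e j)) (e' i) *: Psi (e i) (e' j).
  rewrite -sumrN; apply: eq_bigr => i _; rewrite -[LHS]/(Pr (e i) _).
  rewrite {1}(expand' (lie x (e' i))) ?idI ?memvf //; last by case: (e'P i).
  rewrite linear_sum -sumrN; apply: eq_bigr => j _; rewrite linearZ /= -(trace_form_inv rhoM).
  by rewrite lieC trace_formNl scaleNr.
by rewrite [X in _ - X]exchange_big subrr.
Qed.

End Casimir.
End Semisimple.

Section Whitehead.
Variables (K : fieldType) (S : lieAlgType K).
Hypothesis charK : [pchar K] =i pred0.
Hypothesis ssS : lie_semisimple S.

(** With C the Casimir operator and w the sum of the rho(e_i) c(e'_i), invariance gives C (c x) =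
    rho(x) w. So c is a coboundary where C is invertible, and Fitting's lemma reduces to the kernel
    of a power of C. This is a proper subspace because tr C is the number of basis vectors, nonzero
    in characteristic 0. *)
Lemma whitehead_cocycle (V : vectType K) (rho : 'Hom(S, 'End(V))) (c : 'Hom(S, V)) :
    (forall x y, rho (lie x y) = lie (rho x) (rho y)) ->
    (forall x y, c (lie x y) = rho x (c y) - rho y (c x)) ->
  exists v, forall x, c x = rho x v.
Proof.
have [n] := ubnP (\dim {:V}); elim: n V rho c => // n IHn V rho c ltn rhoM cP.
have [d [e [e' [dual d0 inv]]]] := casimir_basis charK ssS rhoM.
case: d e e' dual d0 inv => [|d] e e' dual d0 inv.
  (* No basis vectors: rho = 0, and c vanishes on [S, S] = S. *)
  have rho0 := d0 erefl; exists 0 => x; rewrite linear0; apply/eqP; rewrite -memv_ker.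
  have : (lie_vs {:S} {:S} <= lker c)%VS.
    by apply/lie_vs_subP=> y z _ _; rewrite memv_ker cP rho0 !zero_lfunE subr0.
  by rewrite (semisimple_perfect charK ssS) => /subvP; apply; apply: memvf.
pose C : 'End(V) := \sum_i (rho (e i) \o rho (e' i))%VF.
have rhoE x y v : rho (lie x y) v = rho x (rho y v) - rho y (rho x v).
  by rewrite rhoM gl_lieE.
have rhoEE x y v : rho x (rho y v) = rho (lie x y) v + rho y (rho x v).
  by rewrite rhoE subrK.
have Crho x v : C (rho x v) = rho x (C v).
  apply/esym/eqP; rewrite -subr_eq0 /C !sum_lfunE linear_sum -sumrB /=; apply/eqP.
  have := inv V (fun y z => rho y (rho z v)) x; move=> h; rewrite -[RHS]h.
  - apply: eq_bigr => i _; rewrite /= !comp_lfunE (rhoEE x (e i)) (rhoEE x (e' i)) linearD /=.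
    by rewrite addrA addrK.
  - by move=> y a z t; rewrite linearP /= add_lfunE scale_lfunE.
  - by move=> y a z t; rewrite linearP /= add_lfunE scale_lfunE linearP.
pose w := \sum_i rho (e i) (c (e' i)).
have Cc x : C (c x) = rho x w.
  apply/esym/eqP; rewrite -subr_eq0 /C /w sum_lfunE linear_sum -sumrB /=; apply/eqP.
  have := inv V (fun y z => rho y (c z)) x; move=> h; rewrite -[RHS]h.
  - apply: eq_bigr => i _; rewrite /= comp_lfunE (rhoEE x (e i)) cP linearB /=.
    by rewrite addrA.
  - by move=> y a z t; rewrite linearP /= add_lfunE scale_lfunE.
  - by move=> y a z t; rewrite linearP /= linearP.
have Citer k x v : iter k C (rho x v) = rho x (iter k C v).
  exact: (iter_lfun_comm (fun u => Crho x u)).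
have [m m1 fit] := fitting 1 (fun z (_ : z \in {:V}%VS) => memvf (C z)).
case: m m1 fit => // m _ /(_ w (memvf w))[a [b [_ _ def_w Ca]]].
(* Since w = a + C^(m+1) b and C^(m+1) a = 0, the coboundary of C^m b agrees with c modulo the
   kernel of C^(m+2). *)
pose v0 := iter m C b.
have cv x : iter m.+2 C (c x - rho x v0) = 0.
  rewrite iter_lfunB (Citer _ _ v0) iterSr Cc Citer def_w iter_lfunD Ca add0r /v0.
  by rewrite -!iterD !addSn !addnS subrr.
have [U UP] : exists U : {vspace V}, forall v, v \in U <-> iter m.+2 C v = 0.
  apply: vspace_of_pred => [|k u v u0 v0']; first exact: iter_lfun0.
  rewrite iter_lfunD v0' addr0.
  have -> : iter m.+2 C (k *: u) = k *: iter m.+2 C u.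
    by elim: (m.+2) => // j IH; rewrite !iterS IH linearZ.
  by rewrite u0 scaler0.
have ltU : (\dim U < n)%N.
  apply: (@leq_trans (\dim {:V})) => //; rewrite ltn_neqAle dimvS ?subvf // andbT.
  apply/negP=> /eqP dimU; have : lfun_trace C = 0.
    apply: (@lfun_trace_nilpotent _ _ _ m.+2) => v; apply/UP.
    have /eqP-> : U == {:V}%VS by rewrite eqEdim subvf dimU leqnn.
    exact: memvf.
  rewrite /C linear_sum /= => /eqP; rewrite (eq_bigr (fun=> 1)).
    by rewrite sumr_const card_ord (negPf (natr_pchar0_neq0 charK _)).
  by move=> i _; rewrite -[LHS]/(trace_form rho (e i) (e' i)) dual eqxx.
have rhoU x v : v \in U -> rho x v \in U.
  by move=> /UP v0'; apply/UP; rewrite Citer v0' linear0.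
pose rho0 : 'Hom(S, 'End(subvs_of U)) := (restr U \o rho)%VF.
have rho0E x (u : subvs_of U) : vsval (rho0 x u) = rho x (vsval u).
  by rewrite comp_lfunE restrE vsprojK // rhoU ?subvsP.
have c0lin : linear (fun x => vsproj U (c x - rho x v0)).
  move=> k x y; rewrite -linearP; congr (vsproj U _).
  by rewrite !linearP /= add_lfunE scale_lfunE scalerBr opprD addrACA.
pose C0 : {linear S -> subvs_of U} := HB.pack (fun x => vsproj U (c x - rho x v0)) (GRing.isLinear.Build K _ _ _ _ c0lin).
have c0E x : vsval (linfun C0 x) = c x - rho x v0.
  by rewrite lfunE /= vsprojK //; apply/UP.
have [|||u uP] := IHn (subvs_of U) rho0 (linfun C0).
- by rewrite dimvf; exact: ltU.
- move=> x y; apply/lfunP=> u; apply: val_inj; rewrite gl_lieE.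
  by apply: etrans (rho0E _ _) _; rewrite rhoE -!rho0E.
- move=> x y; apply: val_inj; apply: etrans (c0E _) _.
  rewrite [RHS]/(vsval _ - vsval _) !rho0E !c0E cP rhoE (linearB (rho x)) (linearB (rho y)).
  by rewrite !opprB addrACA [RHS]addrACA (addrC (- rho y (c x))).
exists (v0 + vsval u) => x; rewrite linearD /= -rho0E -uP c0E.
by rewrite addrC subrK.
Qed.

End Whitehead.

(** * Jordan components: generalized kernels, and restriction along injections *)

Section JordanKernels.
Variables (K : fieldType) (V : vectType K).
Hypothesis charK : [pchar K] =i pred0.
Implicit Types (X S N Y : 'End(V)).

Lemma semisimple_part_comm X S : semisimple_part X S -> forall v, X (S v) = S (X v).
Proof.
case=> N [_ _ SN ->] v; rewrite !add_lfunE linearD /=; congr (_ + _).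
by have := congr1 (fun f : 'End(V) => f v) SN; rewrite !comp_lfunE.
Qed.

(** S = X - N with N nilpotent and commuting with X, so S too is nilpotent at v; a semisimple S then
    kills v. *)
Lemma semisimple_part_ker X S v n : semisimple_part X S -> iter n X v = 0 -> S v = 0.
Proof.
case=> N [ssS /nilpotent_endP[p N0] SN ->] Xv.
have comm u : S (N u) = N (S u).
  by have := congr1 (fun f : 'End(V) => f u) SN; rewrite !comp_lfunE.
apply: (semisimple_ker_iter (n := n + p) ssS).
apply: (@iter_nilB _ _ (S + N) N) => // u; last by rewrite add_lfunE addrK.
by rewrite !add_lfunE linearD /= comm.
Qed.

Lemma semisimple_part_nil X S : semisimple_part X S ->
  exists n, forall v, S v = 0 -> iter n X v = 0.
Proof.
case=> N [_ /nilpotent_endP[n N0] SN ->]; exists n => v Sv.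
have comm u : S (N u) = N (S u).
  by have := congr1 (fun f : 'End(V) => f u) SN; rewrite !comp_lfunE.
rewrite -(N0 v); elim: n {N0} v Sv => // n IH v Sv.
rewrite !iterSr add_lfunE Sv add0r IH //.
by rewrite comm Sv linear0.
Qed.

(** The same argument one level up: ad S = ad X - ad N, and for semisimple S a generalized kernel of
    ad S is its kernel. *)
Lemma semisimple_part_ad X S Y n : semisimple_part X S ->
  iter n (ad X) Y = 0 -> forall v, Y (S v) = S (Y v).
Proof.
case=> N [ssS /nilpotent_endP[p N0] SN ->] XY v.
suff : lie S Y = 0.
  move/(congr1 (fun f : 'End(V) => f v)); rewrite gl_lieE zero_lfunE => /eqP.
  by rewrite subr_eq0 => /eqP.
apply: (@semisimple_ad_iter _ charK _ _ _ (n + (p + p)) ssS).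
apply: (@iter_nilB _ _ (ad (S + N)) (ad N)) => //; last exact: lie_nilpotent_left.
  have comm : lie S N = 0.
    apply/lfunP=> u; rewrite gl_lieE zero_lfunE; apply/eqP; rewrite subr_eq0; apply/eqP.
    by have := congr1 (fun f : 'End(V) => f u) SN; rewrite !comp_lfunE.
  move=> Z; apply/eqP; rewrite -subr_eq0 -gl_lieE -ad_morphism lieDl comm add0r liexx.
  by rewrite linear0 zero_lfunE.
by move=> Z; rewrite linearD /= add_lfunE addrK.
Qed.

(** The vector p(X) v, written without the algebra of endomorphisms so that it also makes sense on a
    zero space. *)
Definition pact X (p : {poly K}) v : V := \sum_(i < size p) p`_i *: iter i X v.

Lemma pactE (Vp : (0 < dim V)%N) X p v :
  pact X p v = (horner_alg (X : lfun_algType Vp) p : 'End(V)) v.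
Proof.
rewrite -[in RHS](coefK p) poly_def raddf_sum /= (@sum_lfunE K V V); apply: eq_bigr => j _.
rewrite linearZ /= rmorphXn /= horner_algX mulr_algl (@scale_lfunE K V V).
by rewrite lfun_alg_expE.
Qed.

Lemma semisimple_pactP X : semisimple_end X <->
  exists p, separable_poly p /\ forall v, pact X p v = 0.
Proof.
have [Vp|/dim0_eq0 V0] := boolP (0 < dim V)%N; last first.
  split=> _; first by exists 1; split=> [|v]; [rewrite unlock coprime1p | rewrite [LHS]V0].
  move=> U _; exists {:V}%VS; split=> //; first by move=> f _; exact: subvf.
    by rewrite addvf.
  by rewrite capvf; apply/eqP; rewrite -subv0; apply/subvP=> v _; rewrite [v]V0 mem0v.
split=> [/(@semisimple_separable _ charK _ Vp)[p sp pX]|[p [sp pX]]].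
  by exists p; split=> // v; rewrite pactE pX; exact: zero_lfunE.
apply: (@separable_semisimple _ _ Vp _ _ sp); apply/lfunP=> v.
by rewrite -pactE pX [RHS]zero_lfunE.
Qed.

Lemma pact_mulX X p v : pact X (p * 'X) v = pact X p (X v).
Proof.
have [Vp|/dim0_eq0 V0] := boolP (0 < dim V)%N; last by rewrite [LHS]V0 [RHS]V0.
by rewrite !(pactE Vp) mulrC rmorphM /= horner_algX lfun_alg_mulE.
Qed.

End JordanKernels.

Section JordanTransfer.
Variables (K : fieldType) (V W : vectType K).
Hypothesis charK : [pchar K] =i pred0.
Variable j : 'Hom(W, V).
Hypothesis jinj : lker j = 0%VS.
Implicit Types (p : {poly K}).

Lemma iter_intertwine (X : 'End(V)) (X' : 'End(W)) : (forall w, j (X' w) = X (j w)) ->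
  forall n w, j (iter n X' w) = iter n X (j w).
Proof. by move=> jX; elim=> //= n IH w; rewrite jX IH. Qed.

Lemma pact_intertwine (X : 'End(V)) (X' : 'End(W)) : (forall w, j (X' w) = X (j w)) ->
  forall p w, j (pact X' p w) = pact X p (j w).
Proof.
move=> jX p w; rewrite linear_sum; apply: eq_bigr => i _ /=.
by rewrite linearZ /= (iter_intertwine jX).
Qed.

Lemma lker0_inj0 w : j w = 0 -> w = 0.
Proof. by move=> jw; apply/eqP; rewrite -memv0 -jinj memv_ker jw. Qed.

Lemma lker0_inj w w' : j w = j w' -> w = w'.
Proof. by have /eqP/lker0P := jinj; apply. Qed.

(** Through the injection j, a separable polynomial annihilating S annihilates [S'], and the
    nilpotent part stays nilpotent. *)
Lemma semisimple_part_sub (X S : 'End(V)) (X' S' : 'End(W)) :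
  (forall w, j (X' w) = X (j w)) -> (forall w, j (S' w) = S (j w)) ->
  semisimple_part X S -> semisimple_part X' S'.
Proof.
move=> jX jS [N [ssS nN SN defX]]; exists (X' - S').
have jN w : j ((X' - S') w) = N (j w).
  by rewrite add_lfunE opp_lfunE linearB /= jX jS defX add_lfunE addrC addKr.
split.
- have /(semisimple_pactP charK)[p [sp pS]] := ssS.
  apply/(semisimple_pactP charK); exists p; split=> // w.
  by apply: lker0_inj0; rewrite (pact_intertwine jS).
- have /nilpotent_endP[n N0] := nN; apply/nilpotent_endP; exists n => w.
  by apply: lker0_inj0; rewrite (iter_intertwine jN).
- apply/lfunP=> w; apply: lker0_inj; rewrite !comp_lfunE jS !jN jS.
  by have := congr1 (fun f : 'End(V) => f (j w)) SN; rewrite !comp_lfunE.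
by rewrite addrC subrK.
Qed.

End JordanTransfer.

Section LeviSemisimple.
Variables (K : fieldType) (g : lieAlgType K) (s r : {vspace g}).
Hypothesis subs : lie_subalg s.
Hypothesis radr : lie_radical r.
Hypothesis sr0 : (s :&: r)%VS = 0%VS.
Hypothesis srf : (s + r)%VS = fullv.

Definition sub_lieAlg (U : {vspace g}) (subU : lie_subalg U) : lieAlgType K :=
  lie_of_law (sub_lie_law subU).

Lemma sub_lieE (U : {vspace g}) (subU : lie_subalg U) (x y : sub_lieAlg subU) :
  vsval (lie x y : subvs_of U) = lie (vsval (x : subvs_of U)) (vsval (y : subvs_of U)).
Proof. by rewrite vsprojK // subU ?subvsP. Qed.

(** For a solvable ideal I of s, I + r is an ideal of g whose derived series enters r once that of I
    vanishes, so it is solvable. By maximality it lies in r, which meets s in 0. *)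
Lemma levi_semisimple : lie_semisimple (sub_lieAlg subs).
Proof.
move=> I [_ idI] [n In]; have [[_ idr] [N rN] maxr] := radr.
pose j : 'Hom(subvs_of s, g) := linfun vsval.
have jE x : j x = vsval x by rewrite lfunE.
have jI0 i : (iter i (fun V => lie_vs V V) ((j @: I)%VS + r)%VS <= j @: (iter i (fun V => lie_vs V V) I) + r)%VS.
  elim: i => [|i IH]; first exact: subvv.
  rewrite !iterS; apply/lie_vs_subP=> x y /(subvP IH)/memv_addP[_ /memv_imgP[a aI ->] [b br ->]].
  move=> /(subvP IH)/memv_addP[_ /memv_imgP[a' aI' ->] [b' br' ->]].
  rewrite lieDl lieDr -addrA memv_add //.
    rewrite !jE -sub_lieE -jE; apply: memv_img.
    exact: (@memv_lie_vs K (sub_lieAlg subs) _ _ a a' aI aI').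
  by apply: memvD; [|rewrite memv_lieC]; apply: idr; rewrite ?memvf.
have sub_r : ((j @: I)%VS + r <= r)%VS.
  apply: maxr; last first.
    exists (n + N)%N; apply/eqP; rewrite -subv0 addnC iterD -rN.
    have : (iter n (fun V => lie_vs V V) ((j @: I)%VS + r)%VS <= r)%VS.
      by apply: subv_trans (jI0 n) _; rewrite In limg0 add0v.
    move: (iter n _ _) => W Wr; elim: (N) => // i IH; rewrite !iterS.
    exact: lie_vsS.
  split=> [|x _ _ /memv_addP[_ /memv_imgP[a aI ->] [b br ->]]]; first exact: subvf.
  have := memvf x; rewrite -srf => /memv_addP[x0 x0s [x1 x1r ->]].
  rewrite lieDr lieDl -addrA memv_add //; last first.
    by apply: memvD; [rewrite memv_lieC|]; apply: idr; rewrite ?memvf.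
  by rewrite jE -(vsprojK x0s) -sub_lieE -jE; apply: memv_img; apply: idI; rewrite ?memvf.
apply/eqP; rewrite -subv0; apply/subvP=> x xI; rewrite memv0.
have : j x \in (s :&: r)%VS.
  rewrite memv_cap jE subvsP /=; apply: (subvP sub_r); apply: (subvP (addvSl _ _)).
  by rewrite -jE memv_img.
by rewrite sr0 memv0 jE => /eqP x0; apply/eqP; apply: val_inj.
Qed.

End LeviSemisimple.

(** * The Gamma-decomposition *)

Section GammaStructure.
Variables (K : fieldType) (charK : [pchar K] =i pred0) (g : lieAlgType K).
Variables (Gam : {vspace 'End(g)}) (s k m : {vspace g}).
Hypothesis Zg : trivial_center {:g}.
Hypothesis crG : completely_reducible Gam.
Hypothesis gdG : gamma_decomposition Gam s k m.

Definition jordan_pair (S : 'End(g)) (y : g) :=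
  [/\ S \in Gam, y \in k & semisimple_part (ad y) S].

Lemma gamma_radical : [/\ lie_radical (m + k)%VS, (m :&: k)%VS = 0%VS,
  (s + (m + k))%VS = fullv & (s :&: (m + k))%VS = 0%VS].
Proof.
have [_ [r rad_r [sr sr0]]] := gd_levi gdG; have [r' rad_r' [defr' mk0]] := gd_radical gdG.
have eqr : r' = r.
  apply/eqP; rewrite eqEsubv; apply/andP; split.
    by case: rad_r => _ _ maxr; apply: maxr; case: rad_r'.
  by case: rad_r' => _ _ maxr; apply: maxr; case: rad_r.
by rewrite defr' eqr.
Qed.

Lemma gd_subalg_s : lie_subalg s. Proof. by case: (gd_levi gdG). Qed.

Lemma gd_semisimple : lie_semisimple (sub_lieAlg gd_subalg_s).
Proof. by have [radr _ srf sr0] := gamma_radical; apply: levi_semisimple sr0 srf. Qed.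

Lemma gd_skm v : exists x y z, [/\ x \in s, y \in k, z \in m & v = x + y + z].
Proof.
have [_ _ srf _] := gamma_radical; have := memvf v; rewrite -srf.
move=> /memv_addP[x xs [_ /memv_addP[z zm [y yk ->]] ->]].
by exists x, y, z; split=> //; rewrite -addrA (addrC y).
Qed.

Lemma gd_skm_eq0 x y z : x \in s -> y \in k -> z \in m -> x + y + z = 0 ->
  [/\ x = 0, y = 0 & z = 0].
Proof.
move=> xs yk zm E; have [_ mk0 _ sr0] := gamma_radical.
have x0 : x = 0.
  apply/eqP; rewrite -memv0 -sr0 memv_cap xs /=.
  move/eqP: E; rewrite -addrA addr_eq0 => /eqP->; rewrite memvN addrC memv_add //.
move: E; rewrite x0 add0r => E.
have y0 : y = 0.
  apply/eqP; rewrite -memv0 -mk0 memv_cap yk andbT.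
  by move/eqP: E; rewrite addr_eq0 => /eqP->; rewrite memvN.
by move: E; rewrite y0 add0r.
Qed.

Lemma lie_sk x y : x \in s -> y \in k -> lie x y = 0.
Proof. by move=> xs yk; apply/eqP; rewrite -memv0 -(gd_sk gdG) memv_lie_vs. Qed.

Lemma lie_skm x z : x \in (s + k)%VS -> z \in m -> lie x z \in m.
Proof. by move=> xs zm; rewrite -(gd_m gdG) memv_lie_vs. Qed.

Lemma lie_sm x z : x \in s -> z \in m -> lie x z \in m.
Proof. by move=> xs; apply: lie_skm; apply: (subvP (addvSl _ _)). Qed.

Lemma lie_km y z : y \in k -> z \in m -> lie y z \in m.
Proof. by move=> yk; apply: lie_skm; apply: (subvP (addvSr _ _)). Qed.

Lemma gamma_ind (P : 'End(g) -> Prop) :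
    (forall x, x \in s -> P (ad x)) ->
    (forall S y, jordan_pair S y -> P S) ->
    (forall f h, P f -> P h -> P (f + h)) ->
  forall f, f \in Gam -> P f.
Proof.
have [T [TP defG _]] := gd_Gam gdG; move=> Ps PT PD f.
rewrite {1}defG => /memv_addP[_ /memv_imgP[x xs ->] [S ST ->]].
apply: PD; first exact: Ps.
have /TP[y yk yS] := ST; apply: (PT S y); split=> //.
by rewrite defG (subvP (addvSr _ _)).
Qed.

Lemma ad_s_gamma x : x \in s -> ad x \in Gam.
Proof.
have [T [_ -> _]] := gd_Gam gdG => xs.
by rewrite (subvP (addvSl _ _)) ?memv_img.
Qed.

Lemma jordan_pair_exists y : y \in k -> exists S, jordan_pair S y.
Proof.
move=> yk; have [S yS] := semisimple_part_exists charK (ad y); exists S; split=> //.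
have [T [TP -> _]] := gd_Gam gdG; apply: (subvP (addvSr _ _)); apply/TP.
by exists y.
Qed.

Lemma k_nil : exists n, forall y y', y \in k -> y' \in k -> iter n (ad y) y' = 0.
Proof.
have [n n0] := gd_k_nilpotent gdG; exists n => y y' yk yk'.
apply/eqP; rewrite -memv0 -n0; elim: n {n0} => //= n IH.
by rewrite adE memv_lie_vs.
Qed.

(** Since k is nilpotent, y lies in a generalized kernel of each [ad y'], and the semisimple part of
    [ad y'] kills it. *)
Lemma gamma_k f y : f \in Gam -> y \in k -> f y = 0.
Proof.
move=> fG yk; move: f fG; apply: gamma_ind.
- by move=> x xs; rewrite adE lie_sk.
- move=> S y' [_ yk' yS]; have [n n0] := k_nil.
  exact: semisimple_part_ker yS (n0 _ _ yk' yk).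
by move=> f h f0 h0; rewrite add_lfunE f0 h0 addr0.
Qed.

(** [ad y] commutes with ad s because [s, k] = 0, and with the semisimple part of [ad y'] because it
    lies in a generalized kernel of ad (ad y'). *)
Lemma gamma_comm_k f y v : f \in Gam -> y \in k -> f (lie y v) = lie y (f v).
Proof.
move=> fG yk; move: f fG; apply: gamma_ind.
- by move=> x xs; rewrite !adE lie_jacobi (lie_sk xs yk) lie0l add0r.
- move=> S y' [_ yk' yS]; have [n n0] := k_nil.
  rewrite -!adE; symmetry; apply: (semisimple_part_ad charK yS (n := n)).
  have -> : iter n (ad (ad y')) (ad y) = ad (iter n (ad y') y).
    by elim: (n) => //= i ->; rewrite !adE ad_morphism.
  by rewrite n0 // linear0.
by move=> f h fv hv; rewrite !add_lfunE fv hv lieDr.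
Qed.

Lemma gamma_inv_exists : exists G0 : {vspace g},
  forall v, v \in G0 <-> forall f, f \in Gam -> f v = 0.
Proof.
apply: vspace_of_pred => [f _|a u v uP vP f fG]; first exact: linear0.
by rewrite linearP /= uP ?vP // scaler0 addr0.
Qed.

Lemma gamma_img_exists : exists G1 : {vspace g},
  forall v, v \in G1 <-> forall W : {vspace g}, (forall f u, f \in Gam -> f u \in W) -> v \in W.
Proof.
apply: vspace_of_pred => [W _|a u v uP vP W fW]; first exact: mem0v.
by rewrite memvD ?memvZ ?uP ?vP.
Qed.

(** Complete reducibility gives g = G0 + G1, invariants and image of Gam, and the projection p onto
    G0 commutes with ad k. From [s + k, m] = m and [s, g] in G1 follows p m = [k, p m], while each
    [ad y] is nilpotent on G0 because its semisimple part vanishes there. Engel's theorem forces p m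
    = 0. *)
Lemma gamma_inv_m z : z \in m -> (forall f, f \in Gam -> f z = 0) -> z = 0.
Proof.
move=> zm0 zinv; have [G0 G0P] := gamma_inv_exists; have [G1 G1P] := gamma_img_exists.
have fG1 f u : f \in Gam -> f u \in G1 by move=> fG; apply/G1P=> W h; apply: h.
(* Two complements are taken: that of G1 consists of invariants, which gives G0 + G1 = g; that of G0
   contains the image, which makes G0 and G1 disjoint. *)
have [|W2 [W2st G1W2 G1W20]] := crG (U := G1).
  by move=> f fG; apply/subvP=> _ /memv_imgP[u _ ->]; apply: fG1.
have W2G0 : (W2 <= G0)%VS.
  apply/subvP=> w wW; apply/G0P=> f fG; apply/eqP; rewrite -memv0 -G1W20 memv_cap fG1 //=.
  by apply: (subvP (W2st f fG)); apply: memv_img.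
have [|W0 [W0st G0W0 G0W00]] := crG (U := G0).
  by move=> f fG; apply/subvP=> _ /memv_imgP[u /G0P uP ->]; rewrite uP ?mem0v.
have G1W0 : (G1 <= W0)%VS.
  apply/subvP=> v /G1P; apply=> f u fG; have := memvf u; rewrite -G0W0.
  move=> /memv_addP[a /G0P aP [b bW ->]]; rewrite linearD /= aP // add0r.
  by apply: (subvP (W0st f fG)); apply: memv_img.
have G01 : (G0 :&: G1)%VS = 0%VS.
  by apply/eqP; rewrite -subv0 -G0W00 capvS.
have G0f : (G0 + G1)%VS = fullv.
  by apply/eqP; rewrite eqEsubv subvf -G1W2 addvC addvS.
pose p := daddv_pi G0 G1.
have pG0 u : u \in G0 -> p u = u by exact: daddv_pi_id.
have pD u : exists2 v, v \in G1 & u = p u + v.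
  by exists (daddv_pi G1 G0 u); [exact: memv_pi | rewrite daddv_pi_add // G0f memvf].
have pG1 u : u \in G1 -> p u = 0.
  move=> uG1; have [v vG1 defu] := pD u; apply/eqP; rewrite -memv0 -G01 memv_cap memv_pi /=.
  by rewrite (canRL (addrK v) (esym defu)) memvB.
have adG0 y u : y \in k -> u \in G0 -> ad y u \in G0.
  by move=> yk /G0P uP; apply/G0P=> f fG; rewrite adE gamma_comm_k // uP // lie0r.
have adG1 y u : y \in k -> u \in G1 -> ad y u \in G1.
  move=> yk /G1P/(_ ((ad y) @^-1: G1)%VS); rewrite -memv_preim; apply=> f v fG.
  by rewrite -memv_preim adE -gamma_comm_k // fG1.
have pad y u : y \in k -> p (ad y u) = ad y (p u).
  move=> yk; have [v vG1 defu] := pD u; rewrite {1}defu !linearD /= (pG1 (ad y v)) ?adG1 // addr0.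
  by rewrite pG0 // adG0 // memv_pi.
have Pm0 : (p @: m)%VS = 0%VS.
  have [n n0] := k_nil.
  apply: (engel_image (gd_k_subalg gdG) _ (rho := ad)).
  - by move=> x y xk yk; exists n; apply: n0.
  - by move=> x y v _ _; rewrite !adE [in RHS]lie_jacobi addrK.
  - move=> y _ yk /memv_imgP[u um ->]; rewrite -pad //; apply: memv_img.
    by rewrite adE lie_km.
  - move=> y _ yk /memv_imgP[u um ->]; have [S [SG _ yS]] := jordan_pair_exists yk.
    have [N NP] := semisimple_part_nil yS; exists N; apply: NP.
    by have /G0P := memv_pi G0 G1 u; apply.
  move=> W WP h; apply/eqP; rewrite eqEsubv WP /=.
  suff : (m <= p @^-1: W)%VS.
    by move=> /subvP mW; apply/subvP=> _ /memv_imgP[u um ->]; rewrite memv_preim mW.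
  rewrite -{1}(gd_m gdG); apply/lie_vs_subP=> _ u /memv_addP[x xs [y yk ->]] um.
  rewrite -memv_preim lieDl linearD /= -!adE (pG1 (ad x u)) ?add0r.
    by rewrite pad // h // memv_img.
  by apply: fG1; apply: ad_s_gamma.
have zG0 : z \in G0 by apply/G0P.
by apply/eqP; rewrite -(pG0 z) // -memv0 -Pm0 memv_img.
Qed.

(** The s-component centralizes s, hence vanishes; the m-component is then invariant, hence vanishes
    by [gamma_inv_m]. *)
Lemma gamma_inv_k v : (forall f, f \in Gam -> f v = 0) -> v \in k.
Proof.
move=> vinv; have [x [y [z [xs yk zm def_v]]]] := gd_skm v.
have inv f : f \in Gam -> f (x + z) = 0.
  move=> fG; have := vinv f fG; rewrite def_v addrAC linearD /=.
  by rewrite (gamma_k fG yk) addr0.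
have x0 : x = 0.
  have := @semisimple_center _ _ gd_semisimple (vsproj s x) => h.
  have /(congr1 vsval) : vsproj s x = 0; last by rewrite vsprojK.
  apply: h => x'; apply: val_inj; rewrite /= sub_lieE vsprojK //.
  have := inv (ad (vsval (x' : subvs_of s))) (ad_s_gamma (subvsP _)).
  rewrite adE lieDr => E.
  have [] := @gd_skm_eq0 (lie (vsval (x' : subvs_of s)) x) 0 (lie (vsval (x' : subvs_of s)) z).
  - by rewrite gd_subalg_s ?subvsP.
  - exact: mem0v.
  - by rewrite lie_sm ?subvsP.
  - by rewrite addr0.
  by move=> E0 _ _; rewrite lieC E0 oppr0.
rewrite def_v x0 add0r (_ : z = 0) ?addr0 //; apply: gamma_inv_m => // f fG.
by have := inv f fG; rewrite x0 add0r.
Qed.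

(** By Fitting's lemma v = a + (ad y)^p b with a in the generalized kernel of [ad y], where S
    vanishes. So S v = (ad y)^p (S b), and for p > n this power kills s and k and maps m to m. *)
Lemma jordan_pair_m S y v : jordan_pair S y -> S v \in m.
Proof.
move=> [_ yk yS]; have [n n0] := k_nil.
have [p ltn] := fitting n.+1 (fun z (_ : z \in {:g}%VS) => memvf (ad y z)).
move=> /(_ v (memvf v))[a [b [_ _ -> ya]]].
rewrite linearD /= (semisimple_part_ker yS ya) add0r.
have comm u : ad y (S u) = S (ad y u) by apply: semisimple_part_comm.
rewrite -(iter_lfun_comm comm); case: p ltn {ya} => // p; rewrite ltnS => le_np.
have [x [y' [z [xs yk' zm ->]]]] := gd_skm (S b).
have mP i u : u \in m -> iter i (ad y) u \in m.
  by apply: iter_lfun_mem => t tm; rewrite adE lie_km.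
have Xx : iter p.+1 (ad y) x = 0.
  by rewrite iterSr adE lieC (lie_sk xs yk) oppr0 iter_lfun0.
have Xy : iter p.+1 (ad y) y' = 0.
  by rewrite -(subnK (leqW le_np)) iterD n0 // iter_lfun0.
by rewrite !iter_lfunD Xx Xy !add0r mP.
Qed.

Lemma gamma_m f z : f \in Gam -> z \in m -> f z \in m.
Proof.
move=> fG zm; move: f fG; apply: gamma_ind.
- by move=> x xs; rewrite adE lie_sm.
- by move=> S y /jordan_pair_m.
by move=> f h fm hm; rewrite add_lfunE memvD.
Qed.

(** A stable complement of the span of Gam m meets m in Gam-invariant vectors, and those are zero by
    [gamma_inv_m]. *)
Lemma gamma_m_gen (W : {vspace g}) :
  (forall f z, f \in Gam -> z \in m -> f z \in W) -> (m <= W)%VS.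
Proof.
move=> mW; have [M1 M1P] : exists M1 : {vspace g}, forall v, v \in M1 <->
    v \in m /\ forall W : {vspace g}, (forall f z, f \in Gam -> z \in m -> f z \in W) -> v \in W.
  apply: vspace_of_pred => [|a u v [um uP] [vm vP]]; first by split=> [|*]; exact: mem0v.
  split=> [|U fU]; first by rewrite memvD ?memvZ.
  by rewrite memvD ?memvZ ?uP ?vP.
have M1m u : u \in M1 -> u \in m by case/M1P.
have fM1 f u : f \in Gam -> u \in m -> f u \in M1.
  by move=> fG um; apply/M1P; split=> [|U fU]; [apply: gamma_m | apply: fU].
have [|W2 [W2st M1W2 M1W20]] := crG (U := M1).
  by move=> f fG; apply/subvP=> _ /memv_imgP[u /M1m um ->]; apply: fM1.
apply/subvP=> z zm; have := memvf z; rewrite -M1W2 => /memv_addP[a aM [w wW defz]].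
suff w0 : w = 0 by move: aM; rewrite defz w0 addr0 => /M1P[_]; apply.
have wm : w \in m by rewrite -(addKr a w) -defz memvD // memvN M1m.
apply: gamma_inv_m => // f fG; apply/eqP; rewrite -memv0 -M1W20 memv_cap fM1 //=.
by apply: (subvP (W2st f fG)); apply: memv_img.
Qed.

(** The elements of k that kill m form a k-stable subspace U. If U were nonzero, Engel's theorem
    would give a nonzero u in U commuting with k; it commutes with s and m as well, so it is central
    in g. *)
Lemma mu_k_inj y : y \in k -> (forall z, z \in m -> lie y z = 0) -> y = 0.
Proof.
move=> yk ym; have [n n0] := k_nil.
have [U UP] : exists U : {vspace g}, forall y, y \in U <-> y \in k /\ forall z, z \in m -> lie y z = 0.
  apply: vspace_of_pred => [|a u v [uk um] [vk vm]].
    by split=> [|z _]; rewrite ?mem0v // lie0l.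
  by split=> [|z zm]; rewrite ?memvD ?memvZ // lieDl lieZl um ?vm // scaler0 addr0.
apply: NNPP => y0.
have [||||||u [uU u0 uk]] := engel_relative (gd_k_subalg gdG) _ (rho := ad) (U := U) (W := 0%VS).
- by move=> a b ak bk; exists n; apply: n0.
- by move=> a b v _ _; rewrite !adE [in RHS]lie_jacobi addrK.
- move=> a u ak /UP[uk um]; rewrite adE; apply/UP; split=> [|z zm].
    exact: (gd_k_subalg gdG).
  have := lie_jacobi a u z; rewrite (um z zm) lie0r (um (lie a z)) ?lie_km //.
  by rewrite addr0.
- by move=> a w _; rewrite !memv0 => /eqP->; rewrite linear0.
- by move=> a u ak /UP[uk _]; exists n; rewrite memv0 n0.
- by apply/negP=> /subvP/(_ y); rewrite memv0 => h; apply: y0; apply/eqP/h; apply/UP.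
have /UP[uk' um] := uU; case/negP: u0; rewrite memv0; apply/eqP.
apply: Zg => [|v _]; first exact: memvf.
have [x [y' [z [xs yk' zm ->]]]] := gd_skm v.
rewrite !lieDr (um z zm) addr0 (lieC u x) (lie_sk xs uk') oppr0 add0r lieC -adE.
by have := uk y' yk'; rewrite memv0 => /eqP->; rewrite oppr0.
Qed.

End GammaStructure.

Lemma vsvalB (K : fieldType) (V : vectType K) (U : {vspace V}) (u v : subvs_of U) :
  vsval (u - v) = vsval u - vsval v.
Proof. by []. Qed.

Section GammaProjections.
Variables (K : fieldType) (g : lieAlgType K).
Variables (Gam : {vspace 'End(g)}) (s k m : {vspace g}).
Hypothesis gdG : gamma_decomposition Gam s k m.
Local Notation pk := (daddv_pi k (s + m)).
Local Notation pm := (daddv_pi m (s + k)).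
Local Notation ps := (daddv_pi s (k + m)).

Lemma proj_skm x y z : x \in s -> y \in k -> z \in m ->
  [/\ ps (x + y + z) = x, pk (x + y + z) = y & pm (x + y + z) = z].
Proof.
move=> xs yk zm.
have split3 (U W W' : {vspace g}) u v : (U :&: W)%VS = 0%VS -> u \in U -> v \in W ->
    daddv_pi U W (u + v) = u.
  move=> UW uU vW; rewrite linearD /= daddv_pi_id //.
  suff -> : daddv_pi U W v = 0 by rewrite addr0.
  have := daddv_pi_add UW (subvP (addvSr U W) _ vW).
  move=> E; apply/eqP; rewrite -memv0 -UW memv_cap memv_pi /=.
  by rewrite (canRL (addrK _) E) memvB ?memv_pi.
have disj (U V W : {vspace g}) :
    (forall x y z, x \in U -> y \in V -> z \in W -> x + y + z = 0 -> x = 0) -> (U :&: (V + W))%VS = 0%VS.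
  move=> h; apply/eqP; rewrite -subv0; apply/subvP=> u /memv_capP[uU /memv_addP[v vV [w wW def_u]]].
  rewrite memv0; apply/eqP; apply: (h u (- v) (- w)); rewrite ?memvN //.
  by rewrite -addrA -opprD -def_u subrr.
split.
- rewrite -addrA split3 ?memv_add //; apply: disj => x' y' z' xs' yk' zm' E.
  by have [] := gd_skm_eq0 gdG xs' yk' zm' E.
- rewrite addrAC addrC split3 ?memv_add //; apply: disj => y' x' z' yk' xs' zm' E.
  by have [] : [/\ x' = 0, y' = 0 & z' = 0] by apply: (gd_skm_eq0 gdG); rewrite // (addrC x').
rewrite addrC split3 ?memv_add //; apply: disj => z' x' y' zm' xs' yk' E.
by have [] : [/\ x' = 0, y' = 0 & z' = 0] by apply: (gd_skm_eq0 gdG) => //; rewrite -[RHS]E addrC addrA.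
Qed.

Lemma lie_mm_r z1 z2 : z1 \in m -> z2 \in m -> lie z1 z2 \in (m + k)%VS.
Proof.
move=> z1m z2m; have [[[_ idr] _ _] _ _ _] := gamma_radical gdG.
by apply: idr; rewrite ?memvf // (subvP (addvSl _ _)).
Qed.

Lemma mem_r_split x : x \in (m + k)%VS -> [/\ pk x \in k, pm x \in m & x = pk x + pm x].
Proof.
move=> /memv_addP[z zm [y yk ->]].
have [_] := proj_skm (mem0v s) yk zm; rewrite add0r addrC => -> ->.
by split=> //; rewrite addrC.
Qed.

End GammaProjections.

(** * The algebra B and its action on brackets of elements of m *)

Section GammaB.
Variables (K : fieldType) (charK : [pchar K] =i pred0) (g : lieAlgType K).
Variables (Gam : {vspace 'End(g)}) (s k m nhat : {vspace g}).
Hypothesis crG : completely_reducible Gam.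
Hypothesis gdG : gamma_decomposition Gam s k m.
Hypothesis genN : lie_generated m nhat.
Local Notation B := (gammaB Gam m nhat).
Local Notation pk := (daddv_pi k (s + m)).
Local Notation pm := (daddv_pi m (s + k)).
Implicit Types (b : 'End(subvs_of m)).

Lemma m_sub_nhat : (m <= nhat)%VS. Proof. by case: genN. Qed.

Lemma nhat_sub_r : (nhat <= m + k)%VS.
Proof.
have [_ _] := genN; apply; last exact: addvSl.
have [[[_ idr] _ _] _ _ _] := gamma_radical gdG.
by move=> x y _ yr; apply: idr; rewrite ?memvf.
Qed.

Lemma nhat_stable x y : (forall z, z \in m -> lie x z \in m) -> y \in nhat -> lie x y \in nhat.
Proof.
move=> xm; move=> yN; have [subN mN maxN] := genN.
have WN : (nhat <= nhat :&: ad x @^-1: nhat)%VS.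
  apply: maxN => [a b|].
    rewrite !memv_cap -!memv_preim !adE => /andP[aN xa] /andP[bN xb].
    rewrite (subN _ _ aN bN) lie_jacobi.
    exact: memvD (subN _ _ xa bN) (subN _ _ aN xb).
  rewrite subv_cap mN; apply/subvP=> z zm; rewrite -memv_preim adE.
  by apply: (subvP mN); apply: xm.
by have := subvP WN y yN; rewrite memv_cap -memv_preim adE => /andP[].
Qed.

Lemma lie_subalg_gammaB : lie_subalg B.
Proof.
move=> b1 b2 /mem_gammaB[D1 [[D1N D1L] D1G D1E]] /mem_gammaB[D2 [[D2N D2L] D2G D2E]].
apply/mem_gammaB; exists (lie D1 D2); split.
- split=> [x xN|x y xN yN]; rewrite !gl_lieE.
    exact: memvB (D1N _ (D2N _ xN)) (D2N _ (D1N _ xN)).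
  have -> : D1 (D2 (lie x y)) = lie (D1 (D2 x)) y + lie (D2 x) (D1 y) +
      (lie (D1 x) (D2 y) + lie x (D1 (D2 y))).
    by rewrite D2L // linearD /= (D1L _ _ (D2N _ xN) yN) (D1L _ _ xN (D2N _ yN)).
  have -> : D2 (D1 (lie x y)) = lie (D2 (D1 x)) y + lie (D1 x) (D2 y) +
      (lie (D2 x) (D1 y) + lie x (D2 (D1 y))).
    by rewrite D1L // linearD /= (D2L _ _ (D1N _ xN) yN) (D2L _ _ xN (D1N _ yN)).
  rewrite lieBl lieBr !opprD !addrA.
  by rewrite [LHS](ACl (1*5*4*8*(2*7)*(3*6))) /= !subrr !addr0.
- by move=> f x fG xN; rewrite !gl_lieE linearB /= (D2G f x) // (D1G f (D2 x)) ?D2N // (D1G f x) // (D2G f (D1 x)) ?D1N.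
by move=> z; rewrite !gl_lieE linearB /= !(D1E, D2E).
Qed.

Lemma gammaB_comm b f (z : subvs_of m) : b \in B -> f \in Gam ->
  vsval (b (vsproj m (f (vsval z)))) = f (vsval (b z)).
Proof.
move=> /mem_gammaB[D [_ DG DE]] fG.
have fm := gamma_m gdG fG (subvsP z).
rewrite !DE (vsprojK fm) DG //.
exact: subvP m_sub_nhat _ (subvsP z).
Qed.

Lemma mu_val y (z : subvs_of m) : y \in k -> vsval (mu m y z) = lie y (vsval z).
Proof. by move=> yk; rewrite comp_lfunE restrE adE vsprojK // (lie_km gdG) ?subvsP. Qed.

Lemma mu_gammaB y : y \in k -> mu m y \in B.
Proof.
move=> yk; apply/mem_gammaB; exists (ad y); split.
- split=> [x xN|x x' _ _]; rewrite !adE; last exact: lie_jacobi.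
  by apply: nhat_stable => // z; apply: (lie_km gdG).
- by move=> f x fG _; rewrite !adE (gamma_comm_k charK gdG).
by move=> z; rewrite mu_val // adE.
Qed.

Lemma mu_k_gammaB : (mu m @: k <= B)%VS.
Proof. by apply/subvP=> _ /memv_imgP[y yk ->]; apply: mu_gammaB. Qed.

Lemma mu_lie y y' : y \in k -> y' \in k -> mu m (lie y y') = lie (mu m y) (mu m y').
Proof.
move=> yk yk'; apply/lfunP=> z; apply: subvs_inj; rewrite gl_lieE. rewrite vsvalB.
rewrite !mu_val ?(gd_k_subalg gdG) //.
by rewrite [in RHS]lie_jacobi addrK.
Qed.

Lemma lie_subalg_mu_k : lie_subalg (mu m @: k)%VS.
Proof.
move=> _ _ /memv_imgP[y yk ->] /memv_imgP[y' yk' ->].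
by rewrite -mu_lie // memv_img // (gd_k_subalg gdG).
Qed.

(* The derivation extending [b] maps the [k]-component of [z1, z2] into the
   Gam-invariants of g, that is, into k. *)
Lemma gammaB_bracket b (z1 z2 : subvs_of m) : b \in B ->
  let w := lie (vsval z1) (vsval z2) in
  let w' := lie (vsval (b z1)) (vsval z2) + lie (vsval z1) (vsval (b z2)) in
  vsval (b (vsproj m (pm w))) = pm w' /\ lie b (mu m (pk w)) = mu m (pk w').
Proof.
move=> bB w w'; have [D [[DN DL] DG DE]] := proj1 (@mem_gammaB K g Gam m nhat b) bB.
have zN (z : subvs_of m) : vsval z \in nhat by apply: (subvP m_sub_nhat); exact: subvsP.
have [subN _ _] := genN.
have wN : w \in nhat by apply: subN.
have Dw : D w = w' by rewrite DL // /w' !DE.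
have [kw mw def_w] := mem_r_split gdG (subvP nhat_sub_r _ wN).
have mwN : pm w \in nhat by apply: (subvP m_sub_nhat).
have kwN : pk w \in nhat by rewrite (canRL (addrK _) (esym def_w)) memvB.
have Dk : D (pk w) \in k.
  apply: (gamma_inv_k charK crG gdG) => f fG; rewrite -DG // (gamma_k gdG fG kw).
  exact: linear0.
have Dm : D (pm w) \in m.
  by have := DE (vsproj m (pm w)); rewrite vsprojK // => <-; exact: subvsP.
have [_ Ek Em] := proj_skm gdG (mem0v s) Dk Dm.
move: Ek Em; rewrite add0r -linearD /= -def_w Dw => Ek Em.
rewrite Ek Em DE vsprojK //; split=> //; apply/lfunP=> z; apply: subvs_inj.
rewrite gl_lieE vsvalB DE !mu_val // DE DL // addrK.
by [].
Qed.

End GammaB.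

(** * The Lie algebra s + B + m *)

(** Turns a linear identity in V into scalar ones, where [ring] applies. *)
Lemma coord_inj (K : fieldType) (V : vectType K) (u v : V) :
  (forall i, coord (vbasis {:V}) i u = coord (vbasis {:V}) i v) -> u = v.
Proof.
move=> uv; rewrite (coord_vbasis (memvf u)) (coord_vbasis (memvf v)).
by apply: eq_bigr => i _; rewrite uv.
Qed.

Section CoordLinear.
Variables (K : fieldType) (V : vectType K) (n : nat) (X : n.-tuple V) (i : 'I_n).

Lemma coordD u v : coord X i (u + v) = coord X i u + coord X i v.
Proof. exact: linearD. Qed.
Lemma coordN u : coord X i (- u) = - coord X i u.
Proof. exact: linearN. Qed.
Lemma coordZ c u : coord X i (c *: u) = c * coord X i u.
Proof. exact: linearZ. Qed.

End CoordLinear.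

(** * The Jacobi identity for an abstract law on S + B + M *)

Section SemidirectLaw.
Variables (K : fieldType) (S B : lieAlgType K) (M : vectType K).
Variables (a : S -> M -> M) (e : B -> M -> M) (nu : M -> M -> M) (be : M -> M -> B).
Hypothesis (al : forall z, linear (a^~ z)) (ar : forall x, linear (a x)).
Hypothesis (el : forall z, linear (e^~ z)) (er : forall x, linear (e x)).
Hypothesis (nul : forall z, linear (nu^~ z)) (bel : forall z, linear (be^~ z)).
Hypothesis (nuC : forall z t, nu z t = - nu t z) (beC : forall z t, be z t = - be t z).
Hypothesis (nuzz : forall z, nu z z = 0) (bezz : forall z, be z z = 0).
Hypothesis aM : forall x y z, a (lie x y) z = a x (a y z) - a y (a x z).
Hypothesis eM : forall x y z, e (lie x y) z = e x (e y z) - e y (e x z).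
Hypothesis ae : forall x b z, a x (e b z) = e b (a x z).
Hypothesis anu : forall x z t, a x (nu z t) = nu (a x z) t + nu z (a x t).
Hypothesis abe : forall x z t, be (a x z) t + be z (a x t) = 0.
Hypothesis enu : forall b z t, e b (nu z t) = nu (e b z) t + nu z (e b t).
Hypothesis ebe : forall b z t, lie b (be z t) = be (e b z) t + be z (e b t).
Hypothesis jacbe : forall z t u, be z (nu t u) + be t (nu u z) + be u (nu z t) = 0.
Hypothesis jacnu : forall z t u, (nu z (nu t u) - e (be t u) z) +
  (nu t (nu u z) - e (be u z) t) + (nu u (nu z t) - e (be z t) u) = 0.

(** Abstract shape of [Phi]: [a] and [e] are the actions of s and B on m, [nu] and [be] the m- and
    B-components of a bracket of two elements of m. This keeps projections and subspace types out of
    the Jacobi identity. *)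
Definition semidirect_bracket (u v : S * B * M) : S * B * M :=
  (lie u.1.1 v.1.1, lie u.1.2 v.1.2 + be u.2 v.2,
   a u.1.1 v.2 - a v.1.1 u.2 + (e u.1.2 v.2 - e v.1.2 u.2) + nu u.2 v.2).

Lemma triple_eq (u v : S * B * M) : u.1.1 = v.1.1 -> u.1.2 = v.1.2 -> u.2 = v.2 -> u = v.
Proof. by case: u v => [[? ?] ?] [[? ?] ?] /= -> -> ->. Qed.

Lemma tripleE (c : K) (u v : S * B * M) :
  ((c *: u + v).1.1 = c *: u.1.1 + v.1.1) * ((c *: u + v).1.2 = c *: u.1.2 + v.1.2) *
  ((c *: u + v).2 = c *: u.2 + v.2) *
  ((u + v).1.1 = u.1.1 + v.1.1) * ((u + v).1.2 = u.1.2 + v.1.2) * ((u + v).2 = u.2 + v.2) *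
  ((c *: u).1.1 = c *: u.1.1) * ((c *: u).1.2 = c *: u.1.2) * ((c *: u).2 = c *: u.2).
Proof. by []. Qed.

Lemma linear_addE (U W : vectType K) (f : U -> W) : linear f ->
  (forall u v, f (u + v) = f u + f v) * (forall u, f (- u) = - f u) * (f 0 = 0).
Proof.
move=> lf; have f0 : f 0 = 0.
  have := lf 1 0 0; rewrite !scale1r addr0 => /esym/eqP.
  by rewrite -{3}[f 0]addr0 => /eqP/addrI.
split; [split=> [u v|u] | exact: f0]; first by have := lf 1 u v; rewrite !scale1r.
by have := lf (-1) u 0; rewrite !scaleN1r f0 !addr0.
Qed.

Lemma semidirect_law : lie_law semidirect_bracket.
Proof.
have nur z : linear (nu z) by move=> c t u; rewrite !(nuC z) nul scalerN opprD.
have ber z : linear (be z) by move=> c t u; rewrite !(beC z) bel scalerN opprD.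
split.
- move=> v c u u1; apply: triple_eq; rewrite !tripleE /= ?tripleE.
  + by rewrite lieDZl.
  + by rewrite lieDZl bel scalerDr addrACA.
  rewrite al ar el er nul; apply: coord_inj => i.
  rewrite !(coordD, coordN, coordZ); ring.
- move=> v c u u1; apply: triple_eq; rewrite !tripleE /= ?tripleE.
  + by rewrite linearP.
  + by rewrite linearP ber scalerDr addrACA.
  rewrite al ar el er nur; apply: coord_inj => i.
  rewrite !(coordD, coordN, coordZ); ring.
- by move=> u; apply: triple_eq; rewrite /= ?liexx ?bezz ?nuzz ?subrr ?addr0.
move=> [[x1 y1] z1] [[x2 y2] z2] [[x3 y3] z3]; apply: triple_eq; rewrite !(tripleE 0) /=.
- exact: jacobi.
- rewrite !lieDr !(linear_addE (ber _)) !ebe -[RHS](jacbe z1 z2 z3).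
  have := jacobi y1 y2 y3; move/eqP; rewrite -addrA addr_eq0 => /eqP->.
  have abe' x z t : be z (a x t) = be t (a x z).
    by have /eqP := abe x z t; rewrite addrC addr_eq0 => /eqP->; rewrite [RHS]beC.
  rewrite (abe' x1 z2 z3) (abe' x2 z3 z1) (abe' x3 z1 z2).
  rewrite (beC (e y1 z2) z3) (beC (e y2 z3) z1) (beC (e y3 z1) z2).
  apply: coord_inj => i; rewrite !(coordD, coordN); ring.
rewrite !(linear_addE (nur _), linear_addE (ar _), linear_addE (er _), linear_addE (el _)).
rewrite !aM !eM !ae !anu !enu -[RHS](jacnu z1 z2 z3).
rewrite (nuC (a x1 z2) z3) (nuC (a x2 z3) z1) (nuC (a x3 z1) z2).
rewrite (nuC (e y1 z2) z3) (nuC (e y2 z3) z1) (nuC (e y3 z1) z2).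
apply: coord_inj => i; rewrite !(coordD, coordN); ring.
Qed.

End SemidirectLaw.

Lemma eq_lie_law (K : fieldType) (V : vectType K) (br br' : V -> V -> V) :
  (forall u v, br u v = br' u v) -> lie_law br -> lie_law br'.
Proof.
move=> E [bl br_ bb bj]; split.
- by move=> y c x x'; rewrite -!E bl.
- by move=> x c y y'; rewrite -!E br_.
- by move=> x; rewrite -E bb.
by move=> x y z; rewrite -!E bj.
Qed.

Lemma vsvalD (K : fieldType) (V : vectType K) (U : {vspace V}) (u v : subvs_of U) :
  vsval (u + v) = vsval u + vsval v.
Proof. by []. Qed.

Lemma vsvalN (K : fieldType) (V : vectType K) (U : {vspace V}) (u : subvs_of U) :
  vsval (- u) = - vsval u.
Proof. by []. Qed.

Section ExtensionLaw.
Variables (K : fieldType) (charK : [pchar K] =i pred0) (g : lieAlgType K).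
Variables (Gam : {vspace 'End(g)}) (s k m nhat : {vspace g}).
Hypothesis crG : completely_reducible Gam.
Hypothesis gdG : gamma_decomposition Gam s k m.
Hypothesis genN : lie_generated m nhat.
Local Notation B := (gammaB Gam m nhat).
Local Notation pk := (daddv_pi k (s + m)).
Local Notation pm := (daddv_pi m (s + k)).

Definition ext_a (x : subvs_of s) (z : subvs_of m) : subvs_of m :=
  vsproj m (lie (vsval x) (vsval z)).
Definition ext_nu (z t : subvs_of m) : subvs_of m := vsproj m (pm (lie (vsval z) (vsval t))).
Definition ext_be (z t : subvs_of m) : subvs_of B :=
  vsproj B (mu m (pk (lie (vsval z) (vsval t)))).

Lemma ext_aE x z : vsval (ext_a x z) = lie (vsval x) (vsval z).
Proof. by rewrite vsprojK // (lie_sm gdG) ?subvsP. Qed.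

Lemma ext_nuE z t : vsval (ext_nu z t) = pm (lie (vsval z) (vsval t)).
Proof. by rewrite vsprojK // memv_pi. Qed.

Lemma ext_beE z t : vsval (ext_be z t) = mu m (pk (lie (vsval z) (vsval t))).
Proof. by rewrite vsprojK // (mu_gammaB charK gdG genN) // memv_pi. Qed.

Lemma lie_mm_split (z t : subvs_of m) : lie (vsval z) (vsval t) =
  pk (lie (vsval z) (vsval t)) + vsval (ext_nu z t).
Proof.
have zt := lie_mm_r gdG (subvsP z) (subvsP t).
by have [_ _ E] := mem_r_split gdG zt; rewrite ext_nuE.
Qed.

Lemma ext_be_val z t (u : subvs_of m) :
  vsval (vsval (ext_be z t) u) = lie (pk (lie (vsval z) (vsval t))) (vsval u).
Proof. by rewrite ext_beE (mu_val gdG) // memv_pi. Qed.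

Lemma s_pk_pm x w : x \in s -> w \in (m + k)%VS ->
  pk (lie x w) = 0 /\ pm (lie x w) = lie x (pm w).
Proof.
move=> xs /(mem_r_split gdG)[kw mw ->].
have [[_ Ek Em]] := (proj_skm gdG (mem0v s) kw mw, proj_skm gdG (mem0v s) (mem0v k) (lie_sm gdG xs mw)).
move: Ek Em; rewrite !add0r => Ek Em [_ Ek' Em'].
by rewrite lieDr (lie_sk gdG xs kw) add0r Ek' Em' Em.
Qed.

Lemma pk_pm_eq0 u v : u + v = 0 -> v \in m -> pk u = 0 /\ pm u + v = 0.
Proof.
move=> uv vm; have [_ Ek Em] := proj_skm gdG (mem0v s) (mem0v k) vm.
move: Ek Em; rewrite !add0r => Ek Em.
have -> : u = - v by apply/eqP; rewrite -addr_eq0 uv.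
by rewrite (linearN pk) (linearN pm) /= Ek Em oppr0 addNr.
Qed.

Lemma Phi_lie_law : lie_law (@Phi K g s k m B).
Proof.
have subB : lie_subalg B by apply: lie_subalg_gammaB.
pose S := sub_lieAlg (gd_subalg_s gdG); pose Bt := sub_lieAlg subB.
apply: (@eq_lie_law K _ (@semidirect_bracket K S Bt _ ext_a (fun b z => vsval b z) ext_nu ext_be)).
  by move=> [[x y] z] [[x' y'] z'].
have mr z t : lie (vsval (z : subvs_of m)) (vsval (t : subvs_of m)) \in (m + k)%VS.
  exact: (lie_mm_r gdG (subvsP z) (subvsP t)).
(* The Jacobi identity of g for three elements of m, split into its components in k and in m. *)
have jac3 (z t u : subvs_of m) : pk (lie (vsval z) (pm (lie (vsval t) (vsval u))) +
      lie (vsval t) (pm (lie (vsval u) (vsval z))) +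
      lie (vsval u) (pm (lie (vsval z) (vsval t)))) = 0 /\
    pm (lie (vsval z) (pm (lie (vsval t) (vsval u))) +
      lie (vsval t) (pm (lie (vsval u) (vsval z))) +
      lie (vsval u) (pm (lie (vsval z) (vsval t)))) +
    (lie (vsval z) (pk (lie (vsval t) (vsval u))) +
      lie (vsval t) (pk (lie (vsval u) (vsval z))) +
      lie (vsval u) (pk (lie (vsval z) (vsval t)))) = 0.
  apply: pk_pm_eq0.
    have := jacobi (vsval z) (vsval t) (vsval u).
    rewrite {1}(lie_mm_split t u) {1}(lie_mm_split u z) {1}(lie_mm_split z t) !ext_nuE !lieDr => E.
    by rewrite -[RHS]E; apply: coord_inj => i; rewrite !(coordD, coordN); ring.
  by rewrite !memvD // memv_lieC (lie_km gdG) ?memv_pi ?subvsP.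
apply: semidirect_law.
- by move=> z c x x'; rewrite /ext_a linearP /= lieDZl linearP.
- by move=> x c z z'; rewrite /ext_a !linearP.
- by move=> z c b b'; rewrite linearP /= add_lfunE scale_lfunE.
- by move=> b c z z'; rewrite linearP.
- by move=> z c t t'; rewrite /ext_nu linearP /= lieDZl !linearP.
- by move=> z c t t'; rewrite /ext_be linearP /= lieDZl !linearP.
- by move=> z t; rewrite /ext_nu lieC !linearN.
- by move=> z t; rewrite /ext_be lieC !linearN.
- by move=> z; rewrite /ext_nu liexx !linear0.
- by move=> z; rewrite /ext_be liexx !linear0.
- move=> x y z; apply: subvs_inj; rewrite vsvalB !ext_aE sub_lieE.
  by rewrite [in RHS]lie_jacobi addrK.
- move=> b b' z; rewrite -gl_lieE.
  exact: (congr1 (fun f : 'End(subvs_of m) => f z) (@sub_lieE K _ B subB b b')).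
- move=> x b z; apply: subvs_inj; rewrite ext_aE.
  have := gammaB_comm gdG genN z (subvsP b) (ad_s_gamma gdG (subvsP x)).
  by rewrite !adE => ->.
- move=> x z t; apply: subvs_inj; rewrite vsvalD !ext_nuE !ext_aE !ext_nuE.
  by rewrite -linearD -lie_jacobi; case: (s_pk_pm (subvsP x) (mr z t)).
- move=> x z t; apply: subvs_inj; rewrite vsvalD !ext_beE !ext_aE.
  have [E _] := s_pk_pm (subvsP x) (mr z t).
  rewrite -(linearD (mu m)) -(linearD pk) -lie_jacobi.
  by apply: etrans (congr1 (mu m) E) _; exact: linear0.
- move=> b z t; apply: subvs_inj; rewrite vsvalD !ext_nuE.
  by have [-> _] := gammaB_bracket charK crG gdG genN z t (subvsP b); rewrite linearD.
- move=> b z t; apply: subvs_inj; rewrite vsvalD !ext_beE.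
  have [_ E] := gammaB_bracket charK crG gdG genN z t (subvsP b).
  rewrite -(linearD (mu m)) -(linearD pk); apply: etrans _ E; rewrite -ext_beE.
  exact: (@sub_lieE K _ B subB b (ext_be z t)).
- move=> z t u; apply: subvs_inj.
  have [E _] := jac3 z t u; rewrite !vsvalD !ext_beE !ext_nuE.
  rewrite -!(linearD (mu m)) -!(linearD pk).
  by apply: etrans (congr1 (mu m) E) _; exact: linear0.
move=> z t u; apply: subvs_inj; have [_ E] := jac3 z t u.
rewrite !(vsvalD, vsvalN) !ext_be_val !ext_nuE -[RHS]E !linearD /=.
rewrite -!(lieC _ (pk _)).
by apply: coord_inj => i; rewrite !(coordD, coordN); ring.
Qed.

End ExtensionLaw.

(** * Coordinates on s + B + m, and the embedding of g *)

Section ExtensionAlgebra.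
Variables (K : fieldType) (charK : [pchar K] =i pred0) (g : lieAlgType K).
Variables (Gam : {vspace 'End(g)}) (s k m nhat : {vspace g}).
Hypothesis Zg : trivial_center {:g}.
Hypothesis crG : completely_reducible Gam.
Hypothesis gdG : gamma_decomposition Gam s k m.
Hypothesis genN : lie_generated m nhat.
Local Notation B := (gammaB Gam m nhat).
Local Notation pk := (daddv_pi k (s + m)).
Local Notation pm := (daddv_pi m (s + k)).
Local Notation ps := (daddv_pi s (k + m)).
Variable PhiP : lie_law (@Phi K g s k m B).
Local Notation L := (lie_of_law PhiP).
Local Notation S := (sub_lieAlg (gd_subalg_s gdG)).
Local Notation Bt := (sub_lieAlg (@lie_subalg_gammaB K g Gam m nhat)).
Local Notation M := (subvs_of m).

Definition iS (x : S) : L := (x, 0, 0) : ext s B.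
Definition iB (b : Bt) : L := (0, b, 0) : ext s B.
Definition iM (z : M) : L := (0, 0, z) : ext s B.
Definition cS (u : L) : S := (u : ext s B).1.1.
Definition cB (u : L) : Bt := (u : ext s B).1.2.
Definition cM (u : L) : M := (u : ext s B).2.

Lemma ext_eqP (u v : L) : cS u = cS v -> cB u = cB v -> cM u = cM v -> u = v.
Proof. exact: (@triple_eq K S Bt M). Qed.

Lemma cS_is_linear : linear cS. Proof. by []. Qed.
Lemma cB_is_linear : linear cB. Proof. by []. Qed.
Lemma cM_is_linear : linear cM. Proof. by []. Qed.
HB.instance Definition _ := GRing.isLinear.Build K L S _ cS cS_is_linear.
HB.instance Definition _ := GRing.isLinear.Build K L Bt _ cB cB_is_linear.
HB.instance Definition _ := GRing.isLinear.Build K L M _ cM cM_is_linear.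

Lemma cS_iS x : cS (iS x) = x. Proof. by []. Qed.
Lemma cB_iS x : cB (iS x) = 0. Proof. by []. Qed.
Lemma cM_iS x : cM (iS x) = 0. Proof. by []. Qed.
Lemma cS_iB b : cS (iB b) = 0. Proof. by []. Qed.
Lemma cB_iB b : cB (iB b) = b. Proof. by []. Qed.
Lemma cM_iB b : cM (iB b) = 0. Proof. by []. Qed.
Lemma cS_iM z : cS (iM z) = 0. Proof. by []. Qed.
Lemma cB_iM z : cB (iM z) = 0. Proof. by []. Qed.
Lemma cM_iM z : cM (iM z) = z. Proof. by []. Qed.
Definition compE := (cS_iS, cB_iS, cM_iS, cS_iB, cB_iB, cM_iB, cS_iM, cB_iM, cM_iM).

Lemma iS_is_linear : linear iS.
Proof. by move=> a x y; apply: ext_eqP; rewrite [RHS]linearP /= ?compE ?scaler0 ?addr0. Qed.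
Lemma iB_is_linear : linear iB.
Proof. by move=> a x y; apply: ext_eqP; rewrite [RHS]linearP /= ?compE ?scaler0 ?addr0. Qed.
Lemma iM_is_linear : linear iM.
Proof. by move=> a x y; apply: ext_eqP; rewrite [RHS]linearP /= ?compE ?scaler0 ?addr0. Qed.
HB.instance Definition _ := GRing.isLinear.Build K S L _ iS iS_is_linear.
HB.instance Definition _ := GRing.isLinear.Build K Bt L _ iB iB_is_linear.
HB.instance Definition _ := GRing.isLinear.Build K M L _ iM iM_is_linear.

Lemma ext_decomp u : u = iS (cS u) + iB (cB u) + iM (cM u).
Proof. by apply: ext_eqP; rewrite !linearD /= ?compE ?addr0 ?add0r. Qed.

Lemma cS_lie u v : cS (lie u v) = lie (cS u) (cS v).
Proof. by case: u v => [[x b] z] [[x' b'] z']. Qed.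

Lemma cB_lie u v : cB (lie u v) = lie (cB u) (cB v) + (ext_be Gam s k nhat (cM u) (cM v) : Bt).
Proof. by case: u v => [[x b] z] [[x' b'] z']. Qed.

Lemma cM_lie u v : cM (lie u v) = ext_a (cS u) (cM v) - ext_a (cS v) (cM u) +
  (vsval (cB u : subvs_of B) (cM v) - vsval (cB v : subvs_of B) (cM u)) +
  ext_nu s k (cM u) (cM v).
Proof. by case: u v => [[x b] z] [[x' b'] z']. Qed.

Lemma ext_a0l z : ext_a (0 : subvs_of s) z = 0 :> M.
Proof. by rewrite /ext_a lie0l linear0. Qed.
Lemma ext_a0r (x : subvs_of s) : ext_a x (0 : M) = 0.
Proof. by rewrite /ext_a !linear0. Qed.
Lemma ext_nu0l z : ext_nu s k (0 : M) z = 0.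
Proof. by rewrite /ext_nu lie0l !linear0. Qed.
Lemma ext_be0l z : ext_be Gam s k nhat (0 : M) z = 0.
Proof. by rewrite /ext_be lie0l !linear0. Qed.
Lemma vsval0E (z : M) : vsval (0 : subvs_of B) z = 0.
Proof. by rewrite zero_lfunE. Qed.

Lemma lie_iS_cS x u : cS (lie (iS x) u) = lie x (cS u).
Proof. exact: cS_lie. Qed.
Lemma lie_iS_cB x u : cB (lie (iS x) u) = 0.
Proof. by rewrite cB_lie !compE lie0l ext_be0l addr0. Qed.
Lemma lie_iS_cM x u : cM (lie (iS x) u) = ext_a x (cM u).
Proof. by rewrite cM_lie !compE ext_a0r vsval0E ext_nu0l !linear0 ?oppr0 !addr0. Qed.
Lemma lie_iB_cS b u : cS (lie (iB b) u) = 0.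
Proof. by rewrite cS_lie !compE lie0l. Qed.
Lemma lie_iB_cB b u : cB (lie (iB b) u) = lie b (cB u).
Proof. by rewrite cB_lie !compE ext_be0l addr0. Qed.
Lemma lie_iB_cM b u : cM (lie (iB b) u) = vsval (b : subvs_of B) (cM u).
Proof. by rewrite cM_lie !compE ext_a0l ext_a0r ext_nu0l !linear0 ?oppr0 !addr0 ?add0r. Qed.
Definition lie_i_cE := (lie_iS_cS, lie_iS_cB, lie_iS_cM, lie_iB_cS, lie_iB_cB, lie_iB_cM).

Lemma sub_lieAlg_val (b b' : Bt) : vsval (lie b b' : subvs_of B) =
  lie (vsval (b : subvs_of B)) (vsval (b' : subvs_of B)).
Proof. exact: sub_lieE. Qed.

Definition phi0_fun (v : g) : L :=
  iS (vsproj s (ps v)) + iB (vsproj B (mu m (pk v))) + iM (vsproj m (pm v)).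

Lemma cS_phi0 v : cS (phi0_fun v) = vsproj s (ps v).
Proof. by rewrite /phi0_fun !linearD /= ?compE !addr0. Qed.
Lemma cB_phi0 v : cB (phi0_fun v) = vsproj B (mu m (pk v)).
Proof. by rewrite /phi0_fun !linearD /= ?compE add0r addr0. Qed.
Lemma cM_phi0 v : cM (phi0_fun v) = vsproj m (pm v).
Proof. by rewrite /phi0_fun !linearD /= ?compE !add0r. Qed.

Lemma phi0_is_linear : linear phi0_fun.
Proof.
move=> c v w; apply: ext_eqP.
- by rewrite [RHS]cS_is_linear !cS_phi0 !linearP.
- by rewrite [RHS]cB_is_linear !cB_phi0 !linearP.
by rewrite [RHS]cM_is_linear !cM_phi0 !linearP.
Qed.
HB.instance Definition _ := GRing.isLinear.Build K g L _ phi0_fun phi0_is_linear.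
Definition phi0 : 'Hom(g, L) := linfun phi0_fun.

Definition muB (y : g) : Bt := vsproj B (mu m y).

Lemma muB_val y : y \in k -> vsval (muB y : subvs_of B) = mu m y.
Proof. by move=> yk; rewrite vsprojK // (mu_gammaB charK gdG genN). Qed.

Lemma phi0E x y z : x \in s -> y \in k -> z \in m ->
  phi0 (x + y + z) = iS (vsproj s x) + iB (muB y) + iM (vsproj m z).
Proof.
by move=> xs yk zm; rewrite lfunE /= /phi0_fun; have [-> -> ->] := proj_skm gdG xs yk zm.
Qed.

Lemma phi0_s x : x \in s -> phi0 x = iS (vsproj s x).
Proof.
move=> xs; have := phi0E xs (mem0v k) (mem0v m).
by rewrite /muB !linear0 !addr0.
Qed.

Lemma phi0_k y : y \in k -> phi0 y = iB (muB y).
Proof.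
move=> yk; have := phi0E (mem0v s) yk (mem0v m).
by rewrite !linear0 !addr0 !add0r.
Qed.

Lemma phi0_m z : z \in m -> phi0 z = iM (vsproj m z).
Proof.
move=> zm; have := phi0E (mem0v s) (mem0v k) zm.
by rewrite /muB !linear0 !add0r.
Qed.

Lemma cphi0 x y z : x \in s -> y \in k -> z \in m ->
  [/\ cS (phi0 (x + y + z)) = vsproj s x, cB (phi0 (x + y + z)) = muB y &
      cM (phi0 (x + y + z)) = vsproj m z].
Proof.
by move=> xs yk zm; rewrite phi0E //; split; rewrite !linearD /= ?compE ?addr0 ?add0r.
Qed.

Lemma phi0_morphism : lie_morphism phi0.
Proof.
move=> v w.
have [x [y [z [xs yk zm ->]]]] := gd_skm gdG v.
have [x' [y' [z' [xs' yk' zm' ->]]]] := gd_skm gdG w.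
have [kw mw Ew] := mem_r_split gdG (lie_mm_r gdG zm zm').
have expand P Q : lie z z' = P + Q -> lie (x + y + z) (x' + y' + z') =
    lie x x' + (lie y y' + P) + (lie x z' - lie x' z + (lie y z' - lie y' z) + Q).
  move=> E; rewrite !lieDl !lieDr E (lie_sk gdG xs yk') (lieC y x') (lie_sk gdG xs' yk).
  rewrite (lieC z x') (lieC z y').
  by apply: coord_inj => i; rewrite !(coordD, coordN) ?linear0; ring.
rewrite (expand _ _ Ew).
have Ys : lie y y' + pk (lie z z') \in k by rewrite memvD // (gd_k_subalg gdG).
have Zs : lie x z' - lie x' z + (lie y z' - lie y' z) + pm (lie z z') \in m.
  apply: memvD => //; apply: memvD; apply: memvB.
  - exact: (lie_sm gdG xs zm').
  - exact: (lie_sm gdG xs' zm).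
  - exact: (lie_km gdG yk zm').
  exact: (lie_km gdG yk' zm).
have Xs : lie x x' \in s by apply: (gd_subalg_s gdG).
have [a1 a2 a3] := cphi0 Xs Ys Zs; have [b1 b2 b3] := cphi0 xs yk zm.
have [c1 c2 c3] := cphi0 xs' yk' zm'.
apply: ext_eqP; rewrite ?a1 ?a2 ?a3.
- rewrite cS_lie b1 c1; apply: subvs_inj.
  by rewrite vsprojK //; apply: etrans _ (esym (sub_lieE _ _)); rewrite !vsprojK.
- rewrite cB_lie b2 c2 b3 c3; apply: subvs_inj; rewrite vsvalD muB_val //.
  rewrite sub_lieAlg_val !muB_val ?memv_pi // linearD /= (mu_lie gdG) //.
  by rewrite !vsprojK.
rewrite cM_lie b1 b2 b3 c1 c2 c3; apply: subvs_inj; rewrite vsprojK // !(vsvalD, vsvalN).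
by rewrite !(ext_aE gdG) !muB_val // !(mu_val gdG) // ext_nuE !vsprojK.
Qed.

End ExtensionAlgebra.

(** Used to give an annihilating polynomial of f the root 0, so that it still annihilates f extended
    by zero to s + B. *)
Lemma separable_mulX (K : fieldType) (p : {poly K}) : separable_poly p ->
  p`_0 != 0 -> separable_poly (p * 'X).
Proof.
move=> sp p0; rewrite separable_mul sp /=; apply/andP; split.
  by rewrite unlock derivX coprimep1.
by rewrite -['X]subr0 -polyC0 coprimep_XsubC /root horner_coef0.
Qed.

Section PactKernel.
Variables (K : fieldType) (V : vectType K).
Implicit Types (X : 'End(V)) (p : {poly K}).

Lemma pactD X p u v : pact X p (u + v) = pact X p u + pact X p v.
Proof.
rewrite -big_split; apply: eq_bigr => i _ /=.
by rewrite iter_lfunD scalerDr.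
Qed.

Lemma pact_ker X p v : X v = 0 -> pact X p v = p`_0 *: v.
Proof.
move=> Xv; rewrite /pact; case E: (size p) => [|n].
  by rewrite big_ord0 nth_default ?E // scale0r.
rewrite big_ord_recl big1 ?addr0 // => i _ /=.
by rewrite -iterS iterSr Xv iter_lfun0 scaler0.
Qed.

End PactKernel.

(** * The centralizer of g, and Jordan components, in s + B + m *)

Section ExtensionStructure.
Variables (K : fieldType) (charK : [pchar K] =i pred0) (g : lieAlgType K).
Variables (Gam : {vspace 'End(g)}) (s k m nhat : {vspace g}).
Hypothesis Zg : trivial_center {:g}.
Hypothesis crG : completely_reducible Gam.
Hypothesis gdG : gamma_decomposition Gam s k m.
Hypothesis genN : lie_generated m nhat.
Local Notation B := (gammaB Gam m nhat).
Local Notation pk := (daddv_pi k (s + m)).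
Local Notation pm := (daddv_pi m (s + k)).
Local Notation ps := (daddv_pi s (k + m)).
Variable PhiP : lie_law (@Phi K g s k m B).
Local Notation L := (lie_of_law PhiP).
Local Notation S := (sub_lieAlg (gd_subalg_s gdG)).
Local Notation Bt := (sub_lieAlg (@lie_subalg_gammaB K g Gam m nhat)).
Local Notation M := (subvs_of m).


Local Notation iS := (@iS K g Gam s k m nhat gdG PhiP).
Local Notation iB := (@iB K g Gam s k m nhat PhiP).
Local Notation iM := (@iM K g Gam s k m nhat PhiP).
Local Notation cS := (@cS K g Gam s k m nhat gdG PhiP).
Local Notation cB := (@cB K g Gam s k m nhat PhiP).
Local Notation cM := (@cM K g Gam s k m nhat PhiP).
Local Notation phi0 := (@phi0 K g Gam s k m nhat gdG PhiP).
Local Notation muB := (@muB K g Gam m nhat).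

Lemma mem_ext_subE A (u : L) : (u \in (ext_sub s B A : {vspace L})) = (vsval (cB u : subvs_of B) \in A).
Proof. by case: u => [[x b] z]; exact: mem_ext_sub. Qed.

Lemma phi0_inj : lker phi0 = 0%VS.
Proof.
apply/eqP; rewrite -subv0; apply/subvP=> v; rewrite memv_ker memv0 => /eqP.
have [x [y [z [xs yk zm ->]]]] := gd_skm gdG v.
have [E1 E2 E3] := cphi0 gdG PhiP xs yk zm; move=> E0.
move: E1 E2 E3; rewrite E0 => E1 E2 E3.
have x0 : x = 0 by rewrite -(vsprojK xs) -E1.
have z0 : z = 0 by rewrite -(vsprojK zm) -E3.
suff -> : y = 0 by rewrite x0 z0 !addr0.
apply: (mu_k_inj Zg gdG yk) => t tm.
rewrite -(vsprojK tm) -(mu_val gdG) // -(muB_val charK gdG genN yk) -E2.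
by rewrite zero_lfunE.
Qed.

Lemma limg_phi0 : limg phi0 = (ext_sub s B (mu m @: k)%VS : {vspace L}).
Proof.
apply/vspaceP=> u; rewrite mem_ext_subE; apply/memv_imgP/memv_imgP.
  move=> [v _ ->]; have [x [y [z [xs yk zm ->]]]] := gd_skm gdG v.
  have [_ -> _] := cphi0 gdG PhiP xs yk zm.
  by exists y; rewrite // (muB_val charK gdG genN).
move=> [y yk E]; exists (vsval (cS u : subvs_of s) + y + vsval (cM u)); first exact: memvf.
have [E1 E2 E3] := cphi0 gdG PhiP (subvsP (cS u : subvs_of s)) yk (subvsP (cM u)).
apply: (ext_eqP (gdG := gdG)); rewrite ?E1 ?E2 ?E3 ?vsvalK //.
by apply: subvs_inj; rewrite (muB_val charK gdG genN).
Qed.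

(** The s-component of u is central in s, its m-component is killed by Gam, and what remains, in B,
    acts as zero on m. *)
Lemma centralizer_phi0 (u : L) : (forall v, lie u (phi0 v) = 0) -> u = 0.
Proof.
move=> uz; have uz' v : lie (phi0 v) u = 0 by rewrite lieC uz oppr0.
have uS (x : S) : lie (iS x) u = 0.
  have := uz' (vsval (x : subvs_of s)); rewrite (phi0_s gdG) ?subvsP //.
  by rewrite vsvalK.
have x0 : cS u = 0.
  apply: (semisimple_center (@gd_semisimple K g Gam s k m gdG)) => x; rewrite lieC.
  by rewrite -lie_iS_cS uS !linear0.
have z0 : cM u = 0.
  apply: subvs_inj; apply: (gamma_inv_m charK crG gdG (subvsP _)).
  apply: (gamma_ind gdG).
  - move=> x xs; have := congr1 cM (uS (vsproj s x)); rewrite lie_iS_cM.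
    by move/(congr1 vsval); rewrite (ext_aE gdG) vsprojK // adE.
  - move=> f y [_ yk yf]; apply: (semisimple_part_ker (n := 1) yf); rewrite /= adE.
    have := congr1 cM (uz' y); rewrite (phi0_k gdG) // (lie_iB_cM gdG).
    by move/(congr1 vsval); rewrite (muB_val charK gdG genN) // (mu_val gdG) //.
  by move=> f h f0 h0; rewrite add_lfunE f0 h0 addr0.
apply: (ext_eqP (gdG := gdG)) => //; apply: subvs_inj; apply/lfunP=> z; rewrite zero_lfunE.
have := congr1 cM (uz (vsval z)); rewrite (phi0_m gdG) ?subvsP // vsvalK.
have -> : u = iB (cB u) by apply: (ext_eqP (gdG := gdG)); rewrite ?x0 ?z0 ?compE.
by rewrite (lie_iB_cM gdG).
Qed.

(** For f the semisimple part of [ad y], its analogue on s + B + m: zero on s and on B, since y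
    commutes with s and B commutes with Gam. *)
Definition tS_fun (f : 'End(g)) (u : L) : L := iM (vsproj m (f (vsval (cM u)))).
Lemma tS_is_linear f : linear (tS_fun f).
Proof. by move=> a u v; rewrite /tS_fun !linearP. Qed.
HB.instance Definition _ f := GRing.isLinear.Build K L L _ (tS_fun f) (tS_is_linear f).
Definition tS f : 'End(L) := linfun (tS_fun f).

Lemma tSE f u : tS f u = iM (vsproj m (f (vsval (cM u)))).
Proof. by rewrite lfunE. Qed.

(** The nilpotent part of [ad y] restricts to m. Because B commutes with f, the difference acts on B
    as the bracket with that restriction, hence nilpotently. *)
Lemma semisimple_part_tS f y : jordan_pair Gam k f y ->
  semisimple_part (ad (iB (muB y))) (tS f).
Proof.
move=> jfy; have [fG yk [N [ssf nN fN adyE]]] := jfy.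
have fm z : z \in m -> f z \in m by move=> _; apply: (jordan_pair_m gdG z jfy).
exists (ad (iB (muB y)) - tS f).
pose fM : 'End(M) := restr m f.
have fME z : vsval (fM z) = f (vsval z) by rewrite restrE vsprojK // fm ?subvsP.
have tSM u : tS f u = iM (fM (cM u)) by rewrite tSE restrE.
pose NM : 'End(M) := mu m y - fM.
have NME z : vsval (NM z) = N (vsval z).
  rewrite add_lfunE opp_lfunE vsvalD vsvalN (mu_val gdG) // fME -adE adyE add_lfunE.
  by rewrite addrAC subrr add0r.
have NEcS u : cS ((ad (iB (muB y)) - tS f) u) = 0.
  by rewrite add_lfunE opp_lfunE adE tSM linearB /= (lie_iB_cS gdG) !compE subr0.
have NEcB u : cB ((ad (iB (muB y)) - tS f) u) = lie (muB y : Bt) (cB u).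
  by rewrite add_lfunE opp_lfunE adE tSM linearB /= lie_iB_cB !compE subr0.
have NEcM u : cM ((ad (iB (muB y)) - tS f) u) = NM (cM u).
  rewrite add_lfunE opp_lfunE adE tSM linearB /= (lie_iB_cM gdG) ?compE add_lfunE opp_lfunE.
  by rewrite (muB_val charK gdG genN).
have fMB (b : Bt) z : vsval (b : subvs_of B) (fM z) = fM (vsval (b : subvs_of B) z).
  apply: subvs_inj; rewrite fME -(gammaB_comm gdG genN z (subvsP _) fG).
  by rewrite restrE.
have [n N0] := (proj1 (nilpotent_endP N)) nN.
pose vs : 'Hom(M, g) := linfun vsval.
have vsE t : vs t = vsval t by rewrite lfunE.
have NM0 z : iter n NM z = 0.
  apply: subvs_inj; rewrite -vsE (iter_intertwine (X := N)) ?N0 // => t.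
  by rewrite !vsE NME.
split.
- have /(semisimple_pactP charK)[p [sp pf]] := ssf.
  have [q [sq qf q0]] : exists q, [/\ separable_poly q, forall v, pact f q v = 0 & q`_0 = 0].
    have [p0|p0] := eqVneq p`_0 0; first by exists p.
    exists (p * 'X); split; [exact: separable_mulX | | by rewrite coefMX].
    by move=> v; rewrite pact_mulX.
  apply/(semisimple_pactP charK); exists q; split=> // u.
  have -> : u = (u - iM (cM u)) + iM (cM u) by rewrite subrK.
  rewrite pactD pact_ker; last first.
    by rewrite tSM linearB /= ?compE subrr !linear0.
  rewrite q0 scale0r add0r.
  have EM z : iM (fM z) = tS f (iM z) by rewrite tSM compE.
  pose iML : 'Hom(M, L) := linfun iM.
  have iMLE t : iML t = iM t by rewrite lfunE.
  rewrite -iMLE -(pact_intertwine (X' := fM)) => [|z]; last by rewrite !iMLE EM.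
  have -> : pact fM q (cM u) = 0; last exact: linear0.
  apply: subvs_inj; rewrite -vsE (pact_intertwine (X := f)) ?qf // => z.
  by rewrite !vsE fME.
(* One step kills the s-component, 2n steps the B-component, n steps the m-component. *)
- apply/nilpotent_endP; exists (n + n).+1 => u; apply: (ext_eqP (gdG := gdG)).
  + by rewrite iterS NEcS.
  + have E i : vsval (cB (iter i (ad (iB (muB y)) - tS f) u) : subvs_of B) =
        iter i (ad NM) (vsval (cB u : subvs_of B)).
      elim: i => //= i IH; rewrite NEcB sub_lieAlg_val adE -IH (muB_val charK gdG genN) //.
      rewrite lieBl (_ : lie fM _ = 0) ?subr0 //.
      by apply/lfunP=> z; rewrite gl_lieE fMB subrr zero_lfunE.
    by apply: subvs_inj; rewrite E iterS lie_nilpotent_left // !linear0.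
  have E i : cM (iter i (ad (iB (muB y)) - tS f) u) = iter i NM (cM u).
    by elim: i => //= i IH; rewrite NEcM IH.
  by rewrite E iterS iterD NM0 linear0.
- apply/lfunP=> u; rewrite !comp_lfunE !tSM NEcM.
  apply: (ext_eqP (gdG := gdG)); rewrite ?NEcS ?NEcB ?NEcM ?compE ?lie0r //.
  apply: subvs_inj; rewrite fME !NME fME.
  by have := congr1 (fun h : 'End(g) => h (vsval (cM u))) fN; rewrite !comp_lfunE.
by rewrite addrC subrK.
Qed.

End ExtensionStructure.

(** * Derivations of s + A + m *)

Section Leibniz.
Variables (K : fieldType) (H : lieAlgType K) (D : 'End(H)).
Hypothesis DL : forall x y, D (lie x y) = lie (D x) y + lie x (D y).

Lemma leibniz_iter n x y : iter n D (lie x y) =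
  \sum_(i < n.+1) lie (iter (n - i) D x) (iter i D y) *+ 'C(n, i).
Proof.
elim: n => [|n IHn]; first by rewrite big_ord_recl big_ord0 addr0.
rewrite big_ord_recl iterS {}IHn linear_sum /=.
under eq_bigr => i _ do rewrite linearMn /= DL mulrnDl.
rewrite big_split /= big_ord_recl !bin0 !subn0 -!addrA; congr (_ + _).
rewrite [RHS]big_ord_recr [X in _ + X]big_ord_recr /= !binn !subnn addrA; congr (_ + _).
rewrite -big_split; apply: eq_bigr => i _ /=.
by rewrite /bump /= add1n subSS binS mulrnDr -iterS -subSn ?ltn_ord // subSS.
Qed.

End Leibniz.

(** Let F i be the derived series of r. By induction psi D^t e vanishes on F i for t < 2^i, since
    each Leibniz term has an exponent below half that bound. For t = 2^(i+1) on a bracket of F i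
    only the middle term survives, with a binomial coefficient nonzero in characteristic 0. So the
    images J i of F i under psi D^(2^i) e satisfy [J i, J i] <= J (i+1), and J 0 is a solvable ideal
    of S. *)
Lemma derivation_solvable_image (K : fieldType) (G H S : lieAlgType K)
    (e : 'Hom(G, H)) (psi : 'Hom(H, S)) (D : 'End(H)) (r : {vspace G}) :
    [pchar K] =i pred0 -> lie_semisimple S -> lie_morphism e -> lie_morphism psi ->
    (forall x y, D (lie x y) = lie (D x) y + lie x (D y)) ->
    lie_solvable r -> (forall x, x \in r -> psi (e x) = 0) ->
    (forall s x, x \in r -> exists2 x', x' \in r & lie s (psi (D (e x))) = psi (D (e x'))) ->
  forall x, x \in r -> psi (D (e x)) = 0.
Proof.
move=> charK ssS eM psiM DL [n rn0] psir idr.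
pose F i := iter i (fun V => lie_vs V V) r.
pose P t : 'Hom(G, S) := (psi \o iter t (comp_lfun D) e)%VF.
have PE t x : P t x = psi (iter t D (e x)).
  by rewrite comp_lfunE; congr (psi _); elim: t => //= t IH; rewrite comp_lfunE IH.
have Plie t x y : P t (lie x y) = \sum_(i < t.+1) lie (P (t - i)%N x) (P i y) *+ 'C(t, i).
  rewrite PE eM (leibniz_iter DL) linear_sum; apply: eq_bigr => i _ /=.
  by rewrite linearMn /= psiM !PE.
have P0 i t x : (t < 2 ^ i)%N -> x \in F i -> P t x = 0.
  elim: i t x => [|i IH] t x; first by rewrite expn0 ltnS leqn0 => /eqP-> xr; rewrite PE psir.
  move=> lt /lie_vsP[p [a [b [aF bF ->]]]]; rewrite linear_sum big1 // => l _ /=.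
  rewrite Plie big1 // => q _; have [q_small|q_large] := ltnP q (2 ^ i).
    by rewrite (IH q) ?lie0r ?mul0rn.
  rewrite (IH (t - q)%N) ?lie0l ?mul0rn //.
  rewrite ltn_subLR ?leq_ord //; apply: (leq_trans lt).
  by rewrite expnS mul2n -addnn leq_add2r.
pose J i := (P (2 ^ i)%N @: F i)%VS.
have JS i : (lie_vs (J i) (J i) <= J i.+1)%VS.
  apply/lie_vs_subP=> _ _ /memv_imgP[a aF ->] /memv_imgP[b bF ->].
  pose c : K := ('C(2 ^ i.+1, 2 ^ i))%:R.
  have c0 : c != 0.
    by have /pcharf0P-> := charK; rewrite -lt0n bin_gt0 leq_exp2l.
  have E : P (2 ^ i.+1)%N (lie a b) = c *: lie (P (2 ^ i)%N a) (P (2 ^ i)%N b).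
    have lt : (2 ^ i < (2 ^ i.+1).+1)%N by rewrite ltnS leq_exp2l.
    rewrite Plie (bigD1 (Ordinal lt)) //= [X in _ + X]big1 ?addr0 => [|q ne].
      by rewrite {1}expnS mul2n -addnn addnK scaler_nat.
    have [q_small|q_large] := ltnP q (2 ^ i); first by rewrite (P0 i q) ?lie0r ?mul0rn.
    rewrite (P0 i (2 ^ i.+1 - q)%N) ?lie0l ?mul0rn //.
    rewrite ltn_subLR; last by rewrite -ltnS.
    apply: (@leq_trans (2 ^ i + 2 ^ i).+1); first by rewrite addnn -mul2n -expnS.
    rewrite -addSn leq_add2r ltn_neqAle q_large andbT.
    by apply: contraNneq ne => E; apply/eqP/val_inj.
  rewrite -[lie _ _]scale1r -(mulVf c0) -scalerA -E memvZ // memv_img //.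
  exact: memv_lie_vs.
have JF i : (iter i (fun V => lie_vs V V) (J 0%N) <= J i)%VS.
  by elim: i => //= i IH; apply: subv_trans (JS i); apply: lie_vsS.
have J0 : J 0%N = 0%VS.
  apply: ssS; last first.
    exists n; apply/eqP; rewrite -subv0; apply: subv_trans (JF n) _.
    by rewrite /J /F rn0 limg0 subvv.
  split=> [|s _ _ /memv_imgP[x xr ->]]; first exact: subvf.
  have [x' xr' E] := idr s x xr; apply/memv_imgP; exists x' => //.
  by rewrite !PE /= E.
move=> x xr; apply/eqP; rewrite -memv0 -J0; apply/memv_imgP; exists x => //.
Qed.

Section DerivationsOfExtension.
Variables (K : fieldType) (charK : [pchar K] =i pred0) (g : lieAlgType K).
Variables (Gam : {vspace 'End(g)}) (s k m nhat : {vspace g}).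
Hypothesis Zg : trivial_center {:g}.
Hypothesis crG : completely_reducible Gam.
Hypothesis gdG : gamma_decomposition Gam s k m.
Hypothesis genN : lie_generated m nhat.
Local Notation B := (gammaB Gam m nhat).
Variable PhiP : lie_law (@Phi K g s k m B).
Local Notation L := (lie_of_law PhiP).
Local Notation S := (sub_lieAlg (gd_subalg_s gdG)).
Local Notation Bt := (sub_lieAlg (@lie_subalg_gammaB K g Gam m nhat)).
Local Notation M := (subvs_of m).
Local Notation iS := (@iS K g Gam s k m nhat gdG PhiP).
Local Notation iB := (@iB K g Gam s k m nhat PhiP).
Local Notation iM := (@iM K g Gam s k m nhat PhiP).
Local Notation cS := (@cS K g Gam s k m nhat gdG PhiP).
Local Notation cB := (@cB K g Gam s k m nhat PhiP).
Local Notation cM := (@cM K g Gam s k m nhat PhiP).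
Local Notation phi0 := (@phi0 K g Gam s k m nhat gdG PhiP).
Local Notation muB := (@muB K g Gam m nhat).
Local Notation tS := (@tS K g Gam s k m nhat PhiP).

Lemma tS_iB_comm f b u : f \in Gam -> tS f (lie (iB b) u) = lie (iB b) (tS f u).
Proof.
move=> fG; apply: (ext_eqP (gdG := gdG)); rewrite !(tSE gdG) ?(lie_iB_cS gdG) ?lie_iB_cB ?(lie_iB_cM gdG) ?compE ?lie0r //.
apply: subvs_inj; rewrite (gammaB_comm gdG genN) ?subvsP // vsprojK //.
by rewrite (gamma_m gdG) ?subvsP.
Qed.

Lemma tS_phi0 f y v : jordan_pair Gam k f y -> tS f (phi0 v) = phi0 (f v).
Proof.
move=> jfy; have [fG yk yf] := jfy.
have [x [y' [z [xs yk' zm ->]]]] := gd_skm gdG v.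
have fx : f x = 0.
  by apply: (semisimple_part_ker (n := 1) yf); rewrite /= adE lieC (lie_sk gdG) ?oppr0.
have fm : f z \in m by apply: (gamma_m gdG).
have [_ _ E3] := cphi0 gdG PhiP xs yk' zm.
have -> : f (x + y' + z) = f z by rewrite !linearD /= fx (gamma_k gdG fG yk') !add0r.
by rewrite (tSE gdG) E3 vsprojK // (phi0_m gdG).
Qed.

Variables (H : lieAlgType K) (j : 'Hom(H, L)) (A : {vspace 'End(M)}).
Hypothesis jM : lie_morphism j.
Hypothesis jinj : lker j = 0%VS.
Hypothesis subA : lie_subalg A.
Hypothesis muA : (mu m @: k <= A)%VS.
Hypothesis AB : (A <= B)%VS.
Hypothesis jA : limg j = (ext_sub s B A : {vspace L}).
Local Notation jv := (j^-1)%VF.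

Lemma jvK u : vsval (cB u : subvs_of B) \in A -> j (jv u) = u.
Proof. by move=> uA; rewrite limg_lfunVK // jA mem_ext_subE. Qed.

Lemma jA_mem w : vsval (cB (j w) : subvs_of B) \in A.
Proof. by rewrite -mem_ext_subE -jA memv_img ?memvf. Qed.

(** The pseudo-inverse of j is meaningful on [limg j] only; [iS x] and the values of [tS f] lie
    there because their B-component is zero. *)
Definition eS : 'Hom(S, H) := (jv \o linfun iS)%VF.
Definition Sh f : 'End(H) := (jv \o (tS f \o j))%VF.

Lemma j_eS x : j (eS x) = iS x.
Proof. by rewrite comp_lfunE lfunE /= jvK // compE mem0v. Qed.

Lemma j_Sh f w : j (Sh f w) = tS f (j w).
Proof. by rewrite !comp_lfunE /= jvK // (tSE gdG) compE mem0v. Qed.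

Lemma eS_lie x y : eS (lie x y) = lie (eS x) (eS y).
Proof.
apply: (lker0_inj jinj); rewrite jM !j_eS; apply: (ext_eqP (gdG := gdG)); rewrite !lie_i_cE ?compE //.
by rewrite ext_a0r.
Qed.

Lemma j_iB b : vsval (b : subvs_of B) \in A -> j (jv (iB b)) = iB b.
Proof. by move=> bA; rewrite jvK // compE. Qed.

Lemma j_iM z : j (jv (iM z)) = iM z.
Proof. by rewrite jvK // compE mem0v. Qed.

Lemma muB_A y : y \in k -> vsval (muB y : subvs_of B) \in A.
Proof. by move=> yk; rewrite (muB_val charK gdG genN) // (subvP muA) // memv_img. Qed.

Lemma semisimple_part_Sh f y : jordan_pair Gam k f y ->
  semisimple_part (ad (jv (iB (muB y)))) (Sh f).
Proof.
move=> jfy; have [_ yk _] := jfy.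
apply: (semisimple_part_sub charK jinj _ _ (semisimple_part_tS charK gdG genN PhiP jfy)) => w.
  by rewrite !adE jM j_iB // muB_A.
exact: j_Sh.
Qed.

Definition derivation (D : 'End(H)) := forall x y, D (lie x y) = lie (D x) y + lie x (D y).

Lemma derivation_add_ad D v : derivation D -> derivation (D + ad v).
Proof.
move=> DL x y; rewrite !add_lfunE !adE DL lie_jacobi lieDl lieDr.
by rewrite !addrA; congr (_ + _); rewrite -!addrA; congr (_ + _); rewrite addrC.
Qed.

(** With e the copy of y in H, v lies in a generalized kernel of [ad e], so [ad v] lies in one of ad
    (ad e) and commutes with the semisimple part. A correction killed by earlier [Sh f] therefore
    does not disturb them. *)
Lemma ad_comm_Sh f y v : jordan_pair Gam k f y -> Sh f v = 0 ->
  forall w, lie v (Sh f w) = Sh f (lie v w).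
Proof.
move=> jfy fv w; have yf := semisimple_part_Sh jfy.
have [n n0] := semisimple_part_nil yf.
rewrite -!adE; apply: (semisimple_part_ad charK yf (n := n)).
have -> : iter n (ad (ad (jv (iB (muB y))))) (ad v) = ad (iter n (ad (jv (iB (muB y)))) v).
  by elim: (n) => //= i ->; rewrite !adE ad_morphism.
by rewrite n0 // linear0.
Qed.

(** D restricted to s is a cocycle with values in H under [ad]; Whitehead's lemma makes it a
    coboundary. *)
Lemma derivation_levi D : derivation D -> exists v, forall x, (D + ad v) (eS x) = 0.
Proof.
move=> DL; have ssS : lie_semisimple S := @gd_semisimple K g Gam s k m gdG.
have [||v vP] := whitehead_cocycle charK ssS (V := H) (rho := (ad \o eS)%VF) (c := (D \o eS)%VF).
- by move=> x y; rewrite !(comp_lfunE ad) eS_lie ad_morphism.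
- move=> x y; rewrite !(comp_lfunE D) !(comp_lfunE ad) eS_lie DL !adE addrC; congr (_ + _).
  by rewrite lieC.
exists v => x; have := vP x; rewrite add_lfunE (comp_lfunE D) (comp_lfunE ad) !adE => ->.
by rewrite (lieC v) subrr.
Qed.

Lemma lie_eS_eB x b : vsval (b : subvs_of B) \in A -> lie (eS x) (jv (iB b)) = 0.
Proof.
move=> bA; apply: (lker0_inj jinj); rewrite jM j_eS j_iB // linear0.
apply: (ext_eqP (gdG := gdG)); rewrite !lie_i_cE ?compE ?lie0r ?ext_a0r //; exact: gdG.
Qed.

Lemma Sh_eB f b : vsval (b : subvs_of B) \in A -> Sh f (jv (iB b)) = 0.
Proof.
by move=> bA; apply: (lker0_inj jinj); rewrite j_Sh j_iB // (tSE gdG) compE !linear0.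
Qed.

Lemma Sh_lie_eB f b w : f \in Gam -> vsval (b : subvs_of B) \in A ->
  Sh f (lie (jv (iB b)) w) = lie (jv (iB b)) (Sh f w).
Proof.
by move=> fG bA; apply: (lker0_inj jinj); rewrite jM !j_Sh j_iB // jM j_iB // tS_iB_comm.
Qed.

(** Z consists of the elements of H killed by s and by the [Sh h] already treated. It contains D1 e
    and is stable under [ad e], so the next correction can be taken in Z and leaves the previous
    conditions intact. *)
Lemma derivation_normalize D (l : seq 'End(g)) : derivation D ->
    (forall f, f \in l -> exists y, jordan_pair Gam k f y) ->
  exists v, (forall x, (D + ad v) (eS x) = 0) /\
    forall f w, f \in l -> (D + ad v) (Sh f w) = Sh f ((D + ad v) w).
Proof.
move=> DL; elim: l => [|f l IH] lP; first by have [v vP] := derivation_levi DL; exists v.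
have [|v [vS vl]] := IH; first by move=> h hl; apply: lP; rewrite inE hl orbT.
have [y jfy] := lP f (mem_head _ _).
have lG h : h \in l -> exists2 y, jordan_pair Gam k h y & h \in Gam.
  by move=> hl; have [|y' jh] := lP h; [rewrite inE hl orbT | exists y' => //; case: jh].
have D1L := derivation_add_ad v DL; move E1 : (D + ad v) vS vl D1L => D1 vS vl D1L.
have [fG yk _] := jfy; have yA := muB_A yk.
pose e := jv (iB (muB y)).
have [Z ZP] : exists Z : {vspace H}, forall u, u \in Z <->
    (forall x, lie (eS x) u = 0) /\ (forall h, h \in l -> Sh h u = 0).
  apply: vspace_of_pred => [|a u u' [uS ul] [uS' ul']].
    by split=> *; rewrite ?lie0r ?linear0.
  split=> [x|h hl]; first by rewrite linearP /= uS uS' scaler0 addr0.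
  by rewrite linearP /= ul // ul' // scaler0 addr0.
have eZ : D1 e \in Z.
  apply/ZP; split=> [x|h hl]; last by rewrite -vl // Sh_eB // linear0.
  have := D1L (eS x) e; rewrite lie_eS_eB // linear0 vS lie0l add0r.
  by move=> <-.
have XZ u : u \in Z -> ad e u \in Z.
  move=> /ZP[uS ul]; apply/ZP; rewrite adE; split=> [x|h hl].
    by rewrite lie_jacobi lie_eS_eB // lie0l uS lie0r addr0.
  have [y' jh hG] := lG h hl.
  by rewrite Sh_lie_eB // ul // lie0r.
(* With a positive exponent, D1 e = a + (ad e)^(p+1) b; adding ad ((ad e)^p b) to D1 leaves exactly
   a as the value at e. *)
have [p p0 fitZ] := fitting 1 XZ; have [a [b [aZ bZ De ea]]] := fitZ _ eZ.
case: p p0 De ea {fitZ} => // p _ De ea.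
pose v' := iter p (ad e) b.
have v'Z : v' \in Z by apply: iter_lfun_mem.
have [v'S v'l] := proj1 (ZP v') v'Z.
pose D2 := D1 + ad v'; have D2L : derivation D2 by apply: derivation_add_ad.
have D2e : D2 e = a.
  by rewrite add_lfunE adE De iterS -/v' adE (lieC v') addrK.
exists (v + v'); have -> : D + ad (v + v') = D2 by rewrite linearD addrA E1.
split=> [x|h w]; first by rewrite add_lfunE vS adE lieC v'S oppr0 addr0.
rewrite inE => /orP[/eqP->|hl]; last first.
  have [y' jh hG] := lG h hl.
  by rewrite !add_lfunE !adE linearD /= -vl // (ad_comm_Sh jh) // v'l.
apply: (semisimple_part_ad charK (semisimple_part_Sh jfy) (n := p.+2)).
(* The starting point is [ad e, D2] = - ad (D2 e) = - ad a, and (ad e)^(p+1) kills a; hence the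
   exponent p + 2. *)
have E i : iter i.+1 (ad (ad e)) D2 = - ad (iter i (ad e) a).
  elim: i => [|i IHi]; last by rewrite iterS IHi linearN /= !adE ad_morphism.
  apply/lfunP=> u; rewrite /= adE gl_lieE opp_lfunE !adE D2L D2e.
  by rewrite opprD addrCA subrr addr0.
by rewrite E ea linear0 oppr0.
Qed.

Lemma Sh_linear w : linear (fun f => Sh f w).
Proof.
move=> a f h; apply: (lker0_inj jinj); rewrite linearP /= !j_Sh !(tSE gdG) -linearP.
by rewrite -linearP add_lfunE scale_lfunE.
Qed.

(** [Sh f] is linear in f, so the finitely many f in a basis of T suffice. *)
Lemma derivation_normalized D : derivation D ->
  exists v, (forall x, (D + ad v) (eS x) = 0) /\
    forall f y, jordan_pair Gam k f y -> forall w, (D + ad v) (Sh f w) = Sh f ((D + ad v) w).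
Proof.
move=> DL; have [T [TP defG _]] := gd_Gam gdG.
have lP (f : 'End(g)) : f \in (vbasis T : seq _) -> exists y, jordan_pair Gam k f y.
  move=> /vbasis_mem fT; have /TP[y yk yf] := fT; exists y; split=> //.
  by rewrite defG (subvP (addvSr _ _)).
have [v [vS vl]] := derivation_normalize DL lP; exists v; split=> // f y [_ yk yf].
have /coord_vbasis fE : f \in T by apply/TP; exists y.
have [U UP] : exists U : {vspace 'End(g)}, forall f, f \in U <->
    forall w, (D + ad v) (Sh f w) = Sh f ((D + ad v) w).
  apply: vspace_of_pred => [w|a h h' hP hP' w].
    have S0 u : Sh 0 u = 0.
      by apply: (lker0_inj jinj); rewrite j_Sh (tSE gdG) zero_lfunE !linear0.
    by rewrite !S0 linear0.
  by rewrite !(Sh_linear _ a h h') linearP /= hP hP'.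
apply/UP; rewrite fE memv_suml // => i _; apply/memvZ/UP => w; apply: vl.
by rewrite mem_nth ?size_tuple.
Qed.

Section NormalizedDerivation.
Variable D : 'End(H).
Hypothesis DL : derivation D.
Hypothesis DS : forall x, D (eS x) = 0.
Hypothesis DSh : forall f y, jordan_pair Gam k f y -> forall w, D (Sh f w) = Sh f (D w).

(** D commutes with s and with each [Sh f]. They kill b, so they kill its image, and an element they
    kill has no s- or m-component. *)
Lemma jD_eB b : vsval (b : subvs_of B) \in A ->
  exists2 b', vsval (b' : subvs_of B) \in A & j (D (jv (iB b))) = iB b'.
Proof.
move=> bA; pose u := j (D (jv (iB b))).
have uS x : lie (iS x) u = 0.
  rewrite -j_eS -jM; have := DL (eS x) (jv (iB b)).
  by rewrite lie_eS_eB // linear0 DS lie0l add0r => <-; rewrite linear0.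
have u0 : cS u = 0.
  apply: (semisimple_center (@gd_semisimple K g Gam s k m gdG)) => x; rewrite lieC.
  by rewrite -lie_iS_cS uS !linear0.
have z0 : cM u = 0.
  apply: subvs_inj; apply: (gamma_inv_m charK crG gdG (subvsP _)).
  apply: (gamma_ind gdG).
  - move=> x xs; have := congr1 cM (uS (vsproj s x)); rewrite lie_iS_cM.
    by move/(congr1 vsval); rewrite (ext_aE gdG) vsprojK // adE.
  - move=> f y jfy; have [fG _ _] := jfy; have := congr1 j (DSh jfy (jv (iB b))).
    rewrite Sh_eB // !linear0 j_Sh (tSE gdG) -/u => /(congr1 cM); rewrite compE.
    move/(congr1 vsval); rewrite (vsprojK (gamma_m gdG fG (subvsP _))) => <-; exact: linear0.
  by move=> f h f0 h0; rewrite add_lfunE f0 h0 addr0.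
exists (cB u); first exact: jA_mem.
by apply: (ext_eqP (gdG := gdG)); rewrite -/u ?u0 ?z0 ?compE.
Qed.

Definition derM : 'End(M) := linfun (cM \o j \o D \o jv \o iM).

Lemma derME z : derM z = cM (j (D (jv (iM z)))).
Proof. by rewrite lfunE. Qed.

Lemma iM_lie_s (x : S) z : lie (iS x) (iM z) = iM (ext_a (x : subvs_of s) z).
Proof. by apply: (ext_eqP (gdG := gdG)); rewrite !lie_i_cE ?compE ?lie0r //; exact: gdG. Qed.

(** m is spanned by Gam m, and D commutes with the action of s and with each [Sh f], whose values
    have no B-component. *)
Lemma cB_jD_eM z : cB (j (D (jv (iM z)))) = 0.
Proof.
pose F : 'Hom(g, Bt) := (linfun (cB \o j \o D \o jv \o iM \o vsproj m))%VF.
have FE v : F v = cB (j (D (jv (iM (vsproj m v))))) by rewrite lfunE.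
have Fz : vsval z \in lker F.
  have mF : (m <= lker F)%VS; last exact: (subvP mF _ (subvsP z)).
  apply: (gamma_m_gen charK crG gdG) => f z' fG z'm; rewrite memv_ker; apply/eqP; move: f fG.
  apply: (gamma_ind gdG).
  - move=> x xs; rewrite FE; pose x' : S := vsproj s x.
    have -> : jv (iM (vsproj m (ad x z'))) = lie (eS x') (jv (iM (vsproj m z'))).
      apply: (lker0_inj jinj); rewrite jM j_eS !j_iM iM_lie_s; congr iM.
      by rewrite /ext_a !vsprojK // adE.
    by rewrite DL DS lie0l add0r jM j_eS lie_iS_cB.
  - move=> f y jfy; rewrite FE.
    have -> : jv (iM (vsproj m (f z'))) = Sh f (jv (iM (vsproj m z'))).
      by apply: (lker0_inj jinj); rewrite j_Sh !j_iM (tSE gdG) compE vsprojK.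
    by rewrite (DSh jfy) j_Sh (tSE gdG) compE.
  by move=> f h f0 h0; rewrite add_lfunE linearD /= f0 h0 addr0.
by move: Fz; rewrite memv_ker FE vsvalK => /eqP.
Qed.

Definition eG : 'Hom(g, H) := (jv \o phi0)%VF.

Lemma j_eG v : j (eG v) = phi0 v.
Proof.
rewrite comp_lfunE jvK // -mem_ext_subE.
have : phi0 v \in limg phi0 by rewrite memv_img ?memvf.
by rewrite (limg_phi0 charK gdG genN) !mem_ext_subE => /(subvP muA).
Qed.

Lemma eG_morphism : lie_morphism eG.
Proof.
by move=> v w; apply: (lker0_inj jinj); rewrite jM !j_eG (phi0_morphism charK gdG genN).
Qed.

Lemma eG_s x : x \in s -> eG x = eS (vsproj s x).
Proof. by move=> xs; apply: (lker0_inj jinj); rewrite j_eG j_eS (phi0_s gdG). Qed.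

Lemma eG_m z : z \in m -> eG z = jv (iM (vsproj m z)).
Proof. by move=> zm; apply: (lker0_inj jinj); rewrite j_eG j_iM (phi0_m gdG). Qed.

(** The solvable ideal used is the whole radical m + k of g. Its image has no s-component, and since
    D kills s, the s-components of D on it form an ideal of s. *)
Lemma cS_jD_eM z : cS (j (D (jv (iM z)))) = 0.
Proof.
pose psi : 'Hom(H, S) := linfun (cS \o j).
have psiE w : psi w = cS (j w) by rewrite lfunE.
have [[[_ idr] solr _] _ _ _] := gamma_radical gdG.
rewrite -psiE -(vsvalK z) -eG_m ?subvsP //.
apply: (derivation_solvable_image (r := (m + k)%VS) charK (@gd_semisimple K g Gam s k m gdG)
  eG_morphism _ DL solr); last by rewrite (subvP (addvSl _ _)) ?subvsP.
- by move=> u w; rewrite !psiE jM (cS_lie gdG).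
- move=> v vr; have [yk zm ->] := mem_r_split gdG vr.
  rewrite psiE j_eG; have [] := cphi0 gdG PhiP (mem0v s) yk zm.
  by rewrite add0r linear0.
move=> x v vr; exists (lie (vsval (x : subvs_of s)) v); first by apply: idr; rewrite ?memvf.
rewrite eG_morphism DL !psiE (eG_s (subvsP (x : subvs_of s))) DS lie0l add0r jM j_eS vsvalK.
by rewrite lie_iS_cS.
Qed.

Lemma jD_eM z : j (D (jv (iM z))) = iM (derM z).
Proof.
by apply: (ext_eqP (gdG := gdG)); rewrite ?cS_jD_eM ?cB_jD_eM ?derME ?compE.
Qed.

(** D sends m into m, and m generates nhat, so D stabilizes the copy of nhat in H; carried back by
    [phi0] it is the derivation required by B. It commutes with Gam because D kills s and commutes
    with each [Sh f]. *)
Lemma derM_gammaB : derM \in B.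
Proof.
have [subN mN maxN] := genN.
pose D0 : 'End(g) := (phi0^-1 \o (j \o (D \o eG)))%VF.
have D0E v : D0 v = (phi0^-1)%VF (j (D (eG v))) by rewrite !comp_lfunE.
have phi0I : lker phi0 = 0%VS := phi0_inj charK Zg gdG genN PhiP.
have phi0M := phi0_morphism charK gdG genN PhiP.
have phi0K v : (phi0^-1)%VF (phi0 v) = v.
  by apply: (lker0_inj phi0I); rewrite limg_lfunVK // memv_img ?memvf.
have [W WP] : exists W : {vspace g}, forall v, v \in W <->
    v \in nhat /\ j (D (eG v)) \in (phi0 @: nhat)%VS.
  apply: vspace_of_pred => [|a v w [vN vP] [wN wP]].
    by rewrite mem0v !linear0 mem0v.
  by rewrite memvD ?memvZ // !linearP /= memvD ?memvZ.
have WN : (nhat <= W)%VS.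
  apply: maxN => [a b /WP[aN /memv_imgP[a' aN' Da]] /WP[bN /memv_imgP[b' bN' Db]]|].
    apply/WP; split; first exact: subN.
    rewrite eG_morphism DL linearD /= !jM Da Db !j_eG -!phi0M.
    by rewrite memvD // memv_img // subN.
  apply/subvP=> z zm; apply/WP; split; first exact: (subvP mN).
  rewrite eG_m // jD_eM -(vsvalK (derM _)) -(phi0_m gdG) ?subvsP //.
  by rewrite memv_img // (subvP mN) ?subvsP.
have D0N v : v \in nhat -> D0 v \in nhat /\ phi0 (D0 v) = j (D (eG v)).
  move=> /(subvP WN)/WP[vN /memv_imgP[w wN Dv]].
  by rewrite D0E Dv phi0K.
clearbody D0.
apply/mem_gammaB; exists D0; split.
- split=> [v /D0N[]|v w vN wN] //.
  have [D0v Ev] := D0N v vN; have [D0w Ew] := D0N w wN.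
  apply: (lker0_inj phi0I); have [_ ->] := D0N _ (subN _ _ vN wN).
  by rewrite linearD /= !phi0M Ev Ew eG_morphism DL linearD /= !jM !j_eG.
- move=> f v fG vN; move: f fG; apply: (gamma_ind gdG).
  + move=> x xs; have [D0v Ev] := D0N v vN.
    have xvN : lie x v \in nhat.
      by apply: (nhat_stable genN) => // z zm; apply: (lie_sm gdG).
    apply: (lker0_inj phi0I); rewrite !adE; have [_ ->] := D0N _ xvN.
    by rewrite eG_morphism DL eG_s // DS lie0l add0r jM -Ev -eG_s // j_eG phi0M.
  + move=> f y jfy; have [D0v Ev] := D0N v vN.
    have fvN : f v \in nhat by rewrite (subvP mN) // (jordan_pair_m gdG v jfy).
    apply: (lker0_inj phi0I); have [_ ->] := D0N _ fvN.
    have -> : eG (f v) = Sh f (eG v).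
      by apply: (lker0_inj jinj); rewrite j_Sh !j_eG (tS_phi0 _ jfy).
    by rewrite (DSh jfy) j_Sh -Ev (tS_phi0 _ jfy).
  by move=> f h f0 h0; rewrite !add_lfunE linearD /= f0 h0.
move=> z; have [_ E] := D0N _ (subvP mN _ (subvsP z)).
move: E; rewrite eG_m ?subvsP // vsvalK jD_eM -[in RHS](vsvalK (derM z)) -(phi0_m gdG) ?subvsP //.
by move/(lker0_inj phi0I).
Qed.

(** An element of B is known by its action on m; the Leibniz rule on [b, z] = b z gives that action
    for D b. *)
Lemma jD_eB_bracket b : vsval (b : subvs_of B) \in A ->
  j (D (jv (iB b))) = iB (lie (vsproj B derM : Bt) b) /\ lie derM (vsval (b : subvs_of B)) \in A.
Proof.
move=> bA; have [b' bA' E] := jD_eB bA.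
have iBM (c : Bt) z : lie (iB c) (iM z) = iM (vsval (c : subvs_of B) z).
  by apply: (ext_eqP (gdG := gdG)); rewrite !lie_i_cE ?compE ?lie0r //; exact: gdG.
have Eb : vsval (b' : subvs_of B) = lie derM (vsval (b : subvs_of B)).
  apply/lfunP=> z; rewrite gl_lieE.
  have := congr1 j (DL (jv (iB b)) (jv (iM z))).
  have -> : lie (jv (iB b)) (jv (iM z)) = jv (iM (vsval (b : subvs_of B) z)).
    by apply: (lker0_inj jinj); rewrite jM j_iB // !j_iM iBM.
  rewrite jD_eM linearD /= !jM E jD_eM j_iB // j_iM !iBM -linearD => /(congr1 cM).
  by rewrite !compE => ->; rewrite addrK.
rewrite -Eb; split=> //; rewrite E; congr iB; apply: subvs_inj.
by rewrite sub_lieAlg_val vsprojK ?derM_gammaB.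
Qed.

Lemma normalized_derivation_inner : exists2 u : L,
  u \in (ext_sub s B (normalizer B A) : {vspace L}) & forall w, j (D w) = lie u (j w).
Proof.
exists (iB (vsproj B derM)).
  rewrite mem_ext_subE compE vsprojK ?derM_gammaB //; apply/mem_normalizer.
  split=> [|c cA]; first exact: derM_gammaB.
  have [|_] := jD_eB_bracket (b := vsproj B c : Bt).
    by rewrite vsprojK // (subvP AB).
  by rewrite vsprojK // (subvP AB).
move=> w; rewrite (ext_decomp gdG (j w)).
set x := cS _; set b := cB _; set z := cM _.
have bA : vsval (b : subvs_of B) \in A by apply: jA_mem.
have -> : w = eS x + jv (iB b) + jv (iM z).
  by apply: (lker0_inj jinj); rewrite !linearD /= j_eS j_iB // j_iM -(ext_decomp gdG).
have [E _] := jD_eB_bracket bA.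
rewrite !linearD /= DS linear0 add0r E jD_eM; congr (_ + _); last first.
  by apply: (ext_eqP (gdG := gdG)); rewrite !lie_i_cE ?compE ?lie0r ?vsprojK ?derM_gammaB //; exact: gdG.
have -> : lie (iB (vsproj B derM)) (iS x) = 0.
  by apply: (ext_eqP (gdG := gdG)); rewrite !lie_i_cE ?compE ?lie0r ?linear0 //; exact: gdG.
rewrite -[LHS](addr0 (iB _)) addrC; congr (_ + _).
by apply: (ext_eqP (gdG := gdG)); rewrite !lie_i_cE ?compE ?lie0r ?linear0 //; exact: gdG.
Qed.

End NormalizedDerivation.

Theorem derivation_inner D : derivation D -> exists2 u : L,
  u \in (ext_sub s B (normalizer B A) : {vspace L}) & forall w, j (D w) = lie u (j w).
Proof.
move=> DL; have [v [vS vl]] := derivation_normalized DL.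
have [u uN uE] := normalized_derivation_inner (derivation_add_ad v DL) vS vl.
(* Subtracting j v undoes the correction [ad v]; its B-component lies in A, hence normalizes A. *)
exists (u - j v) => [|w]; last by rewrite lieBl -uE -jM add_lfunE adE linearD addrK.
rewrite memvB //; rewrite mem_ext_subE; apply/mem_normalizer; split=> [|c cA].
  exact: subvsP.
by apply: subA => //; apply: jA_mem.
Qed.

End DerivationsOfExtension.

(** * The derivation tower *)

Section IteratedNormalizers.
Variables (K : fieldType) (G : lieAlgType K) (B A : {vspace G}).
Hypothesis subB : lie_subalg B.

Lemma normalizerS C : lie_subalg C -> (C <= B)%VS -> (C <= normalizer B C)%VS.
Proof.
move=> subC CB; apply/subvP=> x xC; apply/mem_normalizer.
by split=> [|y yC]; [apply: (subvP CB) | apply: subC].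
Qed.

Lemma normalizer_sub C : (normalizer B C <= B)%VS.
Proof. by apply/subvP=> x /mem_normalizer[]. Qed.

Lemma lie_subalg_normalizer C : lie_subalg (normalizer B C).
Proof.
move=> x y /mem_normalizer[xB xC] /mem_normalizer[yB yC]; apply/mem_normalizer.
split=> [|z zC]; first exact: subB.
have -> : lie (lie x y) z = lie x (lie y z) - lie y (lie x z) by rewrite lie_jacobi addrK.
by rewrite memvB ?xC ?yC ?xC.
Qed.

Hypotheses (subA : lie_subalg A) (AB : (A <= B)%VS).
Local Notation N := (iter_normalizer B A).

Lemma iter_normalizerP n : [/\ lie_subalg (N n), (N n <= B)%VS & (A <= N n)%VS].
Proof.
elim: n => [|n [subN NB AN]]; first by split=> //; exact: subvv.
split; [exact: lie_subalg_normalizer | exact: normalizer_sub |].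
exact: subv_trans AN (normalizerS subN NB).
Qed.

Lemma iter_normalizer_ideal n : lie_ideal (N n) (N n.+1).
Proof.
have [subN NB _] := iter_normalizerP n; split; first exact: normalizerS.
by move=> x y /mem_normalizer[_]; apply.
Qed.

Lemma iter_normalizer_stable : exists q, N q.+1 = N q.
Proof.
pose d n := (\dim {:G} - \dim (N n))%N.
have NS n : (N n <= N n.+1)%VS by case: (iter_normalizer_ideal n).
have [n _ dn] := nat_noninc_stable (d := d) (fun n => leq_sub2l _ (dimvS (NS n))) 0.
exists n; apply/eqP; rewrite eq_sym eqEdim NS /=.
have dimle (U : {vspace G}) : (\dim U <= \dim {:G})%N by apply: dimvS; exact: subvf.
by rewrite -(subKn (dimle (N n))) -(subKn (dimle (N n.+1))) -/(d n) -/(d n.+1) dn.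
Qed.

Lemma iter_normalizer_eq q n : N q.+1 = N q -> (q <= n)%N -> N n = N q.
Proof.
move=> Nq /subnKC <-; elim: (n - q)%N => [|i IH]; first by rewrite addn0.
by rewrite addnS /iter_normalizer iterS -/(iter_normalizer B A _) IH.
Qed.

End IteratedNormalizers.

Section DerivationStep.
Variables (K : fieldType) (charK : [pchar K] =i pred0) (g : lieAlgType K).
Variables (Gam : {vspace 'End(g)}) (s k m nhat : {vspace g}).
Hypothesis Zg : trivial_center {:g}.
Hypothesis crG : completely_reducible Gam.
Hypothesis gdG : gamma_decomposition Gam s k m.
Hypothesis genN : lie_generated m nhat.
Local Notation B := (gammaB Gam m nhat).
Variable PhiP : lie_law (@Phi K g s k m B).
Local Notation L := (lie_of_law PhiP).
Local Notation gsub A := (ext_sub s B A : {vspace L}).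
Local Notation phi0 := (@phi0 K g Gam s k m nhat gdG PhiP).

Section Step.
Variables (H : lieAlgType K) (j : 'Hom(H, L)).

Definition ad_comp (u : L) : 'Hom(H, L) := (ad u \o j)%VF.

Lemma ad_comp_is_linear : linear ad_comp.
Proof.
move=> a u v; apply/lfunP=> w; rewrite add_lfunE scale_lfunE !comp_lfunE.
by rewrite linearP add_lfunE scale_lfunE.
Qed.
HB.instance Definition _ := GRing.isLinear.Build K L 'Hom(H, L) _ ad_comp ad_comp_is_linear.

Definition comp_der (D : Der H) : 'Hom(H, L) := (j \o vsval (D : subvs_of _))%VF.

Lemma comp_der_is_linear : linear comp_der.
Proof.
move=> a D D'; apply/lfunP=> w; rewrite add_lfunE scale_lfunE !comp_lfunE.
by rewrite linearP /= add_lfunE scale_lfunE linearP.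
Qed.
HB.instance Definition _ :=
  GRing.isLinear.Build K (Der H) 'Hom(H, L) _ comp_der comp_der_is_linear.

(* If [j] embeds H in L and every derivation of H is the restriction of an
   inner derivation of L, this is the induced embedding of Der H. *)
Definition der_embedding : 'Hom(Der H, L) := ((linfun ad_comp)^-1 \o linfun comp_der)%VF.

Variable A : {vspace 'End(subvs_of m)}.
Hypothesis subA : lie_subalg A.
Hypothesis muA : (mu m @: k <= A)%VS.
Hypothesis AB : (A <= B)%VS.
Hypothesis jM : lie_morphism j.
Hypothesis jinj : lker j = 0%VS.
Hypothesis jA : limg j = gsub A.

Lemma centralizer_limg u : (forall w, lie u (j w) = 0) -> u = 0.
Proof.
move=> uj; apply: (centralizer_phi0 charK crG (gdG := gdG) genN) => v.
have : phi0 v \in limg j.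
  have : phi0 v \in limg phi0 by rewrite memv_img ?memvf.
  by rewrite (limg_phi0 charK gdG genN) jA !mem_ext_subE => /(subvP muA).
by move=> /memv_imgP[w _ ->].
Qed.

Lemma centralizer_eq u v : (forall w, lie u (j w) = lie v (j w)) -> u = v.
Proof.
move=> uv; apply/eqP; rewrite -subr_eq0; apply/eqP; apply: centralizer_limg => w.
by rewrite lieBl uv subrr.
Qed.

(** The element u representing D is unique, because nothing nonzero in L centralizes the image of j;
    so the pseudo-inverse returns u. *)
Lemma der_embeddingP (D : Der H) : der_embedding D \in gsub (normalizer B A) /\
  forall w, j (vsval (D : subvs_of _) w) = lie (der_embedding D) (j w).
Proof.
have /mem_der_on[_ DL] := subvsP (D : subvs_of _).
have DL' x y := DL x y (memvf x) (memvf y).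
have [u uN uE] := derivation_inner charK Zg crG gdG genN jM jinj subA muA AB jA DL'.
suff -> : der_embedding D = u by [].
have Du : linfun comp_der D = linfun ad_comp u.
  by rewrite (lfunE comp_der) (lfunE ad_comp); apply/lfunP=> w; rewrite !comp_lfunE uE adE.
rewrite /der_embedding comp_lfunE Du; apply: centralizer_eq => w.
pose F : 'Hom(L, 'Hom(H, L)) := linfun ad_comp.
have FE v : F v w = lie v (j w) by rewrite (lfunE ad_comp) comp_lfunE adE.
by rewrite -!FE limg_lfunVK // memv_img ?memvf.
Qed.

Lemma der_embedding_ad x : der_embedding (ad_der x) = j x.
Proof.
have [_ E] := der_embeddingP (ad_der x); apply: centralizer_eq => w.
by rewrite -E adE jM.
Qed.

Lemma der_embedding_morphism : lie_morphism der_embedding.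
Proof.
move=> D D'; have [_ E] := der_embeddingP D; have [_ E'] := der_embeddingP D'.
have [_ E2] := der_embeddingP (lie D D'); apply: centralizer_eq => w.
have -> : lie (lie (der_embedding D) (der_embedding D')) (j w) =
    lie (der_embedding D) (lie (der_embedding D') (j w)) -
    lie (der_embedding D') (lie (der_embedding D) (j w)) by rewrite lie_jacobi addrK.
rewrite -E2 -E -E' -!(E, E').
have -> : vsval (lie D D' : subvs_of _) = lie (vsval (D : subvs_of _)) (vsval (D' : subvs_of _)).
  by apply: vsprojK; apply: lie_subalg_Der; apply: subvsP.
by rewrite gl_lieE linearB.
Qed.

Lemma der_embedding_inj : lker der_embedding = 0%VS.
Proof.
apply/eqP; rewrite -subv0; apply/subvP=> D; rewrite memv_ker memv0 => /eqP D0.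
have [_ E] := der_embeddingP D; apply/eqP; apply: subvs_inj; apply/lfunP=> w.
by apply: (lker0_inj jinj); rewrite E D0 lie0l zero_lfunE linear0.
Qed.

Lemma limg_der_embedding : limg der_embedding = gsub (normalizer B A).
Proof.
apply/vspaceP=> u; apply/idP/idP=> [/memv_imgP[D _ ->]|uN].
  by case: (der_embeddingP D).
(* The B-component of a bracket of two elements of m lies in mu(k), hence in A; the rest of the
   B-component is in A by normalization. *)
have uA w : lie u (j w) \in limg j.
  have : j w \in limg j by rewrite memv_img ?memvf.
  rewrite jA !mem_ext_subE cB_lie vsvalD sub_lieAlg_val => jwA; apply: memvD.
    by move: uN; rewrite mem_ext_subE => /mem_normalizer[_]; apply.
  rewrite (ext_beE charK gdG genN); apply: (subvP muA); apply: memv_img; exact: memv_pi.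
pose D : 'End(H) := (j^-1 \o (ad u \o j))%VF.
have DE w : j (D w) = lie u (j w) by rewrite !comp_lfunE limg_lfunVK adE.
have DD : D \in der_on {:H}.
  apply/mem_der_on; split=> [x _|x y _ _]; first exact: memvf.
  by apply: (lker0_inj jinj); rewrite linearD /= !(DE, jM) lie_jacobi.
apply/memv_imgP; exists (Subvs DD : Der H); first exact: memvf.
have [_ E] := der_embeddingP (Subvs DD : Der H); apply: centralizer_eq => w.
by rewrite -E -DE.
Qed.

End Step.
End DerivationStep.

Section Tower.
Variables (K : fieldType) (charK : [pchar K] =i pred0) (g : lieAlgType K).
Variables (Gam : {vspace 'End(g)}) (s k m nhat : {vspace g}).
Hypothesis Zg : trivial_center {:g}.
Hypothesis crG : completely_reducible Gam.
Hypothesis gdG : gamma_decomposition Gam s k m.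
Hypothesis genN : lie_generated m nhat.
Local Notation B := (gammaB Gam m nhat).
Variable PhiP : lie_law (@Phi K g s k m B).
Local Notation L := (lie_of_law PhiP).
Local Notation N := (iter_normalizer B (mu m @: k)%VS).
Local Notation gsub n := (ext_sub s B (N n) : {vspace L}).

Fixpoint tower_embedding n : 'Hom(derivation_tower g n, L) :=
  if n is n'.+1 then der_embedding (tower_embedding n')
  else phi0 gdG PhiP.
Local Notation phi := tower_embedding.

Let subB : lie_subalg B := @lie_subalg_gammaB K g Gam m nhat.
Let NP n : [/\ lie_subalg (N n), (N n <= B)%VS & ((mu m @: k) <= N n)%VS] :=
  iter_normalizerP subB (lie_subalg_mu_k gdG) (mu_k_gammaB charK gdG genN) n.

Lemma tower_embeddingP n :
  [/\ lie_morphism (phi n), lker (phi n) = 0%VS & limg (phi n) = gsub n].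
Proof.
elim: n => [|n [jM jinj jA]] /=.
  split; [exact: (phi0_morphism charK gdG genN) | exact: (phi0_inj charK Zg gdG genN) |].
  exact: (limg_phi0 charK gdG genN).
have [subN NB muN] := NP n; split.
- exact: (der_embedding_morphism charK Zg crG gdG genN subN muN NB jM jinj jA).
- exact: (der_embedding_inj charK Zg crG gdG genN subN muN NB jM jinj jA).
exact: (limg_der_embedding charK Zg crG gdG genN subN muN NB jM jinj jA).
Qed.

Lemma tower_embedding_ad n x : phi n.+1 (ad_der x) = phi n x.
Proof.
have [jM jinj jA] := tower_embeddingP n; have [subN NB muN] := NP n.
exact: (der_embedding_ad charK Zg crG gdG genN subN muN NB jM jinj jA).
Qed.

Lemma tower_embedding0 (x : subvs_of s) (y : subvs_of k) (z : subvs_of m) :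
  phi 0%N (vsval x + vsval y + vsval z) = (x, vsproj B (mu m (vsval y)), z).
Proof.
have [E1 E2 E3] := cphi0 gdG PhiP (subvsP x) (subvsP y) (subvsP z).
apply: (ext_eqP (gdG := gdG)).
- by apply: etrans E1 _; rewrite vsvalK.
- exact: E2.
by apply: etrans E3 _; rewrite vsvalK.
Qed.

Lemma lie_subalg_ext_sub n : lie_subalg (gsub n).
Proof.
have [jM _ <-] := tower_embeddingP n.
by move=> _ _ /memv_imgP[x _ ->] /memv_imgP[y _ ->]; rewrite -jM memv_img ?memvf.
Qed.

Section Stationary.
Variable q : nat.
Hypothesis Nq : N q.+1 = N q.

(** From q on, consecutive embeddings have the same image, and [phi n.+1] after [ad_der] is
    [phi n]. *)
Lemma ad_der_bijective n : (q <= n)%N -> bijective (@ad_der K (derivation_tower g n)).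
Proof.
move=> qn; have [jM jinj jA] := tower_embeddingP n.
have [jM' jinj' jA'] := tower_embeddingP n.+1.
have E : limg (phi n.+1) = limg (phi n).
  by rewrite jA jA' (iter_normalizer_eq Nq qn) (iter_normalizer_eq Nq (leqW qn)).
exists (fun D => ((phi n)^-1)%VF (phi n.+1 D)) => [x|D].
  by apply: (lker0_inj jinj); rewrite tower_embedding_ad limg_lfunVK // memv_img ?memvf.
apply: (lker0_inj jinj'); rewrite tower_embedding_ad limg_lfunVK //.
by rewrite -E memv_img ?memvf.
Qed.

(** A derivation of s + N q + m is carried to stage q of the tower by [phi q]; there it is the
    bracket with an element of s + N (q+1) + m, and N (q+1) = N q. *)
Lemma ext_sub_complete : lie_complete (gsub q).
Proof.
have [jM jinj jA] := tower_embeddingP q; have [subN NB muN] := NP q.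
split=> [u _ uz|D [DU DL]].
  apply: (centralizer_limg charK crG gdG genN muN jA) => w.
  by rewrite uz // -jA memv_img ?memvf.
have jU w : phi q w \in gsub q by rewrite -jA memv_img ?memvf.
pose D' : 'End(derivation_tower g q) := ((phi q)^-1 \o (D \o phi q))%VF.
have D'E w : phi q (D' w) = D (phi q w).
  by rewrite !comp_lfunE limg_lfunVK // jA DU.
have D'L x y : D' (lie x y) = lie (D' x) y + lie x (D' y).
  by apply: (lker0_inj jinj); rewrite linearD /= !(D'E, jM) DL.
have [u uN uE] := derivation_inner charK Zg crG gdG genN jM jinj subN muN NB jA D'L.
exists u => [|y]; first by move: uN; rewrite -[normalizer _ _]/(N q.+1) Nq.
by rewrite -jA => /memv_imgP[w _ ->]; rewrite -D'E uE.
Qed.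

End Stationary.
End Tower.
Theorem theorem3 (K : fieldType) (charK : [pchar K] =i pred0)
    (g : lieAlgType K) (E Gam : {vspace 'End(g)}) (s k m nhat : {vspace g}) :
  trivial_center {:g} ->
  algebraic_hull (limg ad) E ->
  mcr_subalg E Gam ->
  gamma_decomposition Gam s k m ->
  lie_generated m nhat ->
  let B := gammaB Gam m nhat in
  let N := iter_normalizer B (mu m @: k)%VS in
  [/\ lie_subalg B,
      forall n, [/\ lie_subalg (N n), (N n <= B)%VS & lie_ideal (N n) (N n.+1)],
      exists q, N q.+1 = N q
    & exists PhiP : lie_law (@Phi K g s k m B),
      let L := lie_of_law PhiP in
      let gsub n : {vspace L} := ext_sub s B (N n) in
      exists phi : forall n, 'Hom(derivation_tower g n, L),
      [/\ forall n, [/\ lie_subalg (gsub n), lie_morphism (phi n),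
                        lker (phi n) = 0%VS & limg (phi n) = gsub n],
          forall (x : subvs_of s) (y : subvs_of k) (z : subvs_of m),
            phi 0%N (vsval x + vsval y + vsval z)
              = (x, vsproj B (mu m (vsval y)), z),
          forall n (x : derivation_tower g n), phi n.+1 (ad_der x) = phi n x
        & forall q, N q.+1 = N q ->
            [/\ forall n, (q <= n)%N -> N n = N q,
                forall n, (q <= n)%N ->
                  bijective (@ad_der K (derivation_tower g n))
              & lie_complete (gsub q)]]].
Proof.
move=> Zg _ [_ crG _ _] gdG genN B N.
have subB : lie_subalg B := @lie_subalg_gammaB K g Gam m nhat.
have subA := lie_subalg_mu_k gdG; have AB := mu_k_gammaB charK gdG genN.
split=> //.
- move=> n; have [subN NB _] := iter_normalizerP subB subA AB n.
  by split=> //; exact: iter_normalizer_ideal.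
- exact: iter_normalizer_stable.
have PhiP := Phi_lie_law charK crG gdG genN; exists PhiP => L gsub.
exists (tower_embedding gdG PhiP); split.
- move=> n; have [jM jinj jA] := tower_embeddingP charK Zg crG gdG genN PhiP n.
  by split=> //; exact: (@lie_subalg_ext_sub K charK g Gam s k m nhat Zg crG gdG genN PhiP n).
- exact: tower_embedding0.
- exact: (tower_embedding_ad charK Zg crG gdG genN PhiP).
move=> q Nq; split.
- by move=> n; apply: iter_normalizer_eq.
- exact: (ad_der_bijective charK Zg crG gdG genN PhiP Nq).
exact: (ext_sub_complete charK Zg crG gdG genN PhiP Nq).
Qed.
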